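(* Let $p\in\{2,\infty\}$ and assume that there exists a unique invariant probability measure $\mu_{\mathrm{ac}}$ belonging to $L^p(\mathbf{X})$. Let $\mu_{\mathrm{ac}}^\star$ be the unique optimal solution of the problem $$\rho^\star_{\mathrm{ac}} := \sup_{\mu}\Big\{ \int_{\mathbf{X}} d\mu \;:\; \mu \text{ is invariant},\ \|\mu\|_p\le 1,\ \mu\in L^p_+(\mathbf{X})\Big\}.$$ For every integer $r\ge r_{\min}$, let $\mathbf{y}^r$ be an arbitrary optimal solution of the semidefinite program $$\rho^r_{\mathrm{ac}} := \sup_{\mathbf{y}=(y_\alpha)_{|\alpha|\le 2r}} y_0 \quad\text{s.t.}\quad \mathscr{I}_{\mathbf{y}}(\mathbf{x}^\alpha)=0\ \ \forall \alpha\in A_r,\qquad \mathbf{C}^p_r(\mathbf{y})\succeq 0,\qquad \mathbf{M}_{r-r_j}(g_j\,\mathbf{y})\succeq 0,\ \ j=0,1,\dots,m,$$ and, completing it with zeros, consider $\mathbf{y}^r$ as an element of $\mathbb{R}[\mathbf{x}]'$ (i.e. as an infinite sequence indexed by $\mathbb{N}^n$, identified with a linear functional on $\mathbb{R}[\mathbf{x}]$). Then the sequence $(\mathbf{y}^r)_{r\ge r_{\min}}$ converges pointwise to some $\mathbf{y}^\star\in\mathbb{R}[\mathbf{x}]'$, that is, for every fixed $\alpha\in\mathbb{N}^n$, $$\lim_{r\to+\infty} y^r_\alpha = y^\star_\alpha .$$ Moreover, $\mathbf{y}^\star$ has representing measure $\mu_{\mathrm{ac}}^\star$ (i.e. $y^\star_\alpha=\int_{\mathbf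 X} \mathbf{x}^\alpha\,d\mu_{\mathrm{ac}}^\star$ for all $\alpha\in\mathbb{N}^n$), and $$\lim_{r\to+\infty}\rho^r_{\mathrm{ac}}=\rho^\star_{\mathrm{ac}}=\|\mu_{\mathrm{ac}}^\star\|_1 .$$
   Context: Setting. $f=(f_1,\dots,f_n):\mathbb{R}^n\to\mathbb{R}^n$ is a polynomial map and $\mathbf{X}=\{\mathbf{x}\in\mathbb{R}^n: g_1(\mathbf{x})\ge0,\dots,g_m(\mathbf{x})\ge 0\}$ is a compact set, with $g_1,\dots,g_m\in\mathbb{R}[\mathbf{x}]$; $g_0:=1$. Standing assumptions: for some integer $N$, one of the $g_j$ equals $N-\|\mathbf{x}\|_2^2$; and the moments of the Lebesgue measure on $\mathbf{X}$ are available analytically (i.e. are regarded as known). $\lambda$ is the Lebesgue measure and $z_\beta:=\int_{\mathbf{X}}\mathbf{x}^\beta\,d\lambda$, $\mathbf{z}:=(z_\beta)_{\beta\in\mathbb{N}^n}$. $\mathcal{M}_+(\mathbf{X})$ is the set of finite nonnegative Borel measures supported on $\mathbf{X}$. Invariance. Two cases are treated in parallel, and the result holds in each. Discrete time ($\mathbf{x}_{t+1}=f(\mathbf{x}_t)$): $\mu$ is invariant if $f_\#\mu=\mu$, where $f_\#\mu(\mathbf{A})=\mu(\{\mathbf{x}\in\mathbf{X}: f(\mathbf{x})\in\mathbf{A}\})$ for Borel $\mathbf{A}\subseteq\mathbf{X}$. Continuous time ($\dot{\mathbf{x}}=f(\mathbf{x})$): $\mu$ is invariant if $\mathrm{div}(f\mu)=0$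 in the sense of distributions acting on $\mathcal{C}^1(\mathbf{X})$, i.e. $\int_{\mathbf{X}} \mathrm{grad}\,v\cdot f\,d\mu=0$ for all $v\in\mathcal{C}^1(\mathbf{X})$. $L^p$ conventions. $L^p(\mathbf{X})$ (resp. $L^p_+(\mathbf{X})$) is the Lebesgue space (resp. its nonnegative elements) with respect to $\lambda$ on $\mathbf{X}$. For a measure $\mu$ with density $h$ w.r.t. $\lambda$, one writes $\mu\in L^p(\mathbf{X})$ if $h\in L^p(\mathbf{X})$, and $\|\mu\|_p:=\|h\|_p$. Moment notation. $r_j:=\lceil(\deg g_j)/2\rceil$ (so $r_0=0$), $r_{\min}:=\max\{1,r_1,\dots,r_m\}$, $\mathbb{N}^n_d:=\{\beta\in\mathbb{N}^n:|\beta|:=\sum_i\beta_i\le d\}$. For a real sequence $\mathbf{y}$, $\ell_{\mathbf{y}}(\sum_\beta p_\beta\mathbf{x}^\beta):=\sum_\beta p_\beta y_\beta$. $\mathbf{M}_{r-r_j}(g_j\mathbf{y})$ is the symmetric matrix with rows and columns indexed by $\mathbb{N}^n_{r-r_j}$ and $(\beta,\gamma)$ entry $\ell_{\mathbf{y}}(g_j\,\mathbf{x}^{\beta+\gamma})$; $\mathbf{M}_r(\mathbf{y}):=\mathbf{M}_{r-r_0}(g_0\mathbf{y})$ is the moment matrix. $\succeq0$ means positive semidefinite. For a polynomial $q$, $\mathscr{I}_{\mathbf{y}}(q):=\ell_{\mathbf{y}}(q\circ f)-\ell_{\mathbf{y}}(q)$ in discrete time and $\mathscr{I}_{\mathbf{y}}(q):=\ell_{\mathbf{y}}(\mathrm{grad}\,q\cdot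 f)$ in continuous time. $A_r$ is the set of $\alpha\in\mathbb{N}^n_{2r}$ for which $\mathscr{I}_{\mathbf{y}}(\mathbf{x}^\alpha)$ only involves moments of degree at most $2r$, i.e. $\deg(\mathbf{x}^\alpha\circ f)\le 2r$ (discrete time), resp. $\deg(\mathrm{grad}(\mathbf{x}^\alpha)\cdot f)\le 2r$ (continuous time). Finally $$\mathbf{C}^2_r(\mathbf{y}):=\begin{pmatrix}\mathbf{M}_r(\mathbf{z})&\tilde{\mathbf{y}}\\ \tilde{\mathbf{y}}^T&1\end{pmatrix},\quad \tilde{\mathbf{y}}:=(y_\alpha)_{|\alpha|\le r},\qquad \mathbf{C}^\infty_r(\mathbf{y}):=\mathbf{M}_r(\mathbf{z})-\mathbf{M}_r(\mathbf{y}).$$ *)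

(* Defs.v *)
From HB Require Import structures.
From mathcomp Require Import all_boot all_order all_algebra.
From mathcomp Require Import mpoly.
From mathcomp Require Import all_classical all_reals all_analysis.

Set Implicit Arguments.
Unset Strict Implicit.
Unset Printing Implicit Defensive.

Import Order.TTheory GRing.Theory Num.Theory.
Import numFieldNormedType.Exports.

Local Open Scope classical_set_scope.
Local Open Scope ring_scope.

(* Borel sigma-algebra on real matrices, in particular on 'rV[R]_n. *)
Section borel_rV.
Context (R : realType) (m n : nat).
Local Notation T := 'M[R]_(m, n).

Let borel0 : <<s @open T >> set0.
Proof. exact: sigma_algebra0. Qed.

Let borelC (A : set T) : <<s @open T >> A -> <<s @open T >> (~` A).
Proof. by move=> sA; rewrite -setTD; exact: sigma_algebraCD. Qed.

Let borel_bigcup (F : (set T)^nat) :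
  (forall i, <<s @open T >> (F i)) -> <<s @open T >> (\bigcup_i F i).
Proof. exact: sigma_algebra_bigcup. Qed.

HB.instance Definition _ := @isMeasurable.Build
  (sigma_display (@open T)) T <<s @open T >> borel0 borelC borel_bigcup.
End borel_rV.

Section lebesgue_rV.
Context {R : realType}.

Lemma measurable_coord n (i : 'I_n) :
  measurable_fun setT (fun x : 'rV[R]_n => x ord0 i).
Proof.
apply: (measurability _ (measurable_realfun.RGenOpens.measurableE R)) => _ [_ [a [b ->]] <-].
rewrite setTI; apply: sub_sigma_algebra.
by apply: open_comp; [move=> x _; exact: coord_continuous|exact: interval_open].
Qed.

Lemma measurable_fun_rowP d (T : measurableType d) n (f : T -> 'rV[R]_n) :
  (forall i, measurable_fun setT (fun t => f t ord0 i)) ->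
  measurable_fun setT f.
Proof.
move=> mf; apply: (@measurability _ _ _ _ _ _ (@open 'rV[R]_n)) => //.
move=> _ [U oU <-]; rewrite setTI.
pose box (q : 'rV[rat]_n * 'rV[rat]_n) : set 'rV[R]_n :=
  [set x | forall i, ratr (q.1 ord0 i) < x ord0 i < ratr (q.2 ord0 i)].
have -> : U = \bigcup_q (if `[< box q `<=` U >] then box q else set0).
  apply/seteqP; split => [x Ux|x [q _]]; last first.
    by case: asboolP => // qU; exact: qU.
  have /nbhs_ballP[e /= e0 eU] : nbhs x U by exact: open_nbhs_nbhs.
  have lo i : {q : rat | x ord0 i - e < ratr q < x ord0 i}.
    apply: cid; have /rat_in_itvoo[q] : x ord0 i - e < x ord0 i.
      by rewrite ltrBlDr ltrDl.
    by rewrite in_itv/=; exists q.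
  have hi i : {q : rat | x ord0 i < ratr q < x ord0 i + e}.
    apply: cid; have /rat_in_itvoo[q] : x ord0 i < x ord0 i + e by rewrite ltrDl.
    by rewrite in_itv/=; exists q.
  exists (\row_i sval (lo i), \row_i sval (hi i)) => //.
  rewrite asboolT.
    by move=> i; rewrite /= !mxE; move: (svalP (lo i)) (svalP (hi i)) =>
      /andP[_ ->] /andP[->].
  move=> y /= yb; apply: eU; split => // i j; rewrite ord1.
  have := yb j; rewrite /= !mxE => /andP[].
  have /andP[a1 a2] := svalP (lo j); have /andP[b1 b2] := svalP (hi j).
  move=> y1 y2; rewrite /ball/= distrC ltr_distl.
  by rewrite (lt_trans a1 y1) (lt_trans y2 b2).
rewrite preimage_bigcup; apply: countable_bigcupT_measurable => [|q]; first exact: countableP.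
case: asboolP => _; last by rewrite preimage_set0.
have -> : f @^-1` box q = \bigcap_(i in [set: 'I_n])
    ((fun t => f t ord0 i) @^-1` `]ratr (q.1 ord0 i), ratr (q.2 ord0 i)[).
  apply/seteqP; split => [t tb i _|t tb i].
    by rewrite /= in_itv/=; exact: tb.
  by have := tb i Logic.I; rewrite /= in_itv.
apply: fin_bigcap_measurable => // i _.
by rewrite -[X in measurable X]setTI; exact: mf.
Qed.

Definition consrV n (x : measurableTypeR R * 'rV[R]_n) : 'rV[R]_n.+1 :=
  row_mx (x.1%:M : 'rV_1) x.2.

Lemma measurable_consrV n : measurable_fun setT (@consrV n).
Proof.
apply: measurable_fun_rowP => i.
case: (@split_ordP 1 n i) => j ->.
  rewrite (_ : (fun _ => _) = fst); first exact: measurable_fst.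
  by apply/funext => x; rewrite [LHS]row_mxEl mxE (ord1 j).
rewrite (_ : (fun _ => _) = (fun v : 'rV_n => v ord0 j) \o snd).
  exact: (measurableT_comp (measurable_coord j) measurable_snd).
by apply/funext => x; rewrite [LHS]row_mxEr.
Qed.

Definition unconsrV n (x : 'rV[R]_n.+1) : measurableTypeR R * 'rV[R]_n :=
  (x ord0 ord0, \row_j x ord0 (lift ord0 j)).

Lemma measurable_unconsrV n : measurable_fun setT (@unconsrV n).
Proof.
apply: measurable_fun_pair; first exact: measurable_coord.
apply: measurable_fun_rowP => i.
by under eq_fun do rewrite mxE; exact: measurable_coord.
Qed.

Lemma consrVK n : cancel (@consrV n) (@unconsrV n).
Proof.
move=> [a v]; rewrite /unconsrV /consrV; congr pair.
  transitivity (row_mx (a%:M : 'rV_1) v ord0 (lshift n ord0)).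
    by congr (row_mx _ _ _ _); exact: val_inj.
  by rewrite row_mxEl mxE eqxx mulr1n.
apply/rowP => j; rewrite mxE.
transitivity (row_mx (a%:M : 'rV_1) v ord0 (rshift 1 j)).
  by congr (row_mx _ _ _ _); exact: val_inj.
by rewrite row_mxEr.
Qed.

Section step.
Context (n : nat) (mu : {sigma_finite_measure set 'rV[R]_n -> \bar R}).

Definition lebesgue_step : set 'rV[R]_n.+1 -> \bar R :=
  pushforward (lebesgue_measure \x mu)%E (@consrV n).

Let lebesgue_step_measure : {measure set 'rV[R]_n.+1 -> \bar R} :=
  measure_function_pushforward__canonical__measure_function_Measure
    (lebesgue_measure \x mu)%E (@measurable_consrV n).
HB.instance Definition _ := Measure.copy lebesgue_step lebesgue_step_measure.

Let lebesgue_step_sigma_finite : sigma_finite setT lebesgue_step.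
Proof.
have /sigma_finiteP[F [FT ndF Foo]] := sigma_finiteT (@lebesgue_measure R).
have /sigma_finiteP[G [GT ndG Goo]] := sigma_finiteT mu.
exists (fun i => @unconsrV n @^-1` (F i `*` G i)) => [|i].
  apply/esym/seteqP; split => // x _ /=.
  have [i _ Fi] : (\bigcup_i F i) (unconsrV x).1 by rewrite -FT.
  have [j _ Gj] : (\bigcup_i G i) (unconsrV x).2 by rewrite -GT.
  exists (maxn i j) => //; split.
  - by move: Fi; exact/subsetPset/ndF/leq_maxl.
  - by move: Gj; exact/subsetPset/ndG/leq_maxr.
have [mF Fi] := Foo i; have [mG Gi] := Goo i; split.
  rewrite -[X in measurable X]setTI; apply: measurable_unconsrV => //.
  exact: measurableX.
rewrite /lebesgue_step /pushforward -comp_preimage.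
rewrite (_ : _ \o _ = id); last by apply/funext => x /=; rewrite consrVK.
by rewrite preimage_id product_measure1E// lte_mul_pinfty// ge0_fin_numE.
Qed.

HB.instance Definition _ := @Measure_isSigmaFinite.Build _ _ _
  lebesgue_step lebesgue_step_sigma_finite.

End step.

(* Lebesgue measure on the Borel sets of R^n, as an iterated product;
   lebesgueV_box characterizes it. *)
Fixpoint lebesgueV n : {sigma_finite_measure set 'rV[R]_n -> \bar R} :=
  if n is n'.+1 then lebesgue_step (lebesgueV n') else \d_(0 : 'rV[R]_0).

Lemma lebesgueV_box n (A : 'I_n -> set (measurableTypeR R)) :
  (forall i, measurable (A i)) ->
  lebesgueV n [set x | forall i, A i (x ord0 i)] =
  (\prod_(i < n) lebesgue_measure (A i))%E.
Proof.
elim: n A => [|n IHn] A mA.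
  rewrite big_ord0 /= diracE mem_set//= => i; by case: i.
rewrite big_ord_recl -IHn //= /lebesgue_step /pushforward.
rewrite -product_measure1E//; last first.
  rewrite [X in measurable X](_ : _ = \bigcap_(i in [set: 'I_n])
      ((fun x : 'rV[R]_n => x ord0 i) @^-1` A (lift ord0 i))); last first.
    by apply/seteqP; split => [x xA i _|x xA i];
      [exact: xA|exact: (xA i Logic.I)].
  apply: fin_bigcap_measurable => // i _.
  rewrite -[X in measurable X]setTI.
  by apply: measurable_coord => //; exact: mA.
have E1 (a : R) (v : 'rV[R]_n) : consrV (a, v) ord0 ord0 = a.
  by have [] := consrVK (a, v).
have E2 (a : R) (v : 'rV[R]_n) j : consrV (a, v) ord0 (lift ord0 j) = v ord0 j.
  by have [_ /rowP/(_ j)] := consrVK (a, v); rewrite mxE.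
congr ((_ \x _)%E _); apply/seteqP; split => [[a v] /= vA|[a v] /= [aA vA] i].
  by split => [|i]; [rewrite -[a](E1 a v)|rewrite -(E2 a)]; exact: vA.
by case: (unliftP ord0 i) => [j|] ->; rewrite ?E1 ?E2.
Qed.
End lebesgue_rV.

(* Discrete time: x_(t+1) = f(x_t); continuous time: dx/dt = f(x). *)
Inductive dynamics := discrete_time | continuous_time.

Inductive exponent := exponent2 | exponentoo.

Definition exponent_val (R : realType) (p : exponent) : \bar R :=
  if p is exponent2 then 2%:E else +oo%E.

Section measures.
Context {R : realType} {n : nat}.
Implicit Types (X A : set 'rV[R]_n) (f : n.-tuple {mpoly R[n]}).
Implicit Types (mu : {measure set 'rV[R]_n -> \bar R}).

Definition polymap f (x : 'rV[R]_n) : 'rV[R]_n :=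
  \row_i (tnth f i).@[x ord0].

Definition semialgebraic m (g : 'I_m -> {mpoly R[n]}) : set 'rV[R]_n :=
  [set x | forall j, 0 <= (g j).@[x ord0]].

Definition partial_deriv (i : 'I_n) (v : 'rV[R]_n -> R^o) (x : 'rV[R]_n) : R^o :=
  'D_(delta_mx ord0 i) v x.

Definition C1 (v : 'rV[R]_n -> R^o) :=
  (forall x, differentiable v x) /\ (forall i, continuous (partial_deriv i v)).

(* Test functions in C^1(X) are the restrictions to X of C^1 functions on R^n. *)
Definition invariant_measure (dyn : dynamics) f X mu : Prop :=
  match dyn with
  | discrete_time => forall A, measurable A -> A `<=` X ->
      mu [set x | X x /\ A (polymap f x)] = mu A
  | continuous_time => forall v, C1 v ->
      \int[mu]_(x in X) (\sum_(i < n) partial_deriv i v x * polymap f x ord0 i) = 0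
  end.

(* Functions on X are represented by their extension by zero to R^n, so that
   mu is concentrated on X and the L^p norm over R^n is the one over X. *)
Definition is_density X mu (h : 'rV[R]_n -> R) :=
  [/\ measurable_fun setT h,
      forall x, 0 <= h x,
      forall x, ~ X x -> h x = 0 &
      forall A, measurable A -> mu A = (\int[lebesgueV n]_(x in A) (h x)%:E)%E].

Definition in_Lp_plus (p : \bar R) X mu :=
  exists2 h, is_density X mu h & h \in Lfun (lebesgueV n) p.

(* The density is unique almost everywhere; the value is meaningful only when
   mu has a density. *)
Definition ac_density X mu : 'rV[R]_n -> R := xget (cst 0) (is_density X mu).

Definition Lp_norm (p : \bar R) X mu : \bar R :=
  'N[lebesgueV n]_p[EFin \o ac_density X mu]%E.

Definition moment X mu (a : 'X_{1..n}) : R :=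
  \int[mu]_(x in X) ('X_[a] : {mpoly R[n]}).@[x ord0].

Section ac_problem.
Context (dyn : dynamics) (p : \bar R) (f : n.-tuple {mpoly R[n]}).
Context (X : set 'rV[R]_n).

Definition ac_feasible mu :=
  [/\ invariant_measure dyn f X mu, (Lp_norm p X mu <= 1)%E & in_Lp_plus p X mu].

Definition ac_value : \bar R :=
  ereal_sup [set mu X | mu in
    [set mu : {finite_measure set 'rV[R]_n -> \bar R} | ac_feasible mu]].

Definition ac_optimal (mu : {finite_measure set 'rV[R]_n -> \bar R}) :=
  ac_feasible mu /\ mu X = ac_value.
End ac_problem.
End measures.

Section relaxation.
Context {R : realType} {n : nat}.
Implicit Types (q : {mpoly R[n]}) (z : 'X_{1..n} -> R).

Definition psd_mx k (A : 'M[R]_k) :=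
  A^T = A /\ forall u : 'cV[R]_k, 0 <= (u^T *m A *m u) ord0 ord0.

Definition riesz z q : R := \sum_(a <- msupp q) q@_a * z a.

(* Indexed by the multi-indices of degree at most d, enumerated. *)
Definition localizing_matrix d q z : 'M[R]_#|{: 'X_{1..n < d.+1} }| :=
  \matrix_(i, j) riesz z
    (q * 'X_[(bmnm (enum_val i) + bmnm (enum_val j))%MM]).

Definition moment_matrix d z := localizing_matrix d 1 z.

Definition low_moments d z : 'cV[R]_#|{: 'X_{1..n < d.+1} }| :=
  \col_i z (bmnm (enum_val i)).

Definition C2 r zleb z :=
  block_mx (moment_matrix r zleb) (low_moments r z)
           (low_moments r z)^T (1%:M : 'M[R]_1).

Definition Coo r zleb z := moment_matrix r zleb - moment_matrix r z.

Definition C_psd (p : exponent) r zleb z :=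
  match p with
  | exponent2 => psd_mx (C2 r zleb z)
  | exponentoo => psd_mx (Coo r zleb z)
  end.

(* deg q <= d iff msize q <= d.+1, with msize 0 = 0. *)
Definition half_deg q : nat := uphalf (msize q).-1.

Definition r_min m (g : 'I_m -> {mpoly R[n]}) : nat :=
  maxn 1 (\max_(j < m) half_deg (g j)).

(* The polynomial grad q . f. *)
Definition lie_deriv (f : n.-tuple {mpoly R[n]}) q : {mpoly R[n]} := \sum_(i < n) q^`M(i) * tnth f i.

Definition Iop (dyn : dynamics) (f : n.-tuple {mpoly R[n]}) z q : R :=
  match dyn with
  | discrete_time => riesz z (q \mPo f) - riesz z q
  | continuous_time => riesz z (lie_deriv f q)
  end.

Definition A_set (dyn : dynamics) (f : n.-tuple {mpoly R[n]}) r :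
    set 'X_{1..n} :=
  [set a | (mdeg a <= 2 * r)%N /\
    match dyn with
    | discrete_time => (msize ('X_[a] \mPo f) <= (2 * r).+1)%N
    | continuous_time => (msize (lie_deriv f 'X_[a]) <= (2 * r).+1)%N
    end].

Definition truncated_seq r := 'X_{1..n < (2 * r).+1} -> R.

Definition extend0 r (y : truncated_seq r) : 'X_{1..n} -> R :=
  fun a => if insub a is Some b then y b else 0.

Section sdp.
Context (dyn : dynamics) (p : exponent) (f : n.-tuple {mpoly R[n]}).
Context (m : nat) (g : 'I_m -> {mpoly R[n]}) (r : nat).

Let zleb := moment (semialgebraic g) (lebesgueV n).

Definition sdp_feasible (y : truncated_seq r) :=
  [/\ forall a, A_set dyn f r a -> Iop dyn f (extend0 y) 'X_[a] = 0,
      C_psd p r zleb (extend0 y),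
      psd_mx (moment_matrix r (extend0 y)) &
      forall j, psd_mx (localizing_matrix (r - half_deg (g j)) (g j) (extend0 y))].

Definition sdp_value : \bar R :=
  ereal_sup [set (extend0 y 0%MM)%:E | y in sdp_feasible].

Definition sdp_optimal (y : truncated_seq r) :=
  sdp_feasible y /\ (extend0 y 0%MM)%:E = sdp_value.
End sdp.
End relaxation.

(* Main.v *)
(* On a compact X, pass to the limit of the optimal solutions y^r along an
   arbitrary ultrafilter U finer than \oo.  The constraint C^p_r bounds every
   coordinate, so a limit functional l exists, and it bounds l(q)^2 by a constant
   times the integral of q^2 over X.  The L^2 Riesz representation then gives a
   density h of l directly; Putinar's theorem is not needed.  That h >= 0 (and
   h <= 1 if p = oo) follows from l(q^2) >= 0 (resp. from l(q^2) <= z(q^2)) by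
   testing against approximations of the negative part of h (resp. of 1 - h).
   By C^1 Bernstein approximation, the polynomial invariance equations are
   equivalent to invariance of the measure, so l is represented by a feasible
   measure.  Conversely the moments of a feasible measure are feasible for every
   relaxation, hence the mass of l is at least the optimal value.  A feasible
   measure is a multiple of mu_ac, so the optimal measure is mu_ac / |mu_ac|_p and
   it is the measure representing l.  The limit thus does not depend on U, which
   is convergence along \oo. *)

Require Import Defs.
From HB Require Import structures.
From mathcomp Require Import all_boot all_order all_algebra.
From mathcomp Require Import ssrcomplements mpoly.
From mathcomp Require Import all_classical all_reals all_analysis.
From mathcomp Require Import measurable_realfun ess_sup_inf.
From mathcomp Require Import ring lra.

Set Implicit Arguments.
Unset Strict Implicit.
Unset Printing Implicit Defensive.

Import Order.TTheory GRing.Theory Num.Theory.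
Import numFieldNormedType.Exports.

Local Open Scope classical_set_scope.
Local Open Scope ring_scope.

(** * Bernstein approximation in C^1 *)

(** The constant in the L^2 bound on [l] has a different source for each exponent. For p = 2 the
    constraint is a quadratic polynomial in the border coordinate, and its discriminant gives 1. For
    p = oo, Cauchy-Schwarz against the constant polynomial 1, then domination by the Lebesgue
    moments, gives [l 1]. For p = 2 the same constant bounds the norm of [h]. The negative part of
    [h] is not continuous, so it cannot be a test function. The negative parts of polynomials
    tending to [h] in L^2 replace it, which is why the Riesz lemma returns an approximating sequence
    along with [h]. They are admissible because a nonnegative continuous function is the square of
    its root, and squares of polynomials approximate that square uniformly on X. In the C^1
    approximation, a derivative in direction i lowers the Bernstein degree in that coordinate only
    and leaves the nodes in place; hence the weights are studied for degrees D and D - 1 on one grid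
    of mesh 1 / D. Squared L^2 distances are kept below 16^-k, so that most passages to the limit
    become inequalities valid for every k. *)

Section bernstein_basis.
Context {A : comNzRingType}.
Implicit Type s : A.

(* Recursive form of the Bernstein basis 'C(N, k) s^k (1 - s)^(N - k). *)
Fixpoint bern s N k : A :=
  match N, k with
  | O, O => 1
  | O, S _ => 0
  | S N', O => (1 - s) * bern s N' 0%N
  | S N', S k' => s * bern s N' k' + (1 - s) * bern s N' k'.+1
  end.

(** The index [k - 1], extended by 0, lets the recursion and the derivative formula be written
    without a case split on [k]. *)
Definition bern_pred s N k : A := if k is k'.+1 then bern s N k' else 0.

Lemma bernS s N k : bern s N.+1 k = s * bern_pred s N k + (1 - s) * bern s N k.
Proof. by case: k => //=; rewrite mulr0 add0r. Qed.

Lemma bern_gt s N k : (N < k)%N -> bern s N k = 0.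
Proof.
elim: N k => [|N IHN] [|k]//= Nk.
by rewrite !IHN ?mulr0 ?addr0// ltnW.
Qed.

(** Conditioning a binomial expectation on one trial: a success, of probability [s], shifts the
    argument of [phi]. The range [M] is any bound beyond the degree, so that it stays fixed in
    inductions on [N]. *)
Lemma bern_sumS s N M (phi : nat -> A) : (N.+1 < M)%N ->
  \sum_(k < M) bern s N.+1 k * phi k =
  s * (\sum_(k < M) bern s N k * phi k.+1) +
  (1 - s) * \sum_(k < M) bern s N k * phi k.
Proof.
case: M => // M NM; under eq_bigr do rewrite bernS mulrDl.
rewrite big_split/= big_ord_recl/= mulr0 mul0r add0r !mulr_sumr.
rewrite [X in _ = X + _]big_ord_recr/= bern_gt//= mul0r mulr0 addr0.
by congr (_ + _); apply: eq_bigr => i _; rewrite ?mulrA.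
Qed.

Lemma bern_sum1 s N M : (N < M)%N -> \sum_(k < M) bern s N k = 1.
Proof.
elim: N => [|N IHN] NM.
  case: M NM => // M _; rewrite big_ord_recl/= big1 ?addr0//.
under eq_bigr do rewrite -[bern _ _ _]mulr1.
rewrite (bern_sumS s (fun=> 1))//; under eq_bigr do rewrite mulr1.
by rewrite IHN ?(ltnW NM)//; ring.
Qed.

Lemma bern_mean s N M : (N < M)%N ->
  \sum_(k < M) bern s N k * (k%:R - N%:R * s) = 0.
Proof.
elim: N => [|N IHN] NM.
  case: M NM => // M _; rewrite big_ord_recl/= big1 ?addr0//=; first by ring.
  by move=> i _; rewrite mul0r.
rewrite (bern_sumS s (fun k => k%:R - N.+1%:R * s))//.
(* A success moves the deviation by [1 - s] and a failure by [- s]; weighted by [s] and [1 - s], the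
   two shifts cancel. *)
have E c : \sum_(k < M) bern s N k * (k%:R - N%:R * s + c) = c.
  under eq_bigr do rewrite mulrDr.
  by rewrite big_split/= IHN ?(ltnW NM)// -mulr_suml bern_sum1 ?(ltnW NM)//; ring.
rewrite (eq_bigr (fun k : 'I_M => bern s N k * (k%:R - N%:R * s + (1 - s)))).
  rewrite [X in _ + _ * X](eq_bigr (fun k : 'I_M => bern s N k * (k%:R - N%:R * s - s))).
    by rewrite !E; ring.
  by move=> k _; rewrite -[N.+1]addn1 natrD; ring.
by move=> k _; rewrite -[N.+1]addn1 -[k.+1]addn1 !natrD; ring.
Qed.

(** Binomial variance: one more trial adds [s * (1 - s) ^+ 2 + (1 - s) * s ^+ 2], which is
    [s * (1 - s)]. *)
Lemma bern_var s N M : (N < M)%N ->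
  \sum_(k < M) bern s N k * (k%:R - N%:R * s) ^+ 2 = N%:R * (s * (1 - s)).
Proof.
elim: N => [|N IHN] NM.
  case: M NM => // M _; rewrite big_ord_recl/= big1 ?addr0//=; first by ring.
  by move=> i _; rewrite mul0r.
rewrite (bern_sumS s (fun k => (k%:R - N.+1%:R * s) ^+ 2))//.
have E c : \sum_(k < M) bern s N k * (k%:R - N%:R * s + c) ^+ 2 =
    N%:R * (s * (1 - s)) + c ^+ 2.
  rewrite (eq_bigr (fun k : 'I_M => bern s N k * (k%:R - N%:R * s) ^+ 2 +
     (bern s N k * (k%:R - N%:R * s) * (c * 2%:R) + bern s N k * c ^+ 2))); last first.
    by move=> k _; ring.
  rewrite !big_split/= -!mulr_suml IHN ?(ltnW NM)// bern_mean ?(ltnW NM)//.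
  by rewrite bern_sum1 ?(ltnW NM)//; ring.
rewrite (eq_bigr (fun k : 'I_M => bern s N k * (k%:R - N%:R * s + (1 - s)) ^+ 2)).
  rewrite [X in _ + _ * X](eq_bigr (fun k : 'I_M => bern s N k * (k%:R - N%:R * s - s) ^+ 2)).
    by rewrite !E -[N.+1]addn1 natrD; ring.
  by move=> k _; rewrite -[N.+1]addn1 natrD; ring.
by move=> k _; rewrite -[N.+1]addn1 -[k.+1]addn1 !natrD; ring.
Qed.

End bernstein_basis.

(** Applied to evaluation, it identifies the values of a Bernstein polynomial with the Bernstein
    weights of the evaluated coordinate. *)
Lemma rmorph_bern (A B : comNzRingType) (h : {rmorphism A -> B}) s N k :
  h (bern s N k) = bern (h s) N k.
Proof.
elim: N k => [|N IHN] [|k]/=; rewrite ?rmorph0 ?rmorph1//.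
  by rewrite rmorphM rmorphB rmorph1 IHN.
by rewrite rmorphD !rmorphM rmorphB rmorph1 !IHN.
Qed.

Lemma bern_ge0 (R : realDomainType) (t : R) N k : 0 <= t <= 1 -> 0 <= bern t N k.
Proof.
move=> /andP[t0 t1]; have t1' : 0 <= 1 - t by rewrite subr_ge0.
elim: N k => [|N IHN] [|k]//=; first by rewrite mulr_ge0.
by rewrite addr_ge0// mulr_ge0.
Qed.

Lemma mderiv1B (R : comNzRingType) n (i : 'I_n) (s : {mpoly R[n]}) :
  (1 - s)^`M(i) = - s^`M(i).
Proof. by rewrite mderivB -mpolyC1 mderivC sub0r. Qed.

Lemma mderiv_bern (R : comNzRingType) n (i : 'I_n) (s : {mpoly R[n]}) N k :
  (bern s N.+1 k)^`M(i) =
  N.+1%:R * (bern_pred s N k - bern s N k) * s^`M(i).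
Proof.
elim: N k => [|N IHN] k.
  case: k => [|[|k]]/=.
  - by rewrite !mulr1 mul1r sub0r mulN1r mderiv1B.
  - by rewrite mulr0 addr0 mulr1 subr0 !mul1r.
  - by rewrite !mulr0 addr0 subrr mulr0 mul0r mderiv0.
rewrite bernS mderivD !mderivM mderiv1B IHN.
case: k => [|k].
  rewrite [bern_pred _ _ 0]/= mderiv0 [bern s N.+1 0]/= -[N.+2]addn1 natrD; ring.
rewrite [bern_pred s N.+1 _](_ : _ = bern s N.+1 k)//.
rewrite IHN !bernS [bern_pred s N k.+1](_ : _ = bern s N k)//.
by rewrite -[N.+2]addn1 natrD; ring.
Qed.

Arguments bern : simpl never.

(** * Concentration of product Bernstein weights *)

Section product_weights.
Context {R : realType} {n D : nat}.
Hypothesis D0 : (0 < D)%N.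
Variables (a : 'I_n -> nat) (t : 'I_n -> R).
Hypothesis aD : forall j, (D.-1 <= a j <= D)%N.
Hypothesis t01 : forall j, 0 <= t j <= 1.

Let W (k : {ffun 'I_n -> 'I_D.+1}) := \prod_(j < n) bern (t j) (a j) (k j).

Let aD1 j : (a j < D.+1)%N. Proof. by rewrite ltnS; case/andP: (aD j). Qed.

Lemma bern_prod_ge0 k : 0 <= W k.
Proof. by apply: prodr_ge0 => j _; exact: bern_ge0. Qed.

Lemma bern_prod_sum1 : \sum_k W k = 1.
Proof.
rewrite /W -(bigA_distr_bigA (fun j k => bern (t j) (a j) (nat_of_ord k))).
by rewrite big1// => j _; exact: bern_sum1.
Qed.

(** The degree may be D - 1 while the nodes remain k / D. With [d = D - a i], the deviation
    [l - D t] is the centred [l - (a i) t] minus the bias [d t]. The cross term has mean 0, and the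
    variance [(D - d) t (1 - t)] plus the squared bias is at most [(D - d) + d = D]; dividing by D^2
    leaves 1 / D. *)
Lemma bern_prod_var i : \sum_k W k * ((k i)%:R / D%:R - t i) ^+ 2 <= D%:R^-1.
Proof.
(* The squared deviation is absorbed in the factor of coordinate [i], so that the sum over all [k]
   becomes a product of one-dimensional sums, each 1 except the one for [i]. *)
pose F j (l : 'I_D.+1) := bern (t j) (a j) l *
  (if j == i then (l%:R / D%:R - t i) ^+ 2 else 1).
have -> : \sum_k W k * ((k i)%:R / D%:R - t i) ^+ 2 =
    \sum_(k : {ffun 'I_n -> 'I_D.+1}) \prod_j F j (k j).
  apply: eq_bigr => k _; rewrite /F big_split/=; congr (_ * _).
  by rewrite (bigD1 i)//= eqxx big1 ?mulr1// => j /negPf ->.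
rewrite -(bigA_distr_bigA F) (bigD1 i)//= [X in _ * X]big1 ?mulr1; last first.
  move=> j ji; rewrite /F (negPf ji); under eq_bigr do rewrite mulr1.
  exact: bern_sum1.
have Dr : (0 : R) < D%:R by rewrite ltr0n.
set d : R := (D - a i)%:R.
have dE : (a i)%:R = D%:R - d.
  by rewrite /d natrB ?subKr//; case/andP: (aD i).
have d0 : 0 <= d by rewrite ler0n.
have d1 : d <= 1.
  rewrite /d lern1; move: (aD i) D0; case: (D) => //= D' /andP[h _] _.
  by rewrite leq_subLR addn1.
rewrite /F; under eq_bigr do rewrite eqxx.
rewrite (eq_bigr (fun l : 'I_D.+1 => (D%:R ^- 2) *
   (bern (t i) (a i) l * (l%:R - (a i)%:R * t i) ^+ 2
    + (bern (t i) (a i) l * (l%:R - (a i)%:R * t i) * (- 2 * d * t i)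
      + bern (t i) (a i) l * (d * t i) ^+ 2)))); last first.
  move=> l _; rewrite dE; field; exact: lt0r_neq0.
rewrite -mulr_sumr !big_split/= -!mulr_suml bern_var// bern_mean// bern_sum1//.
rewrite mul0r add0r mul1r exprMn.
have /andP[ti0 ti1] := t01 i.
rewrite ler_pdivrMl ?exprn_gt0// expr2 mulfK ?gt_eqF//.
rewrite dE; have h1 : t i * (1 - t i) <= 1 by nra.
have h0 : 0 <= t i * (1 - t i) by nra.
have h2 : d * d <= d by nra.
have h3 : t i * t i <= 1 by nra.
have h4 : 0 <= D%:R - d by rewrite -dE.
have : (D%:R - d) * (t i * (1 - t i)) <= D%:R - d by nra.
rewrite !expr2; nra.
Qed.

End product_weights.

(** Only [x] is confined to [K]; [y] may lie outside it. Compactness is used in its near-covering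
    form, with the radius tending to 0 from the right as the parameter. *)
Lemma compact_unif_continuous (R : realType) (V : normedModType R)
    (K : set V) (F : V -> R) (eps : R) : compact K -> continuous F -> 0 < eps ->
  exists2 d : R, 0 < d & forall x y : V, K x -> ball x d y -> `|F x - F y| <= eps.
Proof.
move=> /compact_near_coveringP cK cF e0.
have := cK R (0^'+) (fun d x => forall y, ball x d y -> `|F x - F y| <= eps) _.
have PF : Filter (0:R)^'+ by exact: at_right_proper_filter.
move=> /(_ PF) [] /=.
  move=> x Kx; have e20 : 0 < eps / 2 by rewrite divr_gt0.
  have /cvgrPdist_lt/(_ _ e20)/nbhs_ballP[d /= d0 dF] := cF x.
  exists (ball x (d / 2), [set r | 0 < r < d / 2]) => /=.
    split; first by apply: nbhsx_ballx; rewrite divr_gt0.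
    near=> r; apply/andP; split; first by near: r; exact: nbhs_right_gt.
    by near: r; apply: nbhs_right_lt; rewrite divr_gt0.
  move=> [x' r]/= [xx' /andP[r0 rd]] y x'y.
  have h1 : `|F x - F x'| < eps / 2.
    apply: dF; apply: le_ball xx'; rewrite ler_pdivrMr// ler_peMr ?ltW//.
    by rewrite ltr1n.
  have h2 : `|F x - F y| < eps / 2.
    apply: dF; rewrite [d]splitr; apply: ball_triangle xx' _.
    by apply: le_ball x'y; exact: ltW.
  have := ler_distD (F x) (F x') (F y); rewrite (distrC (F x') (F x)); lra.
move=> d/= d0 H; exists (d / 2); first by rewrite divr_gt0.
move=> x y Kx; apply: H => //=; last by rewrite divr_gt0.
rewrite sub0r normrN gtr0_norm ?divr_gt0// ltr_pdivrMr// ltr_pMr// ltr1n//.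
Unshelve. all: by end_near. Qed.

Definition cube (R : realType) n (B : R) : set 'rV[R]_n :=
  [set x | forall i, `|x ord0 i| <= B].

Lemma cube_compact (R : realType) n (B : R) : compact (cube B : set 'rV[R]_n).
Proof.
rewrite (_ : cube B = [set v : 'rV[R]_n | forall i, `[- B, B]%classic (v ord0 i)]).
  by apply: (@rV_compact _ _ (fun=> `[- B, B]%classic)) => _; exact: segment_compact.
by apply/seteqP; split => x xB i; move: (xB i); rewrite /= in_itv/= ler_norml.
Qed.

Lemma coord_le_norm (R : realType) n (x : 'rV[R]_n) i : `|x ord0 i| <= `|x|.
Proof.
rewrite [leRHS]/Num.norm/= mx_normrE; apply/bigmax_geP; right.
by exists (ord0, i).
Qed.

Lemma ball_rV (R : realType) n (x y : 'rV[R]_n) (d : R) : 0 < d ->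
  (forall j, `|x ord0 j - y ord0 j| < d) -> ball x d y.
Proof.
move=> d0 xy; rewrite -ball_normE/= [ltLHS]/Num.norm/= mx_normrE.
by apply/bigmax_ltP; split=> // -[i j] _ /=; rewrite ord1 !mxE.
Qed.

Lemma compact_cube (R : realType) n (K : set 'rV[R]_n) :
  compact K -> exists2 B : R, 0 < B & K `<=` cube B.
Proof.
move=> /compact_bounded [M [_ /(_ (`|M| + 1))]].
have M0 : 0 < `|M| + 1 by rewrite ltr_wpDl.
move=> /(_ _) KM; exists (`|M| + 1) => // x Kx i.
have := KM _ x Kx; rewrite (le_lt_trans (ler_norm M)) ?ltrDl// => /(_ isT).
by move=> /=; apply: le_trans; exact: coord_le_norm.
Qed.

Section bernstein_approx.
Context {R : realType} {n : nat} (B : R) (B0 : 0 < B).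

Definition bern_node D (k : {ffun 'I_n -> 'I_D.+1}) : 'rV[R]_n :=
  \row_j (2%:R * B * (k j)%:R / D%:R - B).

Definition cube_coord (x : 'rV[R]_n) (j : 'I_n) : R := (x ord0 j + B) / (2%:R * B).

Lemma cube_coord01 (x : 'rV[R]_n) j : cube B x -> 0 <= cube_coord x j <= 1.
Proof.
move=> /(_ j); rewrite ler_norml /cube_coord => /andP[h1 h2].
have B2 : 0 < 2%:R * B by rewrite mulr_gt0.
by rewrite divr_ge0 ?(ltW B2)/= ?ler_pdivrMr//; lra.
Qed.

Lemma bern_node_cube D (k : {ffun 'I_n -> 'I_D.+1}) : (0 < D)%N ->
  cube B (bern_node k).
Proof.
move=> D0 i; rewrite mxE ler_norml.
have D0' : (0 : R) < D%:R by rewrite ltr0n.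
have h : (k i)%:R / D%:R <= 1 :> R.
  by rewrite ler_pdivrMr// mul1r ler_nat -ltnS.
have h0 : 0 <= (k i)%:R / D%:R :> R by rewrite divr_ge0 ?ler0n.
rewrite -(mulrA (2%:R * B)); move: h h0; set w := (_ / D%:R) => h h0.
have h2 : 0 <= B * w by rewrite mulr_ge0// ltW.
have h3 : B * w <= B by rewrite ger_pMr.
by rewrite -mulrA; apply/andP; split; lra.
Qed.

(** One estimate for a function and for its derivatives. The value attached to a node may be sampled
    at a point [s] within one mesh of it, as the mean value theorem will provide, and nothing is
    asked at nodes of weight 0, which disposes of the last node of a grid line. The proof is
    Chebyshev's inequality for the product weights. *)
Lemma bern_kernel (F : 'rV[R]_n -> R) (eps : R) : continuous F -> 0 < eps ->
  exists D0 : nat, forall D, (D0 <= D)%N -> (0 < D)%N ->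
  forall (a : 'I_n -> nat), (forall j, (D.-1 <= a j <= D)%N) ->
  forall (G : {ffun 'I_n -> 'I_D.+1} -> R) x, cube B x ->
  (forall k : {ffun 'I_n -> 'I_D.+1}, \prod_(j < n) bern (cube_coord x j) (a j) (k j) != 0 ->
    exists s, [/\ cube B s, forall j, `|s ord0 j - bern_node k ord0 j| <= 2%:R * B / D%:R &
      G k = F s]) ->
  `|\sum_(k : {ffun 'I_n -> 'I_D.+1}) (\prod_(j < n) bern (cube_coord x j) (a j) (k j)) * G k - F x| <= eps.
Proof.
move=> cF e0.
have e20 : 0 < eps / 2 by rewrite divr_gt0.
have [d d0 dF] := compact_unif_continuous (@cube_compact R n B) cF e20.
have /compact_bounded [M0 [_ HM]] : compact (F @` (cube B)).
  by apply: continuous_compact; [exact: continuous_subspaceT|exact: cube_compact].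
pose M : R := `|M0| + 1.
have M1 : 0 < M by rewrite ltr_wpDl.
have {}HM x : cube B x -> `|F x| <= M.
  move=> Bx; apply: (HM M); last by exists x.
  by rewrite (le_lt_trans (ler_norm M0))// ltrDl.
(* Chosen so that [c * (d / 2) ^+ 2 = 2 * M], the largest possible value of [|F s - F x|]. *)
pose c : R := (8%:R * M / d ^+ 2).
have c0 : 0 < c by rewrite /c divr_gt0 ?mulr_gt0// exprn_gt0.
(* For [D] beyond this threshold the mesh [2 * B / D] is at most [d / 2], and the sum of the [n]
   variances, rescaled to the cube and multiplied by [c], is at most [eps / 2]. *)
pose e1 : R := n%:R * c * (4%:R * B ^+ 2) / (eps / 2).
exists (Num.truncn (4%:R * B / d + e1)).+1 => D HD D0 a aD G x Bx HG.
have D0' : (0 : R) < D%:R by rewrite ltr0n.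
have B4 : 0 <= 4%:R * B ^+ 2 by rewrite mulr_ge0// exprn_ge0// ltW.
have e10 : 0 <= e1.
  by rewrite /e1 divr_ge0 ?(ltW e20)// mulr_ge0// mulr_ge0 ?ler0n// ltW.
have HD' : 4%:R * B / d + e1 <= D%:R.
  apply: le_trans (ltW (truncnS_gt _)) _; by rewrite ler_nat.
have Bd0 : 0 < 4%:R * B / d by rewrite divr_gt0// mulr_gt0.
have HD1 : 2%:R * B / D%:R <= d / 2.
  have : 4%:R * B / d <= D%:R by lra.
  rewrite ler_pdivrMr// => h; rewrite ler_pdivrMr//; lra.
have HD2 : n%:R * c * (4%:R * B ^+ 2) / D%:R <= eps / 2.
  have : e1 <= D%:R by lra.
  rewrite /e1 (ler_pdivrMr _ _ e20) => h.
  by rewrite (ler_pdivrMr _ _ D0') [leRHS]mulrC.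
pose W (k : {ffun 'I_n -> 'I_D.+1}) : R := \prod_(j < n) bern (cube_coord x j) (a j) (k j).
change (`|\sum_k W k * G k - F x| <= eps).
have t01 j := @cube_coord01 x j Bx.
rewrite (_ : F x = \sum_k W k * F x); last first.
  by rewrite -mulr_suml /W bern_prod_sum1// mul1r.
rewrite -sumrB.
(* If [s] is close to [x], uniform continuity suffices. Otherwise some coordinate differs by at
   least [d], so the node is at least [d / 2] away from [x] there, and the quadratic term dominates
   [2 * M]. *)
have pt k : `|W k * G k - W k * F x| <= W k * (eps / 2) +
    \sum_j c * (4%:R * B ^+ 2) * (W k * ((k j)%:R / D%:R - cube_coord x j) ^+ 2).
  have [W0|W0] := eqVneq (W k) 0.
    rewrite W0 !mul0r subrr normr0 add0r big1// => j _; by rewrite mul0r mulr0.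
  have Wge0 : 0 <= W k by exact: bern_prod_ge0.
  rewrite -mulrBr normrM ger0_norm// -!mulr_sumr.
  rewrite [X in _ <= _ + X]mulrCA -mulrDr.
  apply: ler_wpM2l => //.
  have [s [Bs sk ->]] := HG k W0.
  set S := \sum_j _.
  have S0 : 0 <= S by apply: sumr_ge0 => j _; rewrite sqr_ge0.
  have [sx|] := pselect (forall j, `|x ord0 j - s ord0 j| < d).
    have h : `|F x - F s| <= eps / 2.
      by apply: dF => //; exact: ball_rV.
    rewrite distrC (le_trans h)// lerDl.
    by rewrite mulr_ge0// mulr_ge0// ltW.
  move=> /existsNP[j /negP]; rewrite -leNgt => jd.
  have h1 : d / 2 <= `|bern_node k ord0 j - x ord0 j|.
    have := ler_distD (bern_node k ord0 j) (x ord0 j) (s ord0 j).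
    rewrite (distrC (bern_node k ord0 j) (s ord0 j)) (distrC (bern_node k ord0 j) (x ord0 j)).
    by have := sk j; lra.
  have h2 : (d / 2) ^+ 2 <= 4%:R * B ^+ 2 * S.
    rewrite /S (bigD1 j)//=.
    have -> : (k j)%:R / D%:R - cube_coord x j = (bern_node k ord0 j - x ord0 j) / (2%:R * B).
      rewrite mxE /cube_coord; field; rewrite !gt_eqF//.
    rewrite mulrDr exprMn exprVn.
    rewrite (_ : 4%:R * B ^+ 2 * _ = (bern_node k ord0 j - x ord0 j) ^+ 2); last first.
      by field; rewrite gt_eqF.
    rewrite -[X in _ <= X + _]real_normK ?num_real//.
    rewrite ler_wpDr//.
      by rewrite (mulr_ge0 B4)// sumr_ge0// => l _; rewrite sqr_ge0.
    by rewrite -expr_div_n lerXn2r ?nnegrE ?divr_ge0 ?(ltW d0).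
  have h3 : `|F s - F x| <= 2%:R * M.
    by have := ler_normB (F s) (F x); have := HM _ Bs; have := HM _ Bx; lra.
  apply: le_trans h3 _; apply: (@le_trans _ _ (c * (d / 2) ^+ 2)).
    rewrite /c le_eqVlt; apply/orP; left; apply/eqP; field; rewrite gt_eqF//.
  apply: (@le_trans _ _ (c * (4%:R * B ^+ 2 * S))); first by rewrite ler_pM2l.
  by rewrite mulrA lerDr ltW.
apply: le_trans (ler_norm_sum _ _ _) _.
apply: le_trans (ler_sum _ (fun k _ => pt k)) _.
rewrite big_split/= -mulr_suml bern_prod_sum1// mul1r exchange_big/=.
rewrite [leRHS]splitr lerD2l.
apply: le_trans HD2.
have -> : n%:R * c * (4%:R * B ^+ 2) / D%:R = \sum_(j < n) c * (4%:R * B ^+ 2) / D%:R.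
  by rewrite sumr_const card_ord -[RHS]mulr_natl; ring.
apply: ler_sum => j _; rewrite -mulr_sumr; apply: ler_wpM2l.
  by rewrite mulr_ge0// ltW.
exact: bern_prod_var.
Qed.


Definition cube_mpoly (j : 'I_n) : {mpoly R[n]} :=
  (2%:R * B)^-1 *: ('X_j + B%:MP).

Lemma meval_cube_mpoly (x : 'rV[R]_n) j : (cube_mpoly j).@[x ord0] = cube_coord x j.
Proof. by rewrite mevalZ mevalD mevalXU mevalC mulrC. Qed.

Lemma mderiv_cube_mpoly i j :
  (cube_mpoly j)^`M(i) = ((i == j)%:R / (2%:R * B))%:MP.
Proof.
rewrite mderivZ mderivD mderivC addr0 mderivX mnmE eq_sym.
have [->|ij] := eqVneq i j; last by rewrite scale0r scaler0 mul0r mpolyC0.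
rewrite (_ : (U_(j) - U_(j))%MM = 0%MM); last by apply/mnmP => l; rewrite mnmBE subnn mnm0E.
by rewrite mpolyX0 !scale1r mul1r alg_mpolyC.
Qed.

Lemma mderiv_prod0 i (J : eqType) (s : seq J) (Q : pred J) (P : J -> {mpoly R[n]}) :
  (forall j, Q j -> (P j)^`M(i) = 0) -> (\prod_(j <- s | Q j) P j)^`M(i) = 0.
Proof.
move=> P0; apply: (big_ind (fun p => p^`M(i) = 0)) => //; first by rewrite -mpolyC1 mderivC.
by move=> p q p0 q0; rewrite mderivM p0 q0 mul0r mulr0 addr0.
Qed.

Definition bern_mpoly D (v : 'rV[R]_n -> R) : {mpoly R[n]} :=
  \sum_(k : {ffun 'I_n -> 'I_D.+1})
    v (bern_node k) *: \prod_j bern (cube_mpoly j) D (k j).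

Lemma meval_bern (s : {mpoly R[n]}) N k (x : 'I_n -> R) : (bern s N k).@[x] = bern s.@[x] N k :> R.
Proof. exact: (rmorph_bern (meval x)). Qed.

Lemma bern_mpolyE D v (x : 'rV[R]_n) : (bern_mpoly D v).@[x ord0] =
  \sum_(k : {ffun 'I_n -> 'I_D.+1})
    (\prod_j bern (cube_coord x j) D (k j)) * v (bern_node k).
Proof.
rewrite /bern_mpoly raddf_sum; apply: eq_bigr => k _.
rewrite [LHS]mevalZ mulrC; congr (_ * _); rewrite rmorph_prod.
by apply: eq_bigr => j _; rewrite /= meval_bern meval_cube_mpoly.
Qed.

(** The next node in direction [i]. The cyclic [ordS] makes the shift a bijection of the index set;
    the index that wraps around carries weight 0 in degree [D]. *)
Definition shift_node D (i : 'I_n) (k : {ffun 'I_n -> 'I_D.+1}) :=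
  [ffun j => if j == i then ordS (k j) else k j].

Lemma shift_node_inj D i : injective (@shift_node D i).
Proof.
move=> k l /ffunP kl; apply/ffunP => j; have := kl j; rewrite !ffunE.
by case: eqP => // _; exact: ordS_inj.
Qed.

(** Summation by parts: the difference of neighbouring basis elements in [mderiv_bern] is moved onto
    [v] by reindexing with [shift_node], which produces difference quotients of [v] over one
    mesh. *)
Lemma mderiv_bern_mpoly D v (x : 'rV[R]_n) i : ((bern_mpoly D.+1 v)^`M(i)).@[x ord0] =
  \sum_(k : {ffun 'I_n -> 'I_D.+2})
    (\prod_j bern (cube_coord x j) (if j == i then D else D.+1) (k j)) *
    (D.+1%:R / (2%:R * B) * (v (bern_node (shift_node i k)) - v (bern_node k))).
Proof.
pose c : R := D.+1%:R / (2%:R * B).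
pose rest (k : {ffun 'I_n -> 'I_D.+2}) : R :=
  \prod_(j | j != i) bern (cube_coord x j) D.+1 (k j).
have -> : ((bern_mpoly D.+1 v)^`M(i)).@[x ord0] =
    \sum_(k : {ffun 'I_n -> 'I_D.+2}) v (bern_node k) *
      (c * (bern_pred (cube_coord x i) D (k i) - bern (cube_coord x i) D (k i))
       * rest k).
  rewrite /bern_mpoly (raddf_sum (mderiv i))/= (raddf_sum (meval (x ord0)))/=.
  apply: eq_bigr => k _; rewrite mderivZ [LHS]mevalZ; congr (_ * _); rewrite (bigD1 i)//= mderivM.
  rewrite mderiv_bern mderiv_cube_mpoly eqxx mderiv_prod0; last first.
    move=> j ji; rewrite mderiv_bern mderiv_cube_mpoly eq_sym (negPf ji) mul0r.
    by rewrite mpolyC0 mulr0.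
  rewrite mulr0 addr0 !mevalM mevalB meval_bern mevalC meval_cube_mpoly.
  rewrite (_ : (bern_pred _ _ _).@[_] = bern_pred (cube_coord x i) D (k i)); last first.
    by case: (nat_of_ord (k i)) => [|l]/=; rewrite ?meval0// meval_bern meval_cube_mpoly.
  rewrite (_ : (D.+1%:R).@[_] = D.+1%:R); last exact: (rmorph_nat (meval _)).
  rewrite rmorph_prod/=; rewrite (eq_bigr (fun j => bern (cube_coord x j) D.+1 (k j))).
    by rewrite /c /rest; ring.
  by move=> j _; rewrite meval_bern meval_cube_mpoly.
have restE (k : {ffun 'I_n -> 'I_D.+2}) : rest (shift_node i k) = rest k.
  by apply: eq_bigr => j ji; rewrite ffunE (negPf ji).
have predE (k : {ffun 'I_n -> 'I_D.+2}) : bern_pred (cube_coord x i) D (shift_node i k i) =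
    bern (cube_coord x i) D (k i).
  rewrite ffunE eqxx /=; case: (ltnP (k i) D.+1) => kD; first by rewrite modn_small.
  have {}kD : nat_of_ord (k i) = D.+1 by apply/eqP; rewrite eqn_leq kD -ltnS ltn_ord.
  by rewrite (_ : (k i).+1 %% D.+2 = 0)%N ?kD ?modnn//= bern_gt.
have -> : \sum_(k : {ffun 'I_n -> 'I_D.+2}) v (bern_node k) *
      (c * (bern_pred (cube_coord x i) D (k i) - bern (cube_coord x i) D (k i))
       * rest k) =
    \sum_(k : {ffun 'I_n -> 'I_D.+2}) v (bern_node k) * c *
      bern_pred (cube_coord x i) D (k i) * rest k -
    \sum_(k : {ffun 'I_n -> 'I_D.+2}) v (bern_node k) * c *
      bern (cube_coord x i) D (k i) * rest k.
  by rewrite -sumrB; apply: eq_bigr => k _; ring.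
rewrite (reindex_inj (@shift_node_inj D.+1 i))/= -sumrB.
apply: eq_bigr => k _; rewrite predE restE (bigD1 i)//= eqxx.
rewrite [in RHS](eq_bigr (fun j => bern (cube_coord x j) D.+1 (k j))).
  by rewrite -/(rest k) -/c; ring.
by move=> j /negPf ->.
Qed.

End bernstein_approx.

Lemma derive_line (R : realType) n (v : 'rV[R]_n -> R^o) (x e : 'rV[R]_n) (th : R) :
  differentiable v (x + th *: e) ->
  is_derive th (1:R) (fun t : R => v (x + t *: e) : R^o) ('D_e v (x + th *: e)).
Proof.
move=> dv0; have dv : derivable v (x + th *: e) e by exact: diff_derivable.
have E : (fun h : R => h^-1 *: (((fun t : R => v (x + t *: e) : R^o) \o shift th) (h *: (1:R)) - v (x + th *: e))) =
  (fun h : R => h^-1 *: ((v \o shift (x + th *: e)) (h *: e) - v (x + th *: e))).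
  apply/funext => h; congr (_ *: (v _ - _)) => /=.
  by rewrite [h%:A]mulr1 scalerDl addrCA.
by split; rewrite /derivable /derive ?E.
Qed.

Section weierstrass.
Context {R : realType} {n : nat} (B : R) (B0 : 0 < B).

(** A single Bernstein polynomial serves [v] and all its partial derivatives, once its degree
    exceeds the thresholds of [bern_kernel] for each of them. *)
Lemma weierstrass_C1 (v : 'rV[R]_n -> R) (eps : R) : C1 v -> 0 < eps ->
  exists q : {mpoly R[n]}, forall x, cube B x ->
    `|q.@[x ord0] - v x| <= eps /\
    forall i, `|(q^`M(i)).@[x ord0] - partial_deriv i v x| <= eps.
Proof.
move=> [dv cv] e0.
have cv0 : continuous v by move=> x; exact/differentiable_continuous/dv.
have [N0 HN0] := bern_kernel B0 cv0 e0.
have [N1 HN1] := choice (fun i => bern_kernel B0 (cv i) e0).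
pose D := (N0 + \sum_i N1 i)%N.
exists (bern_mpoly B D.+1 v) => x Bx; split.
  rewrite bern_mpolyE; apply: (HN0 D.+1 _ _ (fun=> D.+1)) => //.
  - by rewrite /D -addnS leq_addr.
  - by move=> j /=; rewrite leqnn leqnSn.
  move=> k _; exists (bern_node B k); split => //; first exact: bern_node_cube.
  by move=> j; rewrite subrr normr0 divr_ge0// mulr_ge0// ltW.
move=> i; rewrite mderiv_bern_mpoly.
apply: (HN1 i D.+1 _ _ (fun j => if j == i then D else D.+1)) => //.
- by rewrite leqW// /D (bigD1 i)//= addnCA leq_addr.
- by move=> j /=; case: ifP => _; rewrite ?leqnn ?leqnSn.
move=> k W0; pose e : 'rV[R]_n := delta_mx ord0 i.
pose h : R := 2%:R * B / D.+1%:R.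
have h0 : 0 < h by rewrite divr_gt0// mulr_gt0.
(* A node of nonzero weight is not the last one in direction [i], so its shift is a true
   neighbour. *)
have kD : (k i < D.+1)%N.
  rewrite ltnNge; apply/negP => kiD; move/eqP: W0; apply.
  by rewrite (bigD1 i)//= eqxx bern_gt// mul0r.
have nodeE : bern_node B (shift_node i k) = bern_node B k + h *: e.
  apply/rowP => j; rewrite !mxE ffunE eqxx/=.
  case: eqVneq => [->|ji]/=; last by rewrite mulr0 addr0.
  by rewrite modn_small// -[(k i).+1]addn1 natrD mulr1 /h; ring.
(* By the mean value theorem the difference quotient is a value of the partial derivative between
   two neighbouring nodes, as [bern_kernel] allows. *)
have [c /itvP cI E] : exists2 c : R, c \in `]0, h[ &
   v (bern_node B k + h *: e) - v (bern_node B k + 0 *: e) =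
   'D_e v (bern_node B k + c *: e) * (h - 0).
  apply: (@MVT R (fun t => v (bern_node B k + t *: e)) (fun t => 'D_e v (bern_node B k + t *: e))) => //.
    by move=> t _; apply: derive_line.
  apply: continuous_subspaceT => t.
  have := derive_line (dv (bern_node B k + t *: e)) => -[dt _].
  by apply: differentiable_continuous; apply/derivable1_diffP.
have c0 : 0 < c by rewrite cI.
have ch : c < h by rewrite cI.
exists (bern_node B k + c *: e); split.
- move=> j; rewrite !mxE eqxx/=; have := @bern_node_cube _ _ B B0 _ k (ltn0Sn D) j.
  have := @bern_node_cube _ _ B B0 _ (shift_node i k) (ltn0Sn D) j.
  rewrite nodeE !mxE eqxx/=; case: eqP => _ /=; rewrite ?mulr0 ?addr0// !mulr1.
  set w := (_ - B); rewrite !ler_norml => /andP[h1 h2] /andP[h3 h4].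
  by apply/andP; split; lra.
- move=> j; rewrite mxE addrAC subrr add0r !mxE eqxx/=.
  case: eqP => _ /=; rewrite ?mulr0 ?normr0 ?(ltW h0)// mulr1 ger0_norm ?ltW//.
- rewrite nodeE; rewrite scale0r addr0 subr0 in E; rewrite E /partial_deriv -/e.
  by rewrite mulrCA -invf_div mulVf ?mulr1// gt_eqF.
Qed.

Lemma weierstrass_C0 (v : 'rV[R]_n -> R) (eps : R) : continuous v -> 0 < eps ->
  exists q : {mpoly R[n]}, forall x, cube B x -> `|q.@[x ord0] - v x| <= eps.
Proof.
move=> cv e0.
have [D HD] := bern_kernel B0 cv e0.
exists (bern_mpoly B D.+1 v) => x Bx.
rewrite bern_mpolyE; apply: (HD D.+1 _ _ (fun=> D.+1)) => //.
  by move=> j /=; rewrite leqnn leqnSn.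
move=> k _; exists (bern_node B k); split => //; first exact: bern_node_cube.
by move=> j; rewrite subrr normr0 divr_ge0// mulr_ge0// ltW.
Qed.

End weierstrass.

Lemma mpoly_ring_ind (R : comNzRingType) n (P : {mpoly R[n]} -> Prop) :
  (forall c, P c%:MP) -> (forall i, P 'X_i) ->
  (forall p q, P p -> P q -> P (p + q)) ->
  (forall p q, P p -> P q -> P (p * q)) -> forall p, P p.
Proof.
move=> PC PX PD PM; elim/mpolyind => [|c m p _ _ Pp]; first by rewrite -mpolyC0.
apply: (PD) => //; rewrite -mul_mpolyC; apply: (PM) => //.
rewrite mpolyXE_id; apply: (big_ind P) => [|p1 p2|i _]; [by rewrite -mpolyC1|exact: (PM)|].
elim: (m i) => [|k IHk]; first by rewrite expr0 -mpolyC1.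
by rewrite exprS; exact: PM.
Qed.

(** * Polynomials as functions on R^n *)

Section mpoly_calculus.
Context {R : realType} {n : nat}.

Lemma mpoly_partial_deriv (q : {mpoly R[n]}) (x : 'rV[R]_n) :
  differentiable (fun x : 'rV[R]_n => q.@[x ord0] : R^o) x /\
  forall i, partial_deriv i (fun x => q.@[x ord0]) x = (q^`M(i)).@[x ord0].
Proof.
elim/mpoly_ring_ind: q x => [c|j|p q IHp IHq|p q IHp IHq] x.
- under eq_fun do rewrite mevalC.
  split=> [|i]; first exact: differentiable_cst.
  by rewrite /partial_deriv derive_cst mderivC meval0.
- under eq_fun do rewrite mevalXU.
  split=> [|i]; first exact: differentiable_coord.
  rewrite /partial_deriv deriveE; last exact: differentiable_coord.
  (* The coordinate is packed as a continuous linear map, which is its own differential. *)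
  pose l : 'rV[R]_n -> R^o := fun N => N ord0 j.
  rewrite (_ : (fun _ => _) = l)//.
  have lin : linear l by move=> a u w; rewrite /l !mxE.
  pose L := GRing.isLinear.Build _ _ _ _ l lin.
  pose LL : {linear 'rV[R]_n -> R^o} := HB.pack l L.
  rewrite -[l]/(LL : _ -> _) diff_lin; last exact: coord_continuous.
  rewrite /LL/= /l mxE mderivX mevalZ mnmE.
  have [->|ij] := eqVneq j i; last by rewrite andbF mul0r.
  rewrite eqxx.
  rewrite (_ : (U_(i) - U_(i))%MM = 0%MM); last by apply/mnmP => k; rewrite mnmBE subnn mnm0E.
  by rewrite mpolyX0 meval1 mulr1.
- under eq_fun do rewrite mevalD.
  have [dp Dp] := IHp x; have [dq Dq] := IHq x.
  split=> [|i]; first exact: differentiableD.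
  rewrite mderivD mevalD -Dp -Dq /partial_deriv.
  by rewrite deriveD//; exact: diff_derivable.
- under eq_fun do rewrite mevalM.
  have [dp Dp] := IHp x; have [dq Dq] := IHq x.
  split=> [|i]; first exact: differentiableM.
  rewrite mderivM mevalD !mevalM -Dp -Dq /partial_deriv.
  rewrite deriveM//; [|exact: diff_derivable|exact: diff_derivable].
  by rewrite addrC [X in X + _]mulrC.
Qed.

Lemma meval_continuous (q : {mpoly R[n]}) :
  continuous (fun x : 'rV[R]_n => q.@[x ord0] : R^o).
Proof. by move=> x; apply: differentiable_continuous; have [] := mpoly_partial_deriv q x. Qed.

Lemma meval_C1 (q : {mpoly R[n]}) : C1 (fun x : 'rV[R]_n => q.@[x ord0] : R^o).
Proof.
split=> [x|i]; first by have [] := mpoly_partial_deriv q x.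
rewrite (_ : partial_deriv _ _ = fun x => (q^`M(i)).@[x ord0]).
  exact: meval_continuous.
by apply/funext => x; have [_ ->] := mpoly_partial_deriv q x.
Qed.

Lemma measurable_continuous (phi : 'rV[R]_n -> R) :
  continuous phi -> measurable_fun setT phi.
Proof.
move=> cphi.
apply: (measurability _ (measurable_realfun.RGenOpens.measurableE R)) => _ [_ [a [b ->]] <-].
rewrite setTI; apply: sub_sigma_algebra.
by apply: open_comp; [move=> x _; exact: cphi|exact: interval_open].
Qed.

Lemma measurable_meval (q : {mpoly R[n]}) :
  measurable_fun setT (fun x : 'rV[R]_n => q.@[x ord0]).
Proof. by apply: measurable_continuous; exact: meval_continuous. Qed.

Lemma measurable_polymap (f : n.-tuple {mpoly R[n]}) : measurable_fun setT (polymap f).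
Proof.
apply: measurable_fun_rowP => i; under eq_fun do rewrite mxE.
exact: measurable_meval.
Qed.

Lemma measurable_closed_rV (K : set 'rV[R]_n) : closed K -> measurable K.
Proof.
move=> cK; rewrite -[K]setCK; apply: measurableC; apply: sub_sigma_algebra.
exact: closed_openC.
Qed.

Lemma compact_bound_fun (K : set 'rV[R]_n) (phi : 'rV[R]_n -> R) :
  compact K -> continuous phi -> exists2 M : R, 0 < M & forall x, K x -> `|phi x| <= M.
Proof.
move=> cK cphi.
have /compact_bounded [M [_ HM]] : compact (phi @` K).
  by apply: continuous_compact => //; exact: continuous_subspaceT.
exists (`|M| + 1); first by rewrite ltr_wpDl.
move=> x Kx; apply: (HM (`|M| + 1)); last by exists x.
by rewrite (le_lt_trans (ler_norm M))// ltrDl.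
Qed.

End mpoly_calculus.

Lemma lebesgueV_cube_fin (R : realType) n (B : R) :
  (lebesgueV n (cube B : set 'rV[R]_n) < +oo)%E.
Proof.
have [B0|B0] := leP 0 B; last first.
  (* For negative [B] the cube is empty, except in dimension 0, where the condition is vacuous and
     the measure is a Dirac mass. *)
  case: n => [|n].
    by rewrite /= diracE; case: (_ \in _); rewrite ltry.
  rewrite (_ : cube B = set0) ?measure0 ?ltry//.
  apply/seteqP; split => // x /(_ ord0) /= xB.
  by have := normr_ge0 (x ord0 ord0); lra.
rewrite (_ : cube B = [set x : 'rV[R]_n | forall i, `[- B, B]%classic (x ord0 i)]).
  rewrite (@lebesgueV_box _ _ (fun=> `[- B, B]%classic))//.
  rewrite -ge0_fin_numE; last by apply: prode_ge0.
  apply: (big_ind (fun x => x \is a fin_num)) => // [x y|i _]; first exact: fin_numM.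
  rewrite lebesgue_measure_itv/=; case: ifP => // _.
by apply/seteqP; split => x xB i; move: (xB i); rewrite /= in_itv/= ler_norml.
Qed.

Lemma compact_lebesgueV_fin (R : realType) n (K : set 'rV[R]_n) :
  compact K -> (lebesgueV n K < +oo)%E.
Proof.
move=> cK; have [B _ KB] := compact_cube cK.
apply: le_lt_trans (lebesgueV_cube_fin n B).
apply: le_measure => //; rewrite inE; apply: measurable_closed_rV.
  exact: (compact_closed (@norm_hausdorff _ _)).
apply: (compact_closed (@norm_hausdorff _ _)); exact: cube_compact.
Qed.

(** * Square-integrable functions and the Riesz representation *)

Section square_integrable.
Context d (T : measurableType d) (R : realType).
Variable mu : {measure set T -> \bar R}.

Definition sqint (u : T -> R) := measurable_fun setT u /\
  mu.-integrable setT (EFin \o (fun x => u x ^+ 2)).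

Lemma measurable_sqr (u : T -> R) : measurable_fun setT u ->
  measurable_fun setT (fun x => (u x ^+ 2)%:E : \bar R).
Proof. by move=> mu'; apply/measurable_EFinP; exact: measurable_funX. Qed.

Lemma sqintP (u : T -> R) : measurable_fun setT u ->
  (\int[mu]_x (u x ^+ 2)%:E < +oo)%E -> sqint u.
Proof.
move=> mu' uoo; split => //; apply/integrableP; split; first exact: measurable_sqr.
by under eq_integral do rewrite gee0_abs ?lee_fin ?sqr_ge0//.
Qed.

Lemma sqint_mul (u v : T -> R) : sqint u -> sqint v ->
  mu.-integrable setT (EFin \o (fun x => u x * v x)).
Proof.
move=> [mu' iu] [mv iv].
have iuv := integrableD measurableT iu iv.
apply: le_integrable iuv => //.
  by apply/measurable_EFinP; exact: measurable_funM.
move=> x _ /=; rewrite lee_fin [leRHS]ger0_norm ?addr_ge0 ?sqr_ge0//.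
rewrite normrM -(real_normK (num_real (u x))) -(real_normK (num_real (v x))).
have := sqr_ge0 (`|u x| - `|v x|); have := normr_ge0 (u x); have := normr_ge0 (v x).
by rewrite !expr2 => a b; nra.
Qed.

Lemma sqintD (u v : T -> R) : sqint u -> sqint v -> sqint (fun x => u x + v x).
Proof.
move=> su sv; have [mu' iu] := su; have [mv iv] := sv.
split; first exact: measurable_funD.
have iuv := integrableZl measurableT 2 (sqint_mul su sv).
have := integrableD measurableT (integrableD measurableT iu iv) iuv.
apply: eq_integrable => // x _ /=; rewrite -EFinM -!EFinD; congr EFin.
by ring.
Qed.

Lemma sqintZ (c : R) (u : T -> R) : sqint u -> sqint (fun x => c * u x).
Proof.
move=> [mu' iu]; split; first exact: measurable_funM.
have := integrableZl measurableT (c ^+ 2) iu.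
by apply: eq_integrable => // x _ /=; rewrite exprMn.
Qed.

Lemma sqintB (u v : T -> R) : sqint u -> sqint v -> sqint (fun x => u x - v x).
Proof.
move=> su sv; have := sqintD su (sqintZ (-1) sv).
by under eq_fun do rewrite mulN1r.
Qed.

Lemma le_sqint (u v : T -> R) : measurable_fun setT u -> sqint v ->
  (forall x, `|u x| <= `|v x|) -> sqint u.
Proof.
move=> mu' [mv iv] uv; split => //; apply: le_integrable iv => //.
  exact: measurable_sqr.
move=> x _ /=; rewrite lee_fin !normrX lerXn2r ?nnegrE//.
Qed.

Definition dotL2 (u v : T -> R) : R := \int[mu]_x (u x * v x).

Lemma dotL2C u v : dotL2 u v = dotL2 v u.
Proof. by rewrite /dotL2; under eq_Rintegral do rewrite mulrC. Qed.

Lemma dotL2D u v w : sqint u -> sqint v -> sqint w ->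
  dotL2 (fun x => u x + v x) w = dotL2 u w + dotL2 v w.
Proof.
move=> su sv sw; rewrite /dotL2; under eq_Rintegral do rewrite mulrDl.
by rewrite RintegralD//; exact: sqint_mul.
Qed.

Lemma dotL2Z c u w : sqint u -> sqint w ->
  dotL2 (fun x => c * u x) w = c * dotL2 u w.
Proof.
move=> su sw; rewrite /dotL2; under eq_Rintegral do rewrite -mulrA.
by rewrite RintegralZl//; exact: sqint_mul.
Qed.

Lemma dotL2B u v w : sqint u -> sqint v -> sqint w ->
  dotL2 (fun x => u x - v x) w = dotL2 u w - dotL2 v w.
Proof.
move=> su sv sw; rewrite /dotL2; under eq_Rintegral do rewrite mulrBl.
by rewrite RintegralB//; exact: sqint_mul.
Qed.

Lemma dotL2_ge0 u : 0 <= dotL2 u u.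
Proof. by apply: Rintegral_ge0 => x _; rewrite -expr2 sqr_ge0. Qed.

Lemma dotL2E u : sqint u -> (dotL2 u u)%:E = (\int[mu]_x (u x ^+ 2)%:E)%E.
Proof.
move=> su; rewrite /dotL2 /Rintegral fineK.
  by apply: eq_integral => x _; rewrite expr2.
by apply: integrable_fin_num => //; exact: sqint_mul.
Qed.

Lemma dotL2_line u w t : sqint u -> sqint w ->
  dotL2 (fun x => u x + t * w x) (fun x => u x + t * w x) =
  dotL2 u u + 2 * t * dotL2 u w + t ^+ 2 * dotL2 w w.
Proof.
move=> su sw; have stw := sqintZ t sw; have suw := sqintD su stw.
rewrite dotL2D// dotL2Z// (dotL2C u) (dotL2C w) !dotL2D// !dotL2Z// (dotL2C w u).
by ring.
Qed.

End square_integrable.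

Lemma quadratic_ge0 (R : realFieldType) (a b c : R) : 0 <= c ->
  (forall t, 0 <= a + 2 * t * b + t ^+ 2 * c) -> b ^+ 2 <= a * c.
Proof.
move=> c0 H.
have [c00|cn0] := eqVneq c 0.
  rewrite c00 mulr0; have [->|bn0] := eqVneq b 0; first by rewrite expr0n.
  (* With [c = 0] the form is affine in [t], and this [t] would give it the value -1. *)
  have := H (- (a + 1) / b / 2); rewrite c00 mulr0 addr0.
  have -> : 2 * (- (a + 1) / b / 2) * b = - (a + 1) by field.
  by lra.
have cp : 0 < c by rewrite lt_neqAle eq_sym cn0.
have := H (- b / c).
have -> : a + 2 * (- b / c) * b + (- b / c) ^+ 2 * c = (a * c - b ^+ 2) / c by field.
by rewrite pmulr_lge0 ?invr_gt0// subr_ge0.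
Qed.

Lemma cauchy_schwarz_L2 d (T : measurableType d) (R : realType)
    (mu : {measure set T -> \bar R}) (u w : T -> R) : sqint mu u -> sqint mu w ->
  dotL2 mu u w ^+ 2 <= dotL2 mu u u * dotL2 mu w w.
Proof.
move=> su sw; apply: quadratic_ge0 => [|t]; first exact: dotL2_ge0.
by rewrite -dotL2_line//; exact: dotL2_ge0.
Qed.

(** * Completeness of L^2 over a set of finite measure *)

Section L2_complete.
Context d (T : measurableType d) (R : realType).
Variable mu : {measure set T -> \bar R}.
Variables (D : set T) (v : nat -> T -> R).
Hypotheses (mD : measurable D) (Doo : (mu D < +oo)%E).
Hypothesis sv : forall k, sqint mu (v k).
Hypothesis v0 : forall k x, ~ D x -> v k x = 0.
Hypothesis vC : forall k j, (k <= j)%N ->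
  (\int[mu]_x ((v j x - v k x) ^+ 2)%:E <= ((16%:R^-1) ^+ k)%:E)%E.

Let S (x : T) : \bar R := (\sum_(k <oo) `|v k.+1 x - v k x|%:E)%E.

Let mdv j k : measurable_fun setT (fun x => v j x - v k x).
Proof. by apply: measurable_funB; [case: (sv j)|case: (sv k)]. Qed.

Let mS : measurable_fun setT S.
Proof.
apply: ge0_emeasurable_sum => [k x _ _|k _]; first by rewrite lee_fin.
by apply/measurable_EFinP; apply: measurableT_comp => //; exact: mdv.
Qed.

(** Young's inequality [w <= c / 2 + w ^+ 2 / (2 c)] on [D] with [c = 4^-k]: since the squares
    integrate to at most 16^-k = c^2, both terms are of order [c]. This is the origin of the rate
    16. *)
Let int_dv k : (\int[mu]_x `|v k.+1 x - v k x|%:E <=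
  (4%:R^-1 ^+ k * (2%:R^-1 * (fine (mu D) + 1)))%:E)%E.
Proof.
pose c : R := 4%:R^-1 ^+ k.
have c0 : 0 < c by rewrite exprn_gt0// invr_gt0.
have mDf : (mu D) = (fine (mu D))%:E by rewrite fineK// ge0_fin_numE.
apply: (@le_trans _ _ (\int[mu]_x ((c / 2)%:E * (\1_D x)%:E + (c^-1 / 2)%:E * ((v k.+1 x - v k x) ^+ 2)%:E)))%E.
  apply: ge0_le_integral => //.
  - by apply/measurable_EFinP; apply: measurableT_comp => //; exact: mdv.
  - apply: emeasurable_funD; apply: measurable_funeM.
      exact/measurable_EFinP/measurable_indic.
    by apply: measurable_sqr; exact: mdv.
  move=> x _; rewrite -!EFinM -EFinD lee_fin indicE.
  have [xD|/negP xD] := boolP (x \in D); last first.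
    by rewrite !v0 ?subrr ?normr0 ?expr0n/= ?mulr0 ?addr0// => Dx; apply: xD; rewrite inE.
  rewrite mulr1 -(real_normK (num_real _)); set w := `|_|.
  have -> : c / 2 + c^-1 / 2 * w ^+ 2 = w + (2 * c)^-1 * (w - c) ^+ 2.
    by field; rewrite gt_eqF.
  by rewrite lerDl mulr_ge0 ?sqr_ge0// invr_ge0 mulr_ge0// ltW.
rewrite ge0_integralD//=; last 4 first.
- by move=> x _; rewrite -EFinM lee_fin mulr_ge0 ?divr_ge0 ?(ltW c0)// indicE; case: (_ \in _).
- by apply: measurable_funeM; exact/measurable_EFinP/measurable_indic.
- by move=> x _; rewrite -EFinM lee_fin mulr_ge0 ?sqr_ge0// divr_ge0// invr_ge0 ltW.
- by apply: measurable_funeM; apply: measurable_sqr; exact: mdv.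
have c20 : (0 <= (c / 2)%:E)%E by rewrite lee_fin divr_ge0// ltW.
have c20' : (0 <= (c^-1 / 2)%:E)%E by rewrite lee_fin divr_ge0// invr_ge0 ltW.
rewrite !ge0_integralZl//; last 3 first.
- by apply: measurable_sqr; exact: mdv.
- by move=> x _; rewrite lee_fin sqr_ge0.
- exact/measurable_EFinP/measurable_indic.
rewrite integral_indic// setIT mDf.
apply: (@le_trans _ _ ((c / 2)%:E * (fine (mu D))%:E + (c^-1 / 2)%:E * ((16%:R^-1) ^+ k)%:E)%E).
  rewrite leeD2l// lee_wpmul2l ?lee_fin ?divr_ge0 ?invr_ge0 ?(ltW c0)//.
  exact: vC.
rewrite -!EFinM -EFinD lee_fin.
have -> : (16%:R^-1 : R) ^+ k = c ^+ 2.
  by rewrite /c -exprM mulnC exprM; congr (_ ^+ _); rewrite expr2; field.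
rewrite -/c le_eqVlt; apply/orP; left; apply/eqP; field; exact: lt0r_neq0.
Qed.

Let int_S : (\int[mu]_x S x < +oo)%E.
Proof.
rewrite /S integral_nneseries//; last first.
  by move=> k; apply/measurable_EFinP; apply: measurableT_comp => //; exact: mdv.
pose K : R := 2%:R^-1 * (fine (mu D) + 1).
have K0 : 0 <= K by rewrite mulr_ge0// addr_ge0// fine_ge0.
apply: (@le_lt_trans _ _ (\sum_(k <oo) (geometric K 4%:R^-1 k)%:E)%E).
  apply: lee_nneseries => [k _ _|k _]; first by apply: integral_ge0 => x _; rewrite lee_fin.
  by rewrite /= [K * _]mulrC; exact: int_dv.
have h4 : `|4%:R^-1 : R| < 1 by rewrite ger0_norm// invf_lt1// ltr1n.
have := @cvg_geometric_series _ K 4%:R^-1 h4.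
move=> cvgK.
have : (fun n => (series (geometric K 4%:R^-1) n)%:E) @ \oo --> (K / (1 - 4%:R^-1))%:E.
  by apply: cvg_EFin => //; exact: nearW.
rewrite (_ : (fun n => _) = fun n => (\sum_(0 <= k < n) (geometric K 4%:R^-1 k)%:E)%E).
  by move=> /cvg_lim ->//; rewrite ltry.
by apply/funext => n /=; rewrite sumEFin.
Qed.

Let S_ae : {ae mu, forall x, S x \is a fin_num}.
Proof.
have iS : mu.-integrable setT S.
  apply/integrableP; split => //; apply: le_lt_trans int_S.
  rewrite le_eqVlt; apply/orP; left; apply/eqP; apply: eq_integral => x _.
  by rewrite gee0_abs// /S nneseries_ge0.
have := integrable_ae measurableT iS.
by apply: filterS => x; apply.
Qed.

Let v_cvg x : S x \is a fin_num -> cvgn (v ^~ x).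
Proof.
move=> Sx.
have : cvgn (series (telescope (v ^~ x))).
  apply: normed_cvg; apply: nondecreasing_is_cvgn.
    by apply: nondecreasing_series => k _ _; rewrite normr_ge0.
  exists (fine (S x)) => _ [k _ <-]; rewrite -lee_fin fineK// /S.
  rewrite /series/= -sumEFin; apply: nneseries_lim_ge => j _ _.
  by rewrite lee_fin.
rewrite telescopeK => cvS.
rewrite (_ : v ^~ x = (fun k => v k x - v 0%N x) + cst (v 0%N x)).
  by apply: is_cvgD => //; exact: is_cvg_cst.
by apply/funext => k; rewrite /= fctE subrK.
Qed.

(** Summable increments in L^1 force convergence almost everywhere. Cutting the sequence off outside
    the measurable set [G] where the series is finite makes it converge at every point, so that the
    limit is measurable and vanishes off [D] everywhere. Fatou's lemma carries the estimate to the
    limit. *)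
Lemma L2_complete : exists h : T -> R, [/\ sqint mu h, forall x, ~ D x -> h x = 0 &
  forall k, (\int[mu]_x ((h x - v k x) ^+ 2)%:E <= ((16%:R^-1) ^+ k)%:E)%E].
Proof.
pose G := [set x | S x \is a fin_num].
have mG : measurable G.
  by rewrite /G -[X in measurable X]setTI; exact: emeasurable_fin_num.
pose w k x := \1_G x * v k x.
pose h x := limn (w ^~ x).
have wh x : w ^~ x @ \oo --> h x.
  have [xG|xG] := pselect (G x).
    rewrite /h /w indicE mem_set//=; under eq_fun do rewrite mul1r.
    exact: v_cvg.
  rewrite /h /w indicE memNset//=; under eq_fun do rewrite mul0r.
  by rewrite lim_cst//; exact: cvg_cst.
have mw k : measurable_fun setT (w k).
  by apply: measurable_funM => //; case: (sv k).
have mh : measurable_fun setT h.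
  by apply: measurable_fun_cvg mw _ => x _; exact: wh.
have mhv k : measurable_fun setT (fun x => h x - v k x).
  by apply: measurable_funB => //; case: (sv k).
have hk k : (\int[mu]_x ((h x - v k x) ^+ 2)%:E <= ((16%:R^-1) ^+ k)%:E)%E.
  pose f j x : \bar R := ((w j x - w k x) ^+ 2)%:E.
  have mf j : measurable_fun setT (f j).
    by apply: measurable_sqr; exact: measurable_funB.
  have f0 j x : setT x -> (0 <= f j x)%E by rewrite lee_fin sqr_ge0.
  have intf j : (\int[mu]_x f j x <= \int[mu]_x ((v j x - v k x) ^+ 2)%:E)%E.
    apply: ge0_le_integral => //; [by move=> x; exact: f0|by apply: measurable_sqr; exact: mdv|].
    move=> x _; rewrite /f /w -mulrBr exprMn lee_fin indicE.
    by case: (_ \in _); rewrite ?expr1n ?mul1r// expr0n mul0r sqr_ge0.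
  have := fatou mu measurableT mf f0.
  rewrite [X in (X <= _)%E -> _](_ : _ = \int[mu]_x ((h x - v k x) ^+ 2)%:E)%E; last first.
    rewrite (eq_integral (fun x => ((h x - w k x) ^+ 2)%:E)); last first.
      move=> x _; suff : f ^~ x @ \oo --> ((h x - w k x) ^+ 2)%:E.
        by move=> /cvg_limn_einf_sup[].
      apply: cvg_EFin; first exact: nearW.
      rewrite /f /= (_ : _ \o _ = fun j => (w j x - w k x) * (w j x - w k x)).
        by rewrite expr2; apply: cvgM; (apply: cvgB; [exact: wh|exact: cvg_cst]).
      by apply/funext => j /=; rewrite expr2.
    apply: ge0_ae_eq_integral => //.
    - by apply: measurable_sqr; exact: measurable_funB.
    - exact: measurable_sqr.
    - by move=> x _; rewrite lee_fin sqr_ge0.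
    - by move=> x _; rewrite lee_fin sqr_ge0.
    apply: filterS S_ae => x Sx _.
    by rewrite /w indicE mem_set// mul1r.
  move=> /le_trans; apply.
  rewrite limn_einf_lim; apply: lime_le; first exact: is_cvg_einfs.
  (* The infimum over indices from [j] on is bounded by its term at [maxn j k], to which [vC]
     applies. *)
  apply: nearW => j; apply: (@le_trans _ _ (\int[mu]_x f (maxn j k) x)%E).
    apply: ereal_inf_lbound; exists (maxn j k) => //=.
    exact: leq_maxl.
  by apply: le_trans (intf _) _; apply: vC; exact: leq_maxr.
exists h; split => //.
  have shv : sqint mu (fun x => h x - v 0%N x).
    by apply: sqintP => //; apply: le_lt_trans (hk 0%N) _; rewrite ltry.
  have := sqintD shv (sv 0%N).
  by under eq_fun do rewrite subrK.
move=> x Dx; rewrite /h /w; under eq_fun do rewrite v0// mulr0.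
by rewrite lim_cst.
Qed.

End L2_complete.

Lemma geometric_le0 (R : realType) (r x c : R) : 0 <= r < 1 ->
  (forall k, x <= r ^+ k * c) -> x <= 0.
Proof.
move=> /andP[r0 r1] xc.
have cv : (fun k : nat => r ^+ k * c) @ \oo --> (0 : R).
  rewrite -[X in _ --> X](mul0r c); apply: cvgMl; apply: cvg_expr.
  by rewrite ger0_norm.
rewrite -(cvg_lim _ cv)//; apply: limr_ge; first by apply/cvg_ex; exists 0.
exact: nearW.
Qed.

Lemma natinv01 (R : realType) (k : nat) : 0 <= (k.+2%:R^-1 : R) < 1.
Proof. by rewrite invr_ge0 ler0n/= invf_lt1// ltr1n. Qed.

Section riesz_L2.
Context d (T : measurableType d) (R : realType).
Variable mu : {measure set T -> \bar R}.
Variables (D : set T) (mD : measurable D) (Doo : (mu D < +oo)%E).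
Variables (V : lmodType R) (ev : V -> T -> R) (l : {scalar V}) (C : R).
Hypothesis ev_lin : forall a u v x, ev (a *: u + v) x = a * ev u x + ev v x.
Hypothesis sev : forall v, sqint mu (ev v).
Hypothesis ev0 : forall v x, ~ D x -> ev v x = 0.
Hypothesis C0 : 0 <= C.
Hypothesis lC : forall v, l v ^+ 2 <= C * dotL2 mu (ev v) (ev v).

(** If [h] represents [l], this is the squared distance from [ev v] to [h], minus the squared norm
    of [h]; minimising it therefore approaches [h] before [h] is known. *)
Let J (v : V) : R := dotL2 mu (ev v) (ev v) - 2 * l v.

Let J_ge v : - C <= J v.
Proof.
have := lC v; have := dotL2_ge0 mu (ev v); rewrite /J.
set s := dotL2 _ _ _; set a := l v => s0 h.
have h2 : (2 * a) ^+ 2 <= (s + C) ^+ 2.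
  by have := sqr_ge0 (s - C); rewrite !expr2 in h *; nra.
have : 2 * a <= s + C.
  rewrite leNgt; apply/negP => h3; have h4 : 0 <= s + C by rewrite addr_ge0.
  by move: h2; rewrite leNgt ltrXn2r ?nnegrE// (le_trans h4)// ltW.
lra.
Qed.

Let evD t u v : ev (u + t *: v) = fun x => ev u x + t * ev v x.
Proof. by apply/funext => x; rewrite addrC ev_lin addrC. Qed.

Let J_line u v t : J (u + t *: v) =
  J u + 2 * t * (dotL2 mu (ev u) (ev v) - l v) + t ^+ 2 * dotL2 mu (ev v) (ev v).
Proof.
have E : l (u + t *: v) = l u + t * l v by rewrite linearD linearZ.
by rewrite /J evD dotL2_line// E; ring.
Qed.

Let m := inf (range J).

Let hasinfJ : has_inf (range J).
Proof. by split; [exists (J 0), 0|exists (- C) => _ [v _ <-]; exact: J_ge]. Qed.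

Let m_le v : m <= J v.
Proof. by apply: (ge_inf (proj2 hasinfJ)); exists v. Qed.

(** The parallelogram identity, with [m] as a lower bound for [J] at the midpoint of [u] and [v]. *)
Let J_par u v : dotL2 mu (fun x => ev u x - ev v x) (fun x => ev u x - ev v x)
  <= 2 * (J u - m) + 2 * (J v - m).
Proof.
have := m_le (u + 2%:R^-1 *: (v - u)); rewrite J_line.
have E : ev (v - u) = fun x => ev v x + (-1) * ev u x by rewrite -scaleN1r evD.
rewrite E (dotL2C mu (ev u)) dotL2D ?dotL2Z//; last exact: sqintZ.
rewrite dotL2_line//.
rewrite (_ : (fun x => ev u x - ev v x) = fun x => ev u x + (-1) * ev v x); last first.
  by apply/funext => x; rewrite mulN1r.
rewrite dotL2_line// (dotL2C mu (ev v) (ev u)) linearB /= /J.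
set a := dotL2 mu (ev u) (ev u); set b := dotL2 mu (ev v) (ev v).
set c := dotL2 mu (ev u) (ev v).
lra.
Qed.

(** A sequence minimising [J] is Cauchy by [J_par], and its limit in L^2 is [h]; [V] itself is not
    complete, so [h] is only a limit of the [ev (q k)]. The vanishing first variation of [J] gives
    the representation. *)
Lemma riesz_L2 : exists (h : T -> R) (q : nat -> V), [/\ sqint mu h,
  forall x, ~ D x -> h x = 0,
  forall v, l v = dotL2 mu (ev v) h,
  dotL2 mu h h <= C &
  forall k, dotL2 mu (fun x => h x - ev (q k) x) (fun x => h x - ev (q k) x)
    <= (16%:R^-1) ^+ k].
Proof.
(* The factor 1 / 4 makes the bound [2 * e k + 2 * e j] of [J_par] at most 16^-k for [k <= j]. *)
pose e (k : nat) : R := 4%:R^-1 * 16%:R^-1 ^+ k.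
have e0 k : 0 < e k by rewrite mulr_gt0 ?invr_gt0// exprn_gt0// invr_gt0.
have eN k j : (k <= j)%N -> e j <= e k.
  by move=> kj; rewrite ler_pM2l ?invr_gt0// ler_wiXn2l// ?invr_ge0// invf_le1// ler1n.
have [q Hq] : exists q : nat -> V, forall k, J (q k) < m + e k.
  have H k : exists v, J v < m + e k.
    by have [_ [v _ <-] vk] := inf_adherent (e0 k) hasinfJ; exists v.
  by exists (fun k => sval (cid (H k))) => k; exact: svalP (cid (H k)).
have qC k j : (k <= j)%N ->
    (\int[mu]_x ((ev (q j) x - ev (q k) x) ^+ 2)%:E <= ((16%:R^-1) ^+ k)%:E)%E.
  move=> kj; rewrite -dotL2E; last exact: sqintB.
  rewrite lee_fin (le_trans (J_par _ _))//.
  have := Hq k; have := Hq j; have := eN _ _ kj; rewrite /e; set w := 16%:R^-1 ^+ k.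
  lra.
have [h [sh h0 hq]] := L2_complete mD Doo (fun k => sev (q k)) (fun k => @ev0 (q k)) qC.
have {}hq k : dotL2 mu (fun x => h x - ev (q k) x) (fun x => h x - ev (q k) x)
    <= (16%:R^-1) ^+ k.
  by rewrite -lee_fin dotL2E//; exact: sqintB.
suff lh v : l v = dotL2 mu (ev v) h.
  exists h, q; split => //.
  set D0 := dotL2 mu h h; have D00 : 0 <= D0 by exact: dotL2_ge0.
  suff : D0 ^+ 2 - C * D0 <= 0.
    move=> h1; rewrite leNgt; apply/negP => CD; have D0p : 0 < D0 by exact: le_lt_trans CD.
    by move: h1; rewrite expr2 -mulrBl pmulr_lle0// subr_le0 leNgt CD.
  (* An upper bound for the square root of [D0], by the arithmetic-geometric mean inequality. *)
  pose K := (1 + D0) / 2.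
  apply: (@geometric_le0 _ 4%:R^-1 _ (2 * D0 * K + C * (2 * K + 1))) => [|k].
    exact: natinv01.
  have seh : sqint mu (fun x => h x - ev (q k) x) by exact: sqintB.
  set t := 4%:R^-1 ^+ k; have t0 : 0 < t by rewrite exprn_gt0// invr_gt0.
  have t1 : t <= 1 by rewrite exprn_ile1 ?invr_ge0// ltW//; case/andP: (@natinv01 R 2).
  pose a := dotL2 mu (fun x => h x - ev (q k) x) h.
  pose b := dotL2 mu (fun x => h x - ev (q k) x) (fun x => h x - ev (q k) x).
  have bt : b <= t * t.
    apply: le_trans (hq k) _; rewrite /t -exprMn lerXn2r ?nnegrE ?mulr_ge0 ?invr_ge0//.
    by rewrite -invfM lef_pV2 ?posrE ?mulr_gt0// -natrM.
  have aD : a ^+ 2 <= t * t * D0.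
    apply: le_trans (cauchy_schwarz_L2 seh sh) _.
    by rewrite -/b -/D0 ler_wpM2r.
  have aK : `|a| <= t * K.
    rewrite -(@ler_pXn2r _ 2)// ?nnegrE ?mulr_ge0 ?(ltW t0) ?divr_ge0 ?addr_ge0//.
    rewrite real_normK ?num_real//; apply: le_trans aD _.
    rewrite exprMn -expr2 ler_wpM2l ?sqr_ge0// /K expr_div_n ler_pdivlMr ?exprn_gt0//.
    by have := sqr_ge0 (1 - D0); rewrite !expr2; nra.
  have qh : dotL2 mu (ev (q k)) h = D0 - a.
    by rewrite /a /D0 dotL2B// opprB addrC subrK.
  have qq : dotL2 mu (ev (q k)) (ev (q k)) = D0 - 2 * a + b.
    have -> : dotL2 mu (ev (q k)) (ev (q k)) =
        dotL2 mu (fun x => h x + (-1) * (h x - ev (q k) x)) (fun x => h x + (-1) * (h x - ev (q k) x)).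
      by congr (dotL2 mu _ _); apply/funext => x; ring.
    by rewrite dotL2_line// (dotL2C mu h) -/a -/b -/D0; ring.
  (* The bound on [l] at [q k] is [(D0 - a) ^+ 2 <= C * (D0 - 2 * a + b)], where [a] and [b] are of
     order [t]; up to such terms it is [D0 ^+ 2 <= C * D0]. *)
  have := lC (q k); rewrite lh qh qq => h5.
  have := ler_norm a; have := ler_norm (- a); rewrite normrN => h6 h7.
  have h8 : D0 * a <= D0 * (t * K) by rewrite ler_wpM2l//; lra.
  have h9 : C * (- 2 * a) <= C * (2 * (t * K)) by rewrite ler_wpM2l//; lra.
  have h10 : C * b <= C * t by rewrite ler_wpM2l// (le_trans bt)// ger_pMl.
  have h11 := sqr_ge0 a.
  have h12 : (D0 - a) ^+ 2 = D0 ^+ 2 - 2 * (D0 * a) + a ^+ 2 by ring.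
  have h13 : C * (D0 - 2 * a + b) = C * D0 + C * (- 2 * a) + C * b by ring.
  have -> : t * (2 * D0 * K + C * (2 * K + 1)) = 2 * (D0 * (t * K)) + C * (2 * (t * K)) + C * t by ring.
  rewrite h12 h13 in h5; lra.
apply/eqP; rewrite -subr_eq0 -normr_eq0; apply/eqP/eqP; rewrite eq_le normr_ge0 andbT.
set B := dotL2 mu (ev v) (ev v).
have B0 : 0 <= B by exact: dotL2_ge0.
(* [q k] minimises [J] up to [e k], so [e k] plus the variation of [J] along [v] is a nonnegative
   quadratic in [t]; its discriminant bounds the first variation. *)
have h1 k : (dotL2 mu (ev (q k)) (ev v) - l v) ^+ 2 <= e k * B.
  apply: quadratic_ge0 => // t.
  have := m_le (q k + t *: v); rewrite J_line -/B; have := Hq k; lra.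
have h2 k : (dotL2 mu h (ev v) - dotL2 mu (ev (q k)) (ev v)) ^+ 2 <= 16%:R^-1 ^+ k * B.
  rewrite -dotL2B//; apply: le_trans (cauchy_schwarz_L2 _ _) _ => //; first exact: sqintB.
  by rewrite ler_wpM2r.
have h3 k : (l v - dotL2 mu (ev v) h) ^+ 2 <= 16%:R^-1 ^+ k * (4 * B).
  have := h1 k; have := h2 k; rewrite (dotL2C mu (ev v) h) /e.
  set a := dotL2 _ h _; set b := dotL2 _ _ _; set w := 16%:R^-1 ^+ k => h4 h5.
  have w0 : 0 <= w by rewrite exprn_ge0// invr_ge0.
  have h6 : 0 <= w * B by rewrite mulr_ge0.
  have := sqr_ge0 ((a - b) - (b - l v)); rewrite -mulrA in h5; rewrite !expr2 in h4 h5 *; nra.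
have h4 := geometric_le0 (natinv01 R 14) h3.
by rewrite normr_le0 -sqrf_eq0 eq_le h4 sqr_ge0.
Qed.

End riesz_L2.

(** * Measures with a density *)

Section densities.
Context {R : realType} {n : nat}.
Variable X : set 'rV[R]_n.
Local Notation leb := (lebesgueV n : {measure set 'rV[R]_n -> \bar R}).
Implicit Types (mu : {finite_measure set 'rV[R]_n -> \bar R}) (h : 'rV[R]_n -> R).

Lemma density_integrable mu h : is_density X mu h -> leb.-integrable setT (EFin \o h).
Proof.
move=> [mh h0 _ hmu]; apply/integrableP; split; first exact/measurable_EFinP.
under eq_integral => x _ do rewrite gee0_abs ?lee_fin//.
by rewrite -hmu// -ge0_fin_numE// fin_num_measure.
Qed.

(** The change of variables is known for the Radon-Nikodym derivative, which agrees almost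
    everywhere with [h] because both have the same integral over every measurable set. *)
Lemma ge0_density_integral mu h (phi : 'rV[R]_n -> \bar R) : is_density X mu h ->
  measurable_fun setT phi -> (forall x, 0 <= phi x)%E ->
  (\int[mu]_x phi x = \int[leb]_x (phi x * (h x)%:E))%E.
Proof.
move=> dh mphi phi0; have [mh h0 _ hmu] := dh.
have numu : mu `<< leb.
  apply/null_content_dominatesP => A mA A0; rewrite hmu//.
  apply: null_set_integral => //.
  by apply: measurable_funTS; exact/measurable_EFinP.
rewrite -(Radon_Nikodym_SigmaFinite.change_of_variables numu)//.
apply: ae_eq_integral => //.
- by apply: emeasurable_funM => //; exact: measurable_int (Radon_Nikodym_SigmaFinite.f_integrable numu).
- by apply: emeasurable_funM => //; exact/measurable_EFinP.
have fh : ae_eq leb setT (Radon_Nikodym_SigmaFinite.f mu leb) (EFin \o h).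
  apply: integral_ae_eq => //.
  - exact: Radon_Nikodym_SigmaFinite.f_integrable.
  - exact/measurable_EFinP.
  - by move=> A _ mA; rewrite -Radon_Nikodym_SigmaFinite.f_integral// hmu.
by apply: filterS fh => x /(_ Logic.I) -> _.
Qed.

Lemma density_integral mu h (phi : 'rV[R]_n -> R) : is_density X mu h ->
  measurable_fun setT phi ->
  (\int[mu]_x (phi x)%:E = \int[leb]_x (phi x * h x)%:E)%E.
Proof.
move=> dh mphi; have [mh h0 _ _] := dh.
rewrite integralE [RHS]integralE.
rewrite !(ge0_density_integral dh)//; last 2 first.
- by apply: measurable_funeneg; exact/measurable_EFinP.
- by apply: measurable_funepos; exact/measurable_EFinP.
congr (_ - _)%E; apply: eq_integral => x _.
- by rewrite !funeposE -!EFin_max -EFinM maxr_pMl// mul0r.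
- by rewrite !funenegE -!EFinN -!EFin_max -EFinM maxr_pMl// mul0r mulNr.
Qed.

Lemma density_Rintegral mu h (phi : 'rV[R]_n -> R) : measurable X ->
  is_density X mu h -> measurable_fun setT phi ->
  \int[mu]_(x in X) phi x = \int[leb]_x (phi x * h x).
Proof.
move=> mX dh mphi; have [mh h0 hX _] := dh.
rewrite Rintegral_mkcond /Rintegral (density_integral dh).
  congr fine; apply: eq_integral => x _; congr EFin.
  rewrite patchE; case: ifPn => // /negP xX.
  by rewrite hX ?mulr0// => Xx; apply: xX; rewrite inE.
exact/(measurable_restrictT _ mX)/measurable_funTS.
Qed.

Lemma density_ae_eq mu h h' : is_density X mu h -> is_density X mu h' ->
  ae_eq leb setT h h'.
Proof.
move=> dh [mh' _ _ h'mu]; have [mh _ _ hmu] := dh.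
have : ae_eq leb setT (EFin \o h) (EFin \o h').
  apply: integral_ae_eq => //.
  - exact: density_integrable dh.
  - exact/measurable_EFinP.
  - by move=> A _ mA; rewrite -h'mu// -hmu.
by apply: filterS => x /(_ Logic.I) [].
Qed.

Lemma ac_density_ae mu h : is_density X mu h -> ae_eq leb setT (ac_density X mu) h.
Proof. by move=> dh; apply: (density_ae_eq _ dh); exact: (xgetPex _ (ex_intro _ h dh)). Qed.

Lemma ae_eq_Lnorm p (h h' : 'rV[R]_n -> R) : measurable_fun setT h ->
  measurable_fun setT h' -> ae_eq leb setT h h' ->
  'N[leb]_p[EFin \o h]%E = 'N[leb]_p[EFin \o h']%E.
Proof.
move=> mh mh' hh'; rewrite unlock /Lnorm; case: p => [r| |].
- congr (_ `^ _)%E; apply: ae_eq_integral => //.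
  + apply: (measurableT_comp (measurable_poweR _)) => //.
    by apply: measurableT_comp => //; exact/measurable_EFinP.
  + apply: (measurableT_comp (measurable_poweR _)) => //.
    by apply: measurableT_comp => //; exact/measurable_EFinP.
  by apply: filterS hh' => x /(_ Logic.I) /= ->.
- case: ifP => // _; apply: eq_ess_sup; apply: filterS hh' => x /(_ Logic.I) /= ->//.
- case: ifP => // _; apply: eq_ess_inf; apply: filterS hh' => x /(_ Logic.I) /= ->//.
Qed.

(** [ac_density] is an arbitrary choice of density; the norm can be computed with any other, since
    two densities differ on a null set only. *)
Lemma Lp_normE p mu h : is_density X mu h ->
  Lp_norm p X mu = 'N[leb]_p[EFin \o h]%E.
Proof.
move=> dh; apply: ae_eq_Lnorm; last exact: ac_density_ae.
- by have [] : is_density X mu (ac_density X mu) := xgetPex _ (ex_intro _ h dh).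
- by case: dh.
Qed.

Lemma density_notin mu h : measurable X -> is_density X mu h -> mu (~` X) = 0%E.
Proof.
move=> mX [_ _ hX ->]; last exact: measurableC.
rewrite (eq_integral (cst 0%E)) ?integral0// => x /[!inE] Xx /=.
by rewrite hX.
Qed.

End densities.

Section density_measure.
Context {R : realType} {n : nat} (X : set 'rV[R]_n) (h : 'rV[R]_n -> R).
Local Notation leb := (lebesgueV n : {measure set 'rV[R]_n -> \bar R}).
Hypothesis mh : measurable_fun setT h.
Hypothesis h0 : forall x, 0 <= h x.
Hypothesis hoo : (\int[leb]_x (h x)%:E < +oo)%E.

Definition density_measure (A : set 'rV[R]_n) : \bar R := (\int[leb]_(x in A) (h x)%:E)%E.

Let dm0 : density_measure set0 = 0%E.
Proof. by rewrite /density_measure integral_set0. Qed.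

Let dm_ge0 A : (0 <= density_measure A)%E.
Proof. by apply: integral_ge0 => x _; rewrite lee_fin. Qed.

Let dm_sigma : semi_sigma_additive density_measure.
Proof.
apply: semi_sigma_additive_nng_induced; first exact/measurable_EFinP.
by move=> x; rewrite lee_fin.
Qed.

HB.instance Definition _ := isMeasure.Build _ _ _ density_measure dm0 dm_ge0 dm_sigma.

Let dm_fin : fin_num_fun density_measure.
Proof.
move=> A mA; rewrite ge0_fin_numE//; apply: le_lt_trans hoo.
apply: ge0_subset_integral => //; first exact/measurable_EFinP.
by move=> x _; rewrite lee_fin.
Qed.

HB.instance Definition _ := @Measure_isFinite.Build _ _ _ density_measure dm_fin.

Lemma density_measure_exists : (forall x, ~ X x -> h x = 0) ->
  exists mu : {finite_measure set 'rV[R]_n -> \bar R}, is_density X mu h.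
Proof. by move=> hX; exists density_measure; split. Qed.

End density_measure.

Section Lp_unit_ball.
Context d {T : measurableType d} {R : realType}.
Variable mu : {measure set T -> \bar R}.
Implicit Types (h : T -> R) (p : exponent).

(** The norm bound on a nonnegative density in the form that the semidefinite constraint of each
    exponent yields. *)
Definition Lp_unit_ball p h : Prop :=
  match p with
  | exponent2 => (\int[mu]_x (h x ^+ 2)%:E <= 1)%E
  | exponentoo => \forall x \ae mu, h x <= 1
  end.

Lemma exponent_val_ge1 p : (1 <= exponent_val R p)%E.
Proof. by case: p => /=; rewrite ?leey// lee_fin ler1n. Qed.

Lemma Lnorm2_sqr h : ('N[mu]_2%:E[EFin \o h] `^ 2 = \int[mu]_x (h x ^+ 2)%:E)%E.
Proof.
rewrite powR_Lnorm//; apply: eq_integral => x _ /=.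
by rewrite -[LHS]/((`|h x| `^ 2)%:E) powR_mulrn// real_normK// num_real.
Qed.

Lemma Lnorm_le1 p h : measurable_fun setT h -> (forall x, 0 <= h x) ->
  ('N[mu]_(exponent_val R p)[EFin \o h] <= 1)%E <-> Lp_unit_ball p h.
Proof.
move=> mh h0; case: p => /=.
  rewrite -Lnorm2_sqr; set N := Lnorm _ _ _.
  have N0 : (0 <= N)%E by exact: Lnorm_ge0.
  case: N N0 => [r| |]// r0; last by rewrite poweRyr.
  rewrite poweR_EFin !lee_fin in r0 *; rewrite powR_mulrn//.
  by split => h1; [rewrite expr_le1|rewrite -(@expr_le1 _ 2)].
rewrite unlock /Lnorm; case: ifPn => [_|].
  split => [|h1]; last by apply/ess_supP; apply: filterS h1 => x /=; rewrite ger0_norm.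
  by move=> /ess_supP; apply: filterS => x /=; rewrite lee_fin ger0_norm.
(* On a space of measure 0 the L^oo norm is 0 by convention, and any property holds almost
   everywhere. *)
rewrite -leNgt => muT; split => // _; exists setT; split => //.
by apply/eqP; rewrite eq_le muT measure_ge0.
Qed.

Lemma Lp_unit_ball_Lfun p h : measurable_fun setT h -> (forall x, 0 <= h x) ->
  Lp_unit_ball p h -> h \in Lfun mu (exponent_val R p).
Proof.
move=> mh h0 /(Lnorm_le1 p mh h0) h1; rewrite inE; apply/andP; split.
  by rewrite inE.
by rewrite inE/=; apply: le_lt_trans h1 _; rewrite ltry.
Qed.

Lemma Lp_unit_ball_sqint p h (D : set T) : measurable_fun setT h ->
  (forall x, 0 <= h x) -> measurable D -> (mu D < +oo)%E ->
  (forall x, ~ D x -> h x = 0) -> Lp_unit_ball p h -> sqint mu h.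
Proof.
move=> mh h0 mD Doo hD; case: p => /= h1; apply: sqintP => //.
  by apply: le_lt_trans h1 _; rewrite ltry.
apply: (@le_lt_trans _ _ (\int[mu]_x (\1_D x)%:E)%E); last first.
  by rewrite integral_indic// setIT.
apply: ae_ge0_le_integral => //.
- by move=> x _; rewrite lee_fin sqr_ge0.
- exact: measurable_sqr.
- exact/measurable_EFinP/measurable_indic.
apply: filterS h1 => x hx1 _; rewrite lee_fin indicE.
have [xD|/negP xD] := boolP (x \in D); first by rewrite expr_le1.
by rewrite hD ?expr0n// => Dx; apply: xD; rewrite inE.
Qed.

Lemma LnormZ_Lfun p (c : R) h : 0 <= c -> h \in Lfun mu (exponent_val R p) ->
  ('N[mu]_(exponent_val R p)[EFin \o (fun x => c * h x)%R] =
   c%:E * 'N[mu]_(exponent_val R p)[EFin \o h])%E.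
Proof.
move=> c0 hL; have := @LnormZ _ _ _ mu _ (exponent_val_ge1 p) (Lfun_Sub (exponent_val_ge1 p) hL) c.
by rewrite ger0_norm.
Qed.

Lemma Lfun_Lnorm_fin p h : h \in Lfun mu (exponent_val R p) ->
  'N[mu]_(exponent_val R p)[EFin \o h]%E \is a fin_num.
Proof.
by rewrite inE => /andP[_]; rewrite inE/= /finite_norm ge0_fin_numE// Lnorm_ge0.
Qed.

(** Reduction to the unit ball by scaling. The factor is the inverse of [r + 1], where [r] is the
    norm, because [r] itself may be 0. *)
Lemma Lfun_sqint p h (D : set T) : measurable_fun setT h ->
  (forall x, 0 <= h x) -> measurable D -> (mu D < +oo)%E ->
  (forall x, ~ D x -> h x = 0) -> h \in Lfun mu (exponent_val R p) -> sqint mu h.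
Proof.
move=> mh h0 mD Doo hD hL.
have := Lfun_Lnorm_fin hL; case E : (Lnorm _ _ _) => [r| |]// _.
have r0 : 0 <= r by rewrite -lee_fin -E Lnorm_ge0.
have r1 : 0 < r + 1 by rewrite ltr_wpDl.
pose c := (r + 1)^-1.
have c0 : 0 < c by rewrite invr_gt0.
have sc : sqint mu (fun x => c * h x).
  apply: (@Lp_unit_ball_sqint p _ D) => //.
  - exact: measurable_funM.
  - by move=> x; rewrite mulr_ge0// ltW.
  - by move=> x Dx; rewrite hD// mulr0.
  apply/Lnorm_le1; first exact: measurable_funM.
    by move=> x; rewrite mulr_ge0// ltW.
  rewrite LnormZ_Lfun ?(ltW c0)// E -EFinM lee_fin /c ler_pdivrMl// mulr1.
  by rewrite lerDl.
have := sqintZ (r + 1) sc.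
by under eq_fun do rewrite mulrA /c divff ?mul1r ?gt_eqF//.
Qed.

End Lp_unit_ball.

Lemma min_fun_continuous (R : realType) (T : topologicalType) (phi psi : T -> R) :
  continuous phi -> continuous psi -> continuous (fun x => Num.min (phi x) (psi x)).
Proof. by move=> cphi cpsi x; exact: (continuous_min (cphi x) (cpsi x)). Qed.

Lemma max_fun_continuous (R : realType) (T : topologicalType) (phi psi : T -> R) :
  continuous phi -> continuous psi -> continuous (fun x => Num.max (phi x) (psi x)).
Proof. by move=> cphi cpsi x; exact: (continuous_max (cphi x) (cpsi x)). Qed.

Lemma sub_fun_continuous (R : realType) (T : topologicalType) (phi psi : T -> R) :
  continuous phi -> continuous psi -> continuous (fun x => phi x - psi x).
Proof. by move=> cphi cpsi x; apply: cvgB; [exact: cphi|exact: cpsi]. Qed.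

Lemma mul_fun_continuous (R : realType) (T : topologicalType) (phi psi : T -> R) :
  continuous phi -> continuous psi -> continuous (fun x => phi x * psi x).
Proof. by move=> cphi cpsi x; apply: cvgM; [exact: cphi|exact: cpsi]. Qed.

Lemma cst_fun_continuous (R : realType) (T : topologicalType) (c : R) :
  continuous (fun _ : T => c).
Proof. by move=> x; exact: cvg_cst. Qed.

Section continuous_determines.
Context {R : realType} {n : nat}.

(** These sets are stable under intersection, and their indicators are increasing limits of
    continuous functions. *)
Definition cozero : set (set 'rV[R]_n) :=
  [set A | exists2 phi : 'rV[R]_n -> R, continuous phi & A = [set x | 0 < phi x]].

Lemma cozero_generates : @measurable _ 'rV[R]_n = <<s cozero >>.
Proof.
apply/seteqP; split.
  pose T' := g_sigma_algebraType cozero.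
  have mid : measurable_fun setT (fun x : T' => x : 'rV[R]_n).
    apply: measurable_fun_rowP => i.
    apply: (measurability _ (measurable_realfun.RGenOpens.measurableE R)) => _ [_ [a [b ->]] <-].
    rewrite setTI; apply: sub_sigma_algebra.
    (* This minimum is positive exactly when coordinate [i] lies in the open interval from [a] to
       [b]. *)
    exists (fun x : 'rV[R]_n => Num.min (x ord0 i - a) (b - x ord0 i)).
      have cc : continuous (fun x : 'rV[R]_n => x ord0 i).
        by move=> x; exact: coord_continuous.
      by apply: min_fun_continuous; apply: sub_fun_continuous => //;
        exact: cst_fun_continuous.
    apply/seteqP; split => x /=; rewrite in_itv/= lt_min !subr_gt0//.
  by move=> A mA; have := mid measurableT A mA; rewrite setTI.
apply: smallest_sub; first exact: sigma_algebra_measurable.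
move=> _ [phi cphi ->]; apply: sub_sigma_algebra.
rewrite (_ : [set x | _] = phi @^-1` [set r | 0 < r]); last exact: erefl.
by apply: open_comp; [move=> x _; exact: cphi|exact: open_gt].
Qed.

Lemma measure_eq_continuous (m1 : {finite_measure set 'rV[R]_n -> \bar R})
    (m2 : {measure set 'rV[R]_n -> \bar R}) :
  (forall phi : 'rV[R]_n -> R, continuous phi -> (forall x, 0 <= phi x <= 1) ->
    (\int[m1]_x (phi x)%:E = \int[m2]_x (phi x)%:E)%E) ->
  forall A, measurable A -> m1 A = m2 A.
Proof.
move=> H.
apply: (@measure_unique _ _ _ _ (fun=> setT) cozero_generates) => [|i||A|k].
- move=> _ _ [phi cphi ->] [psi cpsi ->].
  exists (fun x => Num.min (phi x) (psi x)).
    exact: min_fun_continuous.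
  by apply/seteqP; split => x /=; rewrite lt_min; [move=> [-> ->]|move/andP].
- exists (fun=> 1); first exact: cst_fun_continuous.
  by apply/seteqP; split => x //= _; exact: ltr01.
- by rewrite bigcup_const//; exists 0%N.
- move=> [phi cphi ->].
  (* Continuous functions with values in [0, 1] that increase to the indicator of [0 < phi]. *)
  pose f k x : R := Num.min 1 (k%:R * Num.max (phi x) 0).
  have cf k : continuous (f k).
    apply: min_fun_continuous; first exact: cst_fun_continuous.
    apply: mul_fun_continuous; first exact: cst_fun_continuous.
    by apply: max_fun_continuous => //; exact: cst_fun_continuous.
  have f01 k x : 0 <= f k x <= 1.
    by rewrite /f le_min ler01/= mulr_ge0 ?ler0n ?le_max ?lexx ?orbT//= ge_min lexx.
  have ndf x : nondecreasing_seq (fun k => (f k x)%:E).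
    move=> k j kj; rewrite lee_fin /f le_min ge_min lexx/= ge_min; apply/orP; right.
    by rewrite ler_wpM2r ?ler_nat// le_max lexx orbT.
  have mf k : measurable_fun setT (EFin \o f k).
    by apply/measurable_EFinP; exact: measurable_continuous.
  have f0 k x : setT x -> (0 <= (EFin \o f k) x)%E by rewrite lee_fin; case/andP: (f01 k x).
  have limE (m : {measure set 'rV[R]_n -> \bar R}) :
      (\int[m]_x (f k x)%:E)%E @[k --> \oo] --> m [set x | 0 < phi x].
    have := @cvg_monotone_convergence _ _ _ m setT measurableT _ mf f0 (fun x _ => ndf x).
    rewrite [X in _ --> X](_ : _ = m [set x | 0 < phi x])//.
    rewrite (eq_integral (fun x => (\1_[set x | 0 < phi x] x)%:E)).
      rewrite integral_indic ?setIT//.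
      rewrite cozero_generates; apply: sub_sigma_algebra; by exists phi.
    move=> x _; apply/cvg_lim => //; apply: cvg_near_cst.
    rewrite indicE; have [px|px] := ltP 0 (phi x).
      rewrite mem_set//=; exists (Num.truncn (phi x)^-1).+1 => // k /= kk.
      rewrite /f max_l ?ltW// min_l//.
      rewrite -ler_pdivrMr// div1r; apply: le_trans (ltW (truncnS_gt _)) _.
      by rewrite ler_nat.
    rewrite memNset//=; last by apply/negP; rewrite -leNgt.
    by apply: nearW => k /=; rewrite /f max_r// mulr0 min_r.
  have := limE m1; rewrite (_ : (fun k => _) = fun k => (\int[m2]_x (f k x)%:E)%E).
    by move=> /cvg_unique; apply => //; exact: limE.
  by apply/funext => k; exact: H.
- by rewrite -ge0_fin_numE// fin_num_measure.
Qed.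

End continuous_determines.

(** * Moments and invariance *)

Section riesz_functional.
Context {R : realType} {n : nat}.
Implicit Types (q : {mpoly R[n]}) (z : 'X_{1..n} -> R).

(** A range of monomials independent of the support of [q] turns linearity into a termwise
    identity. *)
Lemma rieszwE k z q : (msize q <= k)%N ->
  riesz z q = \sum_(a : 'X_{1..n < k}) q@_a * z a.
Proof.
move=> qk; pose I : subFinType _ := 'X_{1..n < k}.
rewrite /riesz (big_mksub I) //=; first last.
  by move=> x /msize_mdeg_lt /leq_trans; apply.
  by rewrite msupp_uniq.
by rewrite big_rmcond //= => i /memN_msupp_eq0 ->; rewrite mul0r.
Qed.

Lemma riesz_linear z : linear_for *%R (riesz z).
Proof.
move=> c p q; pose k := maxn (msize (c *: p + q)) (maxn (msize p) (msize q)).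
rewrite !(@rieszwE k); try by rewrite /k !leq_max leqnn ?orbT.
rewrite mulr_sumr -big_split/=; apply: eq_bigr => a _.
by rewrite mcoeffD mcoeffZ mulrDl mulrA.
Qed.

HB.instance Definition _ z := GRing.isLinear.Build R {mpoly R[n]} R *%R (riesz z)
  (riesz_linear z).

Lemma rieszX z a : riesz z 'X_[a] = z a.
Proof. by rewrite /riesz msuppX big_seq1 mcoeffX eqxx mul1r. Qed.

Lemma eq_riesz z z' q : (forall a, (mdeg a < msize q)%N -> z a = z' a) ->
  riesz z q = riesz z' q.
Proof.
move=> zz'; rewrite /riesz big_seq [RHS]big_seq; apply: eq_bigr => a aq.
by rewrite zz'// msize_mdeg_lt.
Qed.

Lemma scalar_mpoly_eq (l l' : {scalar {mpoly R[n]}}) :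
  (forall a, l 'X_[a] = l' 'X_[a]) -> l =1 l'.
Proof.
move=> ll' q; rewrite [q]mpolyE !linear_sum; apply: eq_bigr => a _.
by rewrite !linearZ/= ll'.
Qed.

End riesz_functional.

Section concentrated.
Context {R : realType} {n : nat} (X : set 'rV[R]_n) (X_compact : compact X).
Variable mu : {finite_measure set 'rV[R]_n -> \bar R}.
Hypothesis muX : mu (~` X) = 0%E.

Let mX : measurable X.
Proof. by apply: measurable_closed_rV; exact: (compact_closed (@norm_hausdorff _ _)). Qed.

Lemma compact_bounded_integrable (phi : 'rV[R]_n -> R) (M : R) : measurable_fun setT phi ->
  (forall x, X x -> `|phi x| <= M) -> mu.-integrable X (EFin \o phi).
Proof.
move=> mphi phiM; apply: measurable_bounded_integrable => //.
- by rewrite -ge0_fin_numE// fin_num_measure.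
- exact: measurable_funTS.
- exists M; split; first by rewrite num_real.
  by move=> y My x Xx; apply: le_trans (ltW My); exact: phiM.
Qed.

Lemma continuous_integrable (phi : 'rV[R]_n -> R) : continuous phi ->
  mu.-integrable X (EFin \o phi).
Proof.
move=> cphi; have [M _ HM] := compact_bound_fun X_compact cphi.
by apply: compact_bounded_integrable HM; exact: measurable_continuous.
Qed.

Lemma meval_integrable (q : {mpoly R[n]}) :
  mu.-integrable X (EFin \o (fun x => q.@[x ord0])).
Proof. by apply: continuous_integrable; exact: meval_continuous. Qed.

Lemma Rintegral_le_bound (phi : 'rV[R]_n -> R) (e : R) : measurable_fun setT phi ->
  (forall x, X x -> `|phi x| <= e) -> `|\int[mu]_(x in X) phi x| <= e * fine (mu X).
Proof.
move=> mphi He.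
have iphi := compact_bounded_integrable mphi He.
apply: (le_trans (le_normr_Rintegral mX iphi)).
rewrite -Rintegral_cst//; apply: le_Rintegral => //.
- apply: (@compact_bounded_integrable _ e); first exact: measurableT_comp.
  by move=> x Xx; rewrite normr_id; exact: He.
- apply: (@compact_bounded_integrable _ `|e|) => // x _; exact: lexx.
Qed.

Lemma integral_concentrated (phi : 'rV[R]_n -> \bar R) : measurable_fun setT phi ->
  (\int[mu]_(x in X) phi x = \int[mu]_x phi x)%E.
Proof.
move=> mphi; rewrite integral_mkcond; apply: ae_eq_integral => //.
  by apply/(measurable_restrictT _ mX); exact: measurable_funTS.
exists (~` X); split => //; first exact: measurableC.
move=> x /= h Xx; apply: h => _; by rewrite patchE mem_set.
Qed.

Lemma measure_concentrated A : measurable A -> mu A = mu (X `&` A).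
Proof.
move=> mA; rewrite -{1}[A](setUIDK A X) measureU; last 3 first.
- exact: measurableI.
- exact: measurableD.
- by apply/seteqP; split => x //= [[_ Xx] [_]].
rewrite [X in (_ + X)%E](_ : _ = 0%E); first by rewrite adde0 setIC.
apply/eqP; rewrite eq_le measure_ge0 andbT -muX; apply: le_measure.
- by rewrite inE; exact: measurableD.
- by rewrite inE; exact: measurableC.
- by move=> x [].
Qed.

Lemma riesz_moment q : riesz (moment X mu) q = \int[mu]_(x in X) q.@[x ord0].
Proof.
have lin : linear_for *%R (fun q : {mpoly R[n]} => \int[mu]_(x in X) q.@[x ord0]).
  move=> c p p'; under eq_Rintegral do rewrite mevalD mevalZ.
  rewrite RintegralD//; last 2 first.
  - apply: (@continuous_integrable (fun x => c * p.@[x ord0])).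
    by apply: mul_fun_continuous; [exact: cst_fun_continuous|exact: meval_continuous].
  - exact: meval_integrable.
  by rewrite RintegralZl//; exact: meval_integrable.
pose L := GRing.isLinear.Build R {mpoly R[n]} R *%R _ lin.
pose l : {scalar {mpoly R[n]}} := HB.pack (fun q : {mpoly R[n]} => \int[mu]_(x in X) q.@[x ord0]) L.
apply: (scalar_mpoly_eq (l := riesz (moment X mu)) (l' := l)) => a /=.
by rewrite rieszX.
Qed.

End concentrated.

Lemma sum_fun_continuous (R : realType) (T : topologicalType) (I : Type) (s : seq I)
    (F : I -> T -> R) :
  (forall i, continuous (F i)) -> continuous (fun x => \sum_(i <- s) F i x).
Proof.
move=> cF; elim: s => [|i s IHs].
  by under eq_fun do rewrite big_nil; exact: cst_fun_continuous.
under eq_fun do rewrite big_cons.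
by move=> x; apply: cvgD; [exact: cF|exact: IHs].
Qed.

Section invariance.
Context {R : realType} {n : nat} (X : set 'rV[R]_n) (X_compact : compact X).
Variable mu : {finite_measure set 'rV[R]_n -> \bar R}.
Hypothesis muX : mu (~` X) = 0%E.
Variable f : n.-tuple {mpoly R[n]}.

Let mX : measurable X.
Proof. by apply: measurable_closed_rV; exact: (compact_closed (@norm_hausdorff _ _)). Qed.

Let mf : measurable_fun setT (polymap f) := measurable_polymap f.

Let mpre A : measurable A -> measurable (polymap f @^-1` A).
Proof. by move=> mA; rewrite -[X in measurable X]setTI; exact: mf. Qed.

Let comp_polymap (q : {mpoly R[n]}) (x : 'rV[R]_n) : (q \mPo f).@[x ord0] = q.@[polymap f x ord0].
Proof. by rewrite comp_mpoly_meval; apply: meval_eq => i; rewrite mxE. Qed.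

(** The definition of invariance tests only sets inside X and counts only points of X. Taking A = X
    shows that almost no point of X is mapped outside X, and this extends the identity to all Borel
    sets. *)
Lemma invariant_preimage : invariant_measure discrete_time f X mu ->
  forall A, measurable A -> mu (polymap f @^-1` A) = mu A.
Proof.
move=> inv.
have fXC : mu (polymap f @^-1` (~` X)) = 0%E.
  rewrite (measure_concentrated X_compact muX (mpre (measurableC mX))).
  rewrite preimage_setC -setDE measureD//; last 2 first.
  - exact: mpre.
  - by rewrite -ge0_fin_numE// fin_num_measure.
  have := inv X mX (@subset_refl _ X).
  move=> muXf; rewrite [X in (_ - X)%E](_ : _ = mu X); last exact: muXf.
  by rewrite subee// fin_num_measure.
move=> A mA; rewrite [RHS](measure_concentrated X_compact muX mA).
rewrite -(inv _ (measurableI _ _ mX mA) (@subIsetl _ X A)).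
rewrite -{1}[A](setUIDK A X) preimage_setU measureU; last 3 first.
- by apply: mpre; exact: measurableI.
- by apply: mpre; exact: measurableD.
- by apply/seteqP; split => x //= [[_ Xx] [_]].
rewrite [X in (_ + X)%E](_ : _ = 0%E); last first.
  apply/eqP; rewrite eq_le measure_ge0 andbT -fXC; apply: le_measure.
  - by rewrite inE; apply: mpre; exact: measurableD.
  - by rewrite inE; apply: mpre; exact: measurableC.
  - by move=> x [].
rewrite adde0; apply: etrans (measure_concentrated X_compact muX (mpre (measurableI _ _ mA mX))) _.
by congr (mu _); apply/seteqP; split => x /= [? []].
Qed.

Let push : {measure set 'rV[R]_n -> \bar R} :=
  measure_function_pushforward__canonical__measure_function_Measure mu mf.

Lemma integral_polymap (phi : 'rV[R]_n -> R) : measurable_fun setT phi ->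
  (\int[push]_x (phi x)%:E = \int[mu]_x (phi (polymap f x))%:E)%E.
Proof.
move=> mphi; rewrite integralE [RHS]integralE.
rewrite !ge0_integral_pushforward//; last 2 first.
- by apply: measurable_funeneg; exact/measurable_EFinP.
- by apply: measurable_funepos; exact/measurable_EFinP.
rewrite preimage_setT; congr (_ - _)%E; apply: eq_integral => x _ /=.
- by rewrite !funeposE.
- by rewrite !funenegE.
Qed.

Lemma invariant_Iop dyn : invariant_measure dyn f X mu ->
  forall q, Iop dyn f (moment X mu) q = 0.
Proof.
case: dyn => inv q /=.
  rewrite !(riesz_moment X_compact); apply/eqP; rewrite subr_eq0; apply/eqP.
  under eq_Rintegral do rewrite comp_polymap.
  rewrite /Rintegral !(integral_concentrated X_compact muX); last 2 first.
  - by apply/measurable_EFinP; exact: measurable_meval.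
  - apply/measurable_EFinP; exact: (measurableT_comp (measurable_meval q) mf).
  rewrite -(integral_polymap (measurable_meval q)); congr fine.
  by apply: eq_measure_integral => A mA _; exact: invariant_preimage.
rewrite (riesz_moment X_compact) -[RHS](inv _ (meval_C1 q)).
apply: eq_Rintegral => x _; rewrite /lie_deriv raddf_sum; apply: eq_bigr => i _.
by rewrite /= mevalM mxE; have [_ ->] := mpoly_partial_deriv q x.
Qed.

Lemma le_eps_eq0 (a c : R) : 0 <= c -> (forall e, 0 < e -> `|a| <= e * c) -> a = 0.
Proof.
move=> c0 H; apply/eqP; rewrite -normr_le0; apply/ler_addgt0Pr => e e0; rewrite add0r.
have c1 : 0 < c + 1 by rewrite ltr_wpDl.
apply: le_trans (H (e / (c + 1)) _) _; first by rewrite divr_gt0.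
by rewrite -mulrA ger_pMr// mulrC ler_pdivrMr// mul1r lerDl.
Qed.

(** Uniform approximation extends the identity from polynomials to continuous functions; these
    determine [mu] and its image measure, which are therefore equal. *)
Lemma Iop_invariant_discrete : (forall q, Iop discrete_time f (moment X mu) q = 0) ->
  invariant_measure discrete_time f X mu.
Proof.
move=> H.
have [B0 B00 XB0] := compact_cube X_compact.
have [M HM] : exists M : 'I_n -> R, forall i, 0 < M i /\ forall x, X x -> `|(tnth f i).@[x ord0]| <= M i.
  suff bnd i : exists M : R, 0 < M /\ forall x, X x -> `|(tnth f i).@[x ord0]| <= M.
    by have [M HM] := choice bnd; exists M.
  have [M M0 HM] := compact_bound_fun X_compact (@meval_continuous _ _ (tnth f i)).
  by exists M.
(* [f] may map points of X outside X, so the approximation takes place on a cube containing both X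
   and its image. *)
pose B := B0 + \sum_i M i.
have B_0 : 0 < B.
  by rewrite ltr_wpDr// sumr_ge0// => i _; rewrite ltW//; case: (HM i).
have XB x : X x -> cube B x.
  move=> /XB0 xB i; apply: (le_trans (xB i)).
  by rewrite lerDl sumr_ge0// => j _; rewrite ltW//; case: (HM j).
have fXB x : X x -> cube B (polymap f x).
  move=> Xx i; rewrite mxE; have [_ h] := HM i; apply: (le_trans (h x Xx)).
  rewrite /B (bigD1 i)//= addrCA lerDl addr_ge0 ?(ltW B00)//.
  by rewrite sumr_ge0// => j _; rewrite ltW//; case: (HM j).
have key (phi : 'rV[R]_n -> R) : continuous phi ->
    \int[mu]_(x in X) phi (polymap f x) = \int[mu]_(x in X) phi x.
  move=> cphi; apply/eqP; rewrite -subr_eq0; apply/eqP.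
  have mphi := measurable_continuous cphi.
  have mphif : measurable_fun setT (fun x => phi (polymap f x)) by exact: measurableT_comp mf.
  apply: (@le_eps_eq0 _ (2 * fine (mu X))); first by rewrite mulr_ge0// fine_ge0.
  move=> e e0; have [q Hq] := weierstrass_C0 B_0 cphi e0.
  have mq := measurable_meval q.
  have mqf : measurable_fun setT (fun x => q.@[polymap f x ord0]).
    exact: (measurableT_comp mq mf).
  have Eq : \int[mu]_(x in X) q.@[polymap f x ord0] = \int[mu]_(x in X) q.@[x ord0].
    have := H q; rewrite /= !(riesz_moment X_compact) => /eqP; rewrite subr_eq0 => /eqP <-.
    by apply: eq_Rintegral => x _; rewrite comp_polymap.
  have [M1 _ HM1] := compact_bound_fun (@cube_compact R n B) cphi.
  have [M2 _ HM2] := compact_bound_fun (@cube_compact R n B) (@meval_continuous _ _ q).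
  have i1 : mu.-integrable X (EFin \o (fun x => phi (polymap f x))).
    by apply: (compact_bounded_integrable X_compact _ (M := M1)) => // x Xx; exact/HM1/fXB.
  have i2 : mu.-integrable X (EFin \o phi) by exact: continuous_integrable.
  have i3 : mu.-integrable X (EFin \o (fun x => q.@[polymap f x ord0])).
    by apply: (compact_bounded_integrable X_compact _ (M := M2)) => // x Xx; exact/HM2/fXB.
  have i4 : mu.-integrable X (EFin \o (fun x => q.@[x ord0])) by exact: meval_integrable.
  have -> : \int[mu]_(x in X) phi (polymap f x) - \int[mu]_(x in X) phi x =
     \int[mu]_(x in X) (phi (polymap f x) - q.@[polymap f x ord0]) +
     \int[mu]_(x in X) (q.@[x ord0] - phi x).
    by rewrite !RintegralB// Eq; ring.
  rewrite (le_trans (ler_normD _ _))// mulrCA mulr_natl mulr2n lerD//.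
  - apply: Rintegral_le_bound => //; first exact: measurable_funB.
    by move=> x Xx; rewrite distrC; apply: Hq; exact: fXB.
  - apply: Rintegral_le_bound => //; first exact: measurable_funB.
    by move=> x Xx; apply: Hq; exact: XB.
have pushE A : measurable A -> mu A = push A.
  apply: measure_eq_continuous => phi cphi phi01.
  have mphi := measurable_continuous cphi.
  rewrite (integral_polymap mphi).
  rewrite -(integral_concentrated X_compact muX); last exact/measurable_EFinP.
  rewrite -[RHS](integral_concentrated X_compact muX); last first.
    by apply/measurable_EFinP; exact: (measurableT_comp mphi mf).
  have phi1 x : `|phi x| <= 1 by have /andP[h0 h1] := phi01 x; rewrite ger0_norm.
  rewrite -[LHS]fineK; last first.
    apply: integrable_fin_num => //.
    by apply: (compact_bounded_integrable X_compact _ (M := 1)).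
  rewrite -[RHS]fineK; last first.
    apply: integrable_fin_num => //.
    apply: (compact_bounded_integrable X_compact _ (M := 1)) => //.
    exact: (measurableT_comp mphi mf).
  by congr EFin; rewrite -/(Rintegral _ _ _) -/(Rintegral _ _ _) key.
move=> A mA AX.
apply/esym; apply: (etrans (pushE _ mA)).
apply: (etrans (measure_concentrated X_compact muX (mpre mA))).
by congr (mu _).
Qed.

Lemma Iop_invariant_continuous : (forall q, Iop continuous_time f (moment X mu) q = 0) ->
  invariant_measure continuous_time f X mu.
Proof.
move=> H v Cv.
have [B B0 XB] := compact_cube X_compact.
have [M HM] : exists M : 'I_n -> R, forall i, 0 < M i /\ forall x, X x -> `|(tnth f i).@[x ord0]| <= M i.
  suff bnd i : exists M : R, 0 < M /\ forall x, X x -> `|(tnth f i).@[x ord0]| <= M.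
    by have [M HM] := choice bnd; exists M.
  have [M M0 HM] := compact_bound_fun X_compact (@meval_continuous _ _ (tnth f i)).
  by exists M.
apply: (@le_eps_eq0 _ ((\sum_i M i) * fine (mu X))).
  by rewrite mulr_ge0 ?fine_ge0// sumr_ge0// => i _; rewrite ltW//; case: (HM i).
move=> e e0; have [q Hq] := weierstrass_C1 B0 Cv e0.
have cv i : continuous (fun x => partial_deriv i v x * (polymap f x ord0 i : R)).
  apply: mul_fun_continuous; first by case: Cv.
  rewrite (_ : (fun x : 'rV[R]_n => _) = fun x => (tnth f i).@[x ord0]).
    exact: meval_continuous.
  by apply/funext => x; rewrite mxE.
have csum : continuous (fun x => \sum_(i < n) partial_deriv i v x * (polymap f x ord0 i : R)).
  exact: sum_fun_continuous.
(* The subtracted integral is [Iop] at [q], hence 0; what remains is an error in the partial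
   derivatives, weighted by the bounds on [f]. *)
have -> : \int[mu]_(x in X) (\sum_(i < n) partial_deriv i v x * polymap f x ord0 i) =
   \int[mu]_(x in X) (\sum_(i < n) partial_deriv i v x * polymap f x ord0 i - (lie_deriv f q).@[x ord0]).
  rewrite RintegralB//; last 2 first.
  - exact: continuous_integrable csum.
  - exact: meval_integrable.
  by have /= := H q; rewrite (riesz_moment X_compact) => ->; rewrite subr0.
rewrite mulrA; apply: Rintegral_le_bound => //.
  by apply: measurable_continuous; apply: sub_fun_continuous => //; exact: meval_continuous.
move=> x Xx; rewrite /lie_deriv (raddf_sum (meval (x ord0)))/= -sumrB mulr_sumr.
apply: le_trans (ler_norm_sum _ _ _) _; apply: ler_sum => i _ /=.
have [_ Mi] := HM i.
rewrite mevalM mxE -mulrBl normrM; apply: ler_pM => //; last exact: Mi.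
by rewrite distrC; have [_ ->] := Hq x (XB _ Xx).
Qed.

Lemma invariant_IopP dyn : invariant_measure dyn f X mu <->
  forall q, Iop dyn f (moment X mu) q = 0.
Proof.
split; first exact: invariant_Iop.
by case: dyn; [exact: Iop_invariant_discrete|exact: Iop_invariant_continuous].
Qed.

End invariance.

(** * Semidefinite constraints as polynomial inequalities *)

Section moment_matrices.
Context {R : realType} {n : nat}.
Implicit Types (q P : {mpoly R[n]}) (z zl : 'X_{1..n} -> R).

Local Notation idx d := #|{: 'X_{1..n < d.+1} }|.

Definition mpoly_of_col d (u : 'cV[R]_(idx d)) : {mpoly R[n]} :=
  \sum_i u i ord0 *: 'X_[bmnm (enum_val i)].

Lemma mpoly_of_col_surj d P : (msize P <= d.+1)%N ->
  exists u : 'cV[R]_(idx d), mpoly_of_col u = P.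
Proof.
move=> Pd; exists (\col_i P@_(bmnm (enum_val i))).
rewrite [RHS](mpolywE Pd) [RHS](reindex _ (onW_bij _ (enum_val_bij _)))/=.
by apply: eq_bigr => i _; rewrite mxE.
Qed.

Lemma msize_mpoly_of_col d (u : 'cV[R]_(idx d)) : (msize (mpoly_of_col u) <= d.+1)%N.
Proof.
apply: (leq_trans (msize_sum _ _ _)); apply/bigmax_leqP_seq => i _ _.
apply: leq_trans (msizeZ_le _ _) _; rewrite msizeX.
exact: bmdeg.
Qed.

Lemma quad_localizing d q z (u : 'cV[R]_(idx d)) :
  (u^T *m localizing_matrix d q z *m u) ord0 ord0 =
  riesz z (q * mpoly_of_col u ^+ 2).
Proof.
rewrite expr2 mxE mulrA {2}/mpoly_of_col mulr_sumr linear_sum/=.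
apply: eq_bigr => j _; rewrite -scalerAr linearZ/= mulrC; congr (_ * _).
rewrite mxE /mpoly_of_col mulr_sumr mulr_suml linear_sum/=.
apply: eq_bigr => i _; rewrite !mxE -scalerAr -scalerAl linearZ/=; congr (_ * riesz _ _).
by rewrite -mulrA -mpolyXD.
Qed.

Lemma localizing_sym d q z : (localizing_matrix d q z)^T = localizing_matrix d q z.
Proof. by apply/matrixP => i j; rewrite !mxE addmC. Qed.

Lemma psd_localizingP d q z : psd_mx (localizing_matrix d q z) <->
  forall P, (msize P <= d.+1)%N -> 0 <= riesz z (q * P ^+ 2).
Proof.
split=> [[_ H] P /mpoly_of_col_surj[u <-]|H]; first by rewrite -quad_localizing.
split; first exact: localizing_sym.
by move=> u; rewrite quad_localizing; apply: H; exact: msize_mpoly_of_col.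
Qed.

Lemma psd_momentP d z : psd_mx (moment_matrix d z) <->
  forall P, (msize P <= d.+1)%N -> 0 <= riesz z (P ^+ 2).
Proof.
rewrite psd_localizingP; split => H P Pd; have := H P Pd; rewrite ?mul1r//.
Qed.

Lemma psd_CooP d zl z : psd_mx (Coo d zl z) <->
  forall P, (msize P <= d.+1)%N -> riesz z (P ^+ 2) <= riesz zl (P ^+ 2).
Proof.
have quad (u : 'cV[R]_(idx d)) : (u^T *m Coo d zl z *m u) ord0 ord0 =
    riesz zl (mpoly_of_col u ^+ 2) - riesz z (mpoly_of_col u ^+ 2).
  rewrite /Coo /moment_matrix mulmxBr mulmxBl [LHS]mxE [X in _ + X]mxE.
  by rewrite !quad_localizing !mul1r.
split=> [[_ H] P /mpoly_of_col_surj[u <-]|H]; first by rewrite -subr_ge0 -quad.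
split; first by rewrite /Coo /moment_matrix raddfB/= !localizing_sym.
by move=> u; rewrite quad subr_ge0; apply: H; exact: msize_mpoly_of_col.
Qed.

(** The border coordinate of the vector is kept as a parameter [s]. Nonnegativity for all [s] is a
    discriminant condition, used below in place of a Schur complement. *)
Lemma psd_C2P d zl z : psd_mx (C2 d zl z) <->
  forall P (s : R), (msize P <= d.+1)%N ->
    0 <= riesz zl (P ^+ 2) + 2 * s * riesz z P + s ^+ 2.
Proof.
have quad (u : 'cV[R]_(idx d)) (s : R) :
    ((col_mx u (s%:M : 'M[R]_1))^T *m C2 d zl z *m col_mx u (s%:M : 'M[R]_1)) ord0 ord0 =
    riesz zl (mpoly_of_col u ^+ 2) + 2 * s * riesz z (mpoly_of_col u) + s ^+ 2.
  have low : (u^T *m low_moments d z) ord0 ord0 = riesz z (mpoly_of_col u).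
    rewrite mxE /mpoly_of_col linear_sum/=; apply: eq_bigr => i _.
    by rewrite linearZ/= rieszX !mxE.
  have low' : ((low_moments d z)^T *m u) ord0 ord0 = riesz z (mpoly_of_col u).
    by rewrite -low -[in LHS](trmxK u) -trmx_mul mxE.
  rewrite /C2 tr_col_mx mul_row_block mul_row_col mulmxDl tr_scalar_mx mulmx1.
  rewrite mul_scalar_mx -scalemxAl !mul_mx_scalar.
  have mxD (A B : 'M[R]_1) : (A + B) ord0 ord0 = A ord0 ord0 + B ord0 ord0 by rewrite mxE.
  have mxS c (A : 'M[R]_1) : (c *: A) ord0 ord0 = c * A ord0 ord0 by rewrite mxE.
  rewrite !(mxD, mxS) low low' quad_localizing mul1r.
  by rewrite [(s%:M) _ _]mxE eqxx mulr1n; ring.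
split=> [[_ H] P s /mpoly_of_col_surj[u <-]|H]; first by rewrite -quad.
split; first by rewrite /C2 tr_block_mx localizing_sym trmxK tr_scalar_mx.
move=> v; rewrite -[v]vsubmxK [dsubmx v]mx11_scalar quad.
by apply: H; exact: msize_mpoly_of_col.
Qed.

End moment_matrices.

(** * Polynomials on X inside L^2, and functions that pair nonnegatively with squares *)

Section restricted_polynomials.
Context {R : realType} {n : nat} (X : set 'rV[R]_n) (X_compact : compact X).
Local Notation leb := (lebesgueV n : {measure set 'rV[R]_n -> \bar R}).
Local Notation zleb := (moment X leb).

(** Extension by zero embeds the polynomials on X in L^2 of the whole space, matching the convention
    for densities. *)
Definition meval_on (q : {mpoly R[n]}) (x : 'rV[R]_n) : R := q.@[x ord0] * \1_X x.

Lemma compact_measurable_rV : measurable X.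
Proof. by apply: measurable_closed_rV; exact: (compact_closed (@norm_hausdorff _ _)). Qed.

Let mX := compact_measurable_rV.

Let Xoo : (leb X < +oo)%E := compact_lebesgueV_fin X_compact.

Lemma sqint_continuous_on (phi : 'rV[R]_n -> R) : continuous phi ->
  sqint leb (fun x => phi x * \1_X x).
Proof.
move=> cphi; have [M M0 HM] := compact_bound_fun X_compact cphi.
have mphi := measurable_continuous cphi.
apply: sqintP; first exact: measurable_funM.
apply: (@le_lt_trans _ _ (\int[leb]_x ((M ^+ 2)%:E * (\1_X x)%:E))%E).
  apply: ge0_le_integral => //.
  - by move=> x _; rewrite lee_fin sqr_ge0.
  - by apply: measurable_sqr; exact: measurable_funM.
  - by apply: measurable_funeM; exact/measurable_EFinP.
  move=> x _; rewrite -EFinM lee_fin indicE.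
  have [xX|xX] := boolP (x \in X); last by rewrite !mulr0 expr0n.
  rewrite !mulr1 -(real_normK (num_real (phi x))) lerXn2r ?nnegrE ?(ltW M0)//.
  by apply: HM; rewrite inE in xX.
rewrite ge0_integralZl//; last 2 first.
- exact/measurable_EFinP.
- by rewrite lee_fin sqr_ge0.
by rewrite integral_indic// setIT lte_mul_pinfty// ?lee_fin ?sqr_ge0// .
Qed.

Lemma sqint_meval_on q : sqint leb (meval_on q).
Proof. by apply: sqint_continuous_on; exact: meval_continuous. Qed.

Lemma meval_on_linear c p q x : meval_on (c *: p + q) x = c * meval_on p x + meval_on q x.
Proof. by rewrite /meval_on mevalD mevalZ mulrDl mulrA. Qed.

Lemma meval_on_notin q x : ~ X x -> meval_on q x = 0.
Proof. by move=> Xx; rewrite /meval_on indicE memNset// mulr0. Qed.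

Lemma meval_on_in (u : 'rV[R]_n -> R) q x : (forall x, ~ X x -> u x = 0) ->
  meval_on q x * u x = q.@[x ord0] * u x.
Proof.
move=> u0; rewrite /meval_on indicE; have [xX|/negP xX] := boolP (x \in X).
  by rewrite mulr1.
by rewrite u0 ?mulr0// => Xx; apply: xX; rewrite inE.
Qed.

Lemma riesz_density (mu : {finite_measure set 'rV[R]_n -> \bar R}) h q :
  is_density X mu h -> riesz (moment X mu) q = dotL2 leb (meval_on q) h.
Proof.
move=> dh; rewrite (riesz_moment X_compact) (density_Rintegral mX dh); last exact: measurable_meval.
have [_ _ hX _] := dh.
by apply: eq_Rintegral => x _; rewrite (meval_on_in _ _ hX).
Qed.

(** [riesz_moment] concerns finite measures, so the Lebesgue measure on X is first realised as the
    finite measure with density [\1_X]. *)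
Lemma riesz_leb q : riesz zleb q = \int[leb]_x meval_on q x.
Proof.
have [mu1 dmu1] : exists mu : {finite_measure set 'rV[R]_n -> \bar R}, is_density X mu \1_X.
  apply: density_measure_exists => //.
    by rewrite integral_indic// setIT.
  by move=> x Xx; rewrite indicE memNset.
rewrite (@eq_riesz _ _ _ (moment X mu1)); last first.
  move=> a _; rewrite /moment (density_Rintegral mX dmu1); last exact: measurable_meval.
  rewrite Rintegral_mkcond; apply: eq_Rintegral => x _.
  by rewrite patchE indicE; case: (_ \in _); rewrite ?mulr1 ?mulr0.
rewrite (riesz_density _ dmu1); apply: eq_Rintegral => x _.
by rewrite /meval_on -mulrA indicE; case: (_ \in _); rewrite ?mulr1 ?mulr0.
Qed.

Lemma dotL2_meval_on p q : dotL2 leb (meval_on p) (meval_on q) = riesz zleb (p * q).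
Proof.
rewrite riesz_leb; apply: eq_Rintegral => x _.
by rewrite /meval_on mevalM indicE; case: (_ \in _); rewrite ?mulr1 ?mulr0 ?mul0r.
Qed.

Lemma riesz_leb_sqr q : riesz zleb (q ^+ 2) = dotL2 leb (meval_on q) (meval_on q).
Proof. by rewrite dotL2_meval_on expr2. Qed.

Section nonnegativity.
Variable u : 'rV[R]_n -> R.
Hypothesis su : sqint leb u.
Hypothesis u0 : forall x, ~ X x -> u x = 0.
Hypothesis upos : forall P : {mpoly R[n]}, 0 <= dotL2 leb (meval_on (P ^+ 2)) u.

(** A polynomial within [e] of [psi] on X has a square close to that of [psi]; the error in the
    pairing is controlled by the integral of [|u|] over X. *)
Lemma sqr_continuous_dot_ge0 (psi : 'rV[R]_n -> R) : continuous psi ->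
  0 <= dotL2 leb (fun x => psi x ^+ 2 * \1_X x) u.
Proof.
move=> cpsi.
have [B B0 XB] := compact_cube X_compact.
have [M M0 HM] := compact_bound_fun X_compact cpsi.
have s1 : sqint leb (fun x => 1 * \1_X x) by apply: sqint_continuous_on; exact: cst_fun_continuous.
have sp : sqint leb (fun x => psi x ^+ 2 * \1_X x).
  apply: sqint_continuous_on; under eq_fun do rewrite expr2.
  exact: mul_fun_continuous.
have sau : sqint leb (fun x => `|u x|).
  apply: (le_sqint _ su); first by apply: measurableT_comp => //; case: su.
  by move=> x; rewrite normr_id.
pose K := dotL2 leb (fun x => 1 * \1_X x) (fun x => `|u x|).
suff H e : 0 < e -> e <= 1 -> - (e * (2 * M + 1) * K) <= dotL2 leb (fun x => psi x ^+ 2 * \1_X x) u.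
  rewrite -oppr_le0; apply: (@geometric_le0 _ 2%:R^-1 _ ((2 * M + 1) * K)) => [|k].
    exact: natinv01.
  rewrite lerNl mulrA; apply: H; first by rewrite exprn_gt0// invr_gt0.
  by rewrite exprn_ile1 ?invr_ge0// ltW//; case/andP: (@natinv01 R 0).
move=> e0 e1; have [q Hq] := weierstrass_C0 B0 cpsi e0.
(* Factor [a ^+ 2 - b ^+ 2]: the difference is at most [e], and the sum at most [2 * M + e], hence
   at most [2 * M + 1]. *)
have pt x : - (e * (2 * M + 1) * (1 * \1_X x)) * `|u x| <= (psi x ^+ 2 * \1_X x - meval_on (q ^+ 2) x) * u x.
  rewrite /meval_on indicE; have [xX|xX] := boolP (x \in X); last first.
    by rewrite !mulr0 subrr oppr0 !mul0r.
  have Xx : X x by rewrite inE in xX.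
  rewrite !mulr1 rmorphXn/= subr_sqr.
  have h1 := Hq x (XB _ Xx); have h2 := HM x Xx.
  set a := psi x in h1 h2 *; set b := q.@[_] in h1 *.
  have h3 : `|(a - b) * (a + b)| <= e * (2 * M + 1).
    rewrite normrM; apply: ler_pM => //; first by rewrite distrC.
    rewrite (_ : a + b = 2 * a + (b - a)); last by ring.
    by apply: (le_trans (ler_normD _ _)); rewrite normrM ger0_norm//; lra.
  rewrite mulNr lerNl -mulNr; apply: (le_trans (ler_norm _)).
  by rewrite normrM normrN ler_wpM2r.
have sq := sqint_meval_on (q ^+ 2).
have h : - (e * (2 * M + 1) * K) <= dotL2 leb (fun x => psi x ^+ 2 * \1_X x - meval_on (q ^+ 2) x) u.
  rewrite -mulNr -dotL2Z//; apply: le_Rintegral => //.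
  - by apply: sqint_mul => //; exact: sqintZ.
  - by apply: sqint_mul => //; exact: sqintB.
  by move=> x _; have := pt x; rewrite !mulNr.
by move: h; rewrite dotL2B//; have := upos q; lra.
Qed.

Lemma continuous_dot_ge0 (phi : 'rV[R]_n -> R) : continuous phi ->
  (forall x, 0 <= phi x) -> 0 <= dotL2 leb (fun x => phi x * \1_X x) u.
Proof.
move=> cphi phi0.
have := @sqr_continuous_dot_ge0 (fun x => Num.sqrt (phi x)).
under [X in dotL2 _ X]eq_fun do rewrite sqr_sqrtr//.
apply=> x; apply: (@continuous_comp _ _ _ phi Num.sqrt); first exact: cphi.
exact: sqrt_continuous.
Qed.

(* The negative parts of the approximating polynomials converge in L^2 to the
   negative part of u, and pair nonnegatively with u. *)
Lemma L2_limit_ge0 (q : nat -> {mpoly R[n]}) :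
  (forall k, dotL2 leb (fun x => u x - meval_on (q k) x) (fun x => u x - meval_on (q k) x)
    <= 16%:R^-1 ^+ k) ->
  {ae leb, forall x, 0 <= u x}.
Proof.
move=> uq; have [mu_ _] := su.
pose un (x : 'rV[R]_n) : R := Num.max (- u x) 0.
have mun : measurable_fun setT un.
  by apply: measurable_maxr => //; exact: measurable_funN.
have sun : sqint leb un.
  apply: (le_sqint mun su) => x; rewrite /un.
  case: (leP (- u x) 0) => h; first by rewrite normr0.
  by rewrite normrN.
pose w k (x : 'rV[R]_n) : R := Num.max (- (q k).@[x ord0]) 0 * \1_X x.
have cw k : continuous (fun x : 'rV[R]_n => Num.max (- (q k).@[x ord0]) 0 : R).
  apply: max_fun_continuous; last exact: cst_fun_continuous.
  under eq_fun do rewrite -mulN1r.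
  by apply: mul_fun_continuous; [exact: cst_fun_continuous|exact: meval_continuous].
have sw k : sqint leb (w k) by exact: sqint_continuous_on.
have wu k : 0 <= dotL2 leb (w k) u.
  by apply: continuous_dot_ge0 => // x; rewrite le_max lexx orbT.
have unu : dotL2 leb un u = - dotL2 leb un un.
  rewrite -mulN1r -dotL2Z// (dotL2C leb _ un); apply: eq_Rintegral => x _.
  rewrite mulN1r /un; case: (leP (- u x) 0) => h; first by rewrite mul0r oppr0 mulr0.
  by rewrite opprK.
have near_ k x : `|un x - w k x| <= `|u x - meval_on (q k) x|.
  rewrite /un /w /meval_on indicE; have [xX|/negP xX] := boolP (x \in X); last first.
    by rewrite u0 ?mulr0 ?oppr0 ?maxxx ?subrr// => Xx; apply: xX; rewrite inE.
  rewrite !mulr1; set a := u x; set b := (q k).@[_].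
  rewrite !ler_norml; apply/andP.
  have := ler_norm (a - b); have := ler_norm (b - a); rewrite distrC.
  by case: (leP (- a) 0) => ha; case: (leP (- b) 0) => hb hc hd; split; lra.
have D0 := dotL2_ge0 leb un.
(* As [w k] pairs nonnegatively with [u], the squared norm of [un] is at most the absolute value of
   the pairing of [un - w k] with [u]. Cauchy-Schwarz applies, and [un - w k] is small because
   taking negative parts is 1-Lipschitz. *)
have key k : dotL2 leb un un ^+ 2 <= 16%:R^-1 ^+ k * dotL2 leb u u.
  have seq := sqintB (sqint_meval_on (q k)) su.
  have suw : sqint leb (fun x => un x - w k x) by exact: sqintB.
  have squ : sqint leb (fun x => u x - meval_on (q k) x) by apply: sqintB => //; exact: sqint_meval_on.
  have h1 : dotL2 leb (fun x => un x - w k x) (fun x => un x - w k x) <= 16%:R^-1 ^+ k.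
    apply: le_trans (uq k); apply: le_Rintegral => //; try exact: sqint_mul.
    by move=> x _; rewrite -!expr2 -real_normK ?num_real// -[leRHS]real_normK ?num_real// lerXn2r ?nnegrE.
  have h2 := cauchy_schwarz_L2 suw su.
  rewrite dotL2B// unu in h2.
  have h3 : dotL2 leb un un ^+ 2 <= (- dotL2 leb un un - dotL2 leb (w k) u) ^+ 2.
    rewrite -opprD sqrrN lerXn2r ?nnegrE ?addr_ge0// lerDl; exact: wu.
  apply: (le_trans h3); apply: (le_trans h2).
  by rewrite ler_wpM2r// dotL2_ge0.
have h0 : dotL2 leb un un = 0.
  by apply/eqP; rewrite -sqrf_eq0 eq_le sqr_ge0 (geometric_le0 (natinv01 R 14) key).
have : ae_eq leb setT (fun x => (un x ^+ 2)%:E) (cst 0%E).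
  apply/ae_eq_integral_abs => //; first exact: measurable_sqr.
  under eq_integral do rewrite gee0_abs ?lee_fin ?sqr_ge0//.
  by rewrite -dotL2E// h0.
apply: filterS => x /(_ Logic.I) /= [] /eqP; rewrite sqrf_eq0 => /eqP h.
by rewrite -oppr_le0; have := lexx (un x); rewrite {2}h /un ge_max => /andP[].
Qed.

End nonnegativity.

End restricted_polynomials.

Section density_constraint.
Context {R : realType} {n : nat}.
Implicit Types (P q : {mpoly R[n]}) (z zl : 'X_{1..n} -> R) (p : exponent).

Definition C_ineq p zl z P : Prop :=
  match p with
  | exponent2 => forall s : R, 0 <= riesz zl (P ^+ 2) + 2 * s * riesz z P + s ^+ 2
  | exponentoo => riesz z (P ^+ 2) <= riesz zl (P ^+ 2)
  end.

Lemma C_psdP p d zl z : C_psd p d zl z <->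
  forall P, (msize P <= d.+1)%N -> C_ineq p zl z P.
Proof.
case: p => /=; [rewrite psd_C2P|exact: psd_CooP].
by split=> H P => [Pd s|s Pd]; exact: H.
Qed.

(** Both cases are discriminants. For p = 2 the quadratic is the constraint itself; for p = oo it is
    [riesz z] of the square of [P + s], followed by domination of [riesz z (P ^+ 2)]. The bound
    serves both for the coordinates of each solution and for the L^2 continuity of the limit. *)
Lemma C_ineq_bound p zl z P :
  (forall s, 0 <= riesz z ((P + s%:MP) ^+ 2)) -> C_ineq p zl z P ->
  0 <= riesz z 1 -> 0 <= riesz zl (P ^+ 2) ->
  riesz z P ^+ 2 <= (if p is exponent2 then 1 else riesz z 1) * riesz zl (P ^+ 2).
Proof.
move=> zP CP z1 zlP; case: p CP => /= CP.
  rewrite mulrC; apply: quadratic_ge0 => // t.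
  by rewrite mulr1; exact: CP.
rewrite mulrC; apply: (@le_trans _ _ (riesz z (P ^+ 2) * riesz z 1)); last by rewrite ler_wpM2r.
apply: quadratic_ge0 => // t; have := zP t.
rewrite (_ : (P + t%:MP) ^+ 2 = P ^+ 2 + ((2 * t) *: P + (t ^+ 2) *: 1)); last first.
  rewrite sqrrD -addrA; congr (_ + (_ + _)).
    by rewrite mulrC mul_mpolyC -scaler_nat scalerA.
  by rewrite alg_mpolyC rmorphXn.
by rewrite !linearD !linearZ/= addrA.
Qed.

End density_constraint.

(** * Representation of limit functionals *)

Section limit_functional.
Context {R : realType} {n : nat} (X : set 'rV[R]_n) (X_compact : compact X).
Local Notation leb := (lebesgueV n : {measure set 'rV[R]_n -> \bar R}).
Local Notation zleb := (moment X leb).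
Variables (dyn : dynamics) (p : exponent) (f : n.-tuple {mpoly R[n]}).
Variable y : 'X_{1..n} -> R.
Hypothesis yI : forall q, Iop dyn f y q = 0.
Hypothesis y_ge0 : forall P, 0 <= riesz y (P ^+ 2).
Hypothesis yC : forall P, C_ineq p zleb y P.

Let mX := compact_measurable_rV X_compact.
Let Xoo : (leb X < +oo)%E := compact_lebesgueV_fin X_compact.

Let C : R := if p is exponent2 then 1 else riesz y 1.

Let y1 : 0 <= riesz y 1. Proof. by rewrite -(expr1n _ 2); exact: y_ge0. Qed.

Let C0 : 0 <= C. Proof. by rewrite /C; case: p. Qed.

Let yL2 P : riesz y P ^+ 2 <= C * dotL2 leb (meval_on X P) (meval_on X P).
Proof.
rewrite -(riesz_leb_sqr X_compact); apply: C_ineq_bound => //.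
by rewrite (riesz_leb_sqr X_compact) dotL2_ge0.
Qed.

Lemma limit_functional_measure : exists mu : {finite_measure set 'rV[R]_n -> \bar R},
  ac_feasible dyn (exponent_val R p) f X mu /\ forall a, y a = moment X mu a.
Proof.
have [h [q [sh hX yh hC hq]]] := riesz_L2 mX Xoo (l := riesz y)
  (fun a u v x => meval_on_linear X a u v x) (sqint_meval_on X_compact)
  (fun q x => @meval_on_notin _ _ X q x) C0 yL2.
have hae : {ae leb, forall x, 0 <= h x}.
  apply: (L2_limit_ge0 X_compact sh hX _ hq) => P.
  by rewrite -yh; exact: y_ge0.
have hball : Lp_unit_ball leb p (fun x => Num.max (h x) 0).
  rewrite /Lp_unit_ball; case Ep : p.
    (* Here [C = 1], so the norm bound supplied by [riesz_L2] is the required one. *)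
    have hle : (\int[leb]_x (h x ^+ 2)%:E <= 1)%E.
      by rewrite -dotL2E// lee_fin; move: hC; rewrite /C Ep.
    apply: le_trans hle; apply: ge0_le_integral => //.
    - by move=> x _; rewrite lee_fin sqr_ge0.
    - apply: measurable_sqr; apply: measurable_maxr => //; by case: sh.
    - by apply: measurable_sqr; case: sh.
    move=> x _; rewrite lee_fin; case: (leP (h x) 0) => // _.
    by rewrite expr0n sqr_ge0.
  (* For p = oo, [u] is [\1_X - h]. The constraint says that it pairs nonnegatively with squares,
     and it is the L^2 limit of the polynomials [1 - q k] on X. *)
  pose u x : R := meval_on X 1 x - h x.
  have s1 := sqint_meval_on X_compact 1.
  have su : sqint leb u by exact: sqintB.
  have u0 x : ~ X x -> u x = 0 by move=> Xx; rewrite /u hX// meval_on_notin// subrr.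
  have uae : {ae leb, forall x, 0 <= u x}.
    apply: (@L2_limit_ge0 _ _ X X_compact u su u0 _ (fun k => 1 - q k)) => [P|k].
      rewrite dotL2C dotL2B//; last exact: sqint_meval_on.
      rewrite dotL2C (dotL2_meval_on X_compact) mulr1 (dotL2C _ h) -yh subr_ge0.
      by have := yC P; rewrite /C_ineq Ep.
    apply: le_trans (hq k); rewrite le_eqVlt; apply/orP; left; apply/eqP.
    apply: eq_Rintegral => x _; rewrite /u.
    have -> : meval_on X (1 - q k) x = meval_on X 1 x - meval_on X (q k) x.
      by rewrite /meval_on mevalB mulrBl.
    by ring.
  apply: filterS uae => x; rewrite /u /meval_on meval1 mul1r subr_ge0 => hx.
  rewrite ge_max ler01 andbT; apply: (le_trans hx); rewrite indicE.
  by case: (_ \in _).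
(* A density must be nonnegative at every point, whereas [h] is so only almost everywhere; passing
   to the positive part changes no integral. *)
pose h' x := Num.max (h x) 0.
have mh : measurable_fun setT h by case: sh.
have mh' : measurable_fun setT h' by exact: measurable_maxr.
have h'0 x : 0 <= h' x by rewrite le_max lexx orbT.
have h'X x : ~ X x -> h' x = 0 by move=> Xx; rewrite /h' hX// maxxx.
have sh' : sqint leb h' by apply: (Lp_unit_ball_sqint mh' h'0 mX Xoo h'X hball).
have h'oo : (\int[leb]_x (h' x)%:E < +oo)%E.
  have := sqint_mul (sqint_meval_on X_compact 1) sh' => /integrableP[_].
  apply: le_lt_trans; rewrite le_eqVlt; apply/orP; left; apply/eqP.
  apply: eq_integral => x _ /=; rewrite (meval_on_in _ _ h'X) meval1 mul1r.
  by rewrite ger0_norm.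
have [mu dmu] := density_measure_exists mh' h'0 h'oo h'X.
have momE a : y a = moment X mu a.
  rewrite -[LHS](rieszX y) -[RHS](rieszX (moment X mu)) (riesz_density X_compact _ dmu) yh.
  rewrite /dotL2 /Rintegral; congr fine; apply: ae_eq_integral => //.
  - apply/measurable_EFinP; apply: measurable_funM => //.
    by have [] := sqint_meval_on X_compact 'X_[a].
  - apply/measurable_EFinP; apply: measurable_funM => //.
    by have [] := sqint_meval_on X_compact 'X_[a].
  by apply: filterS hae => x hx _; rewrite /h' max_l.
exists mu; split => //; split.
- apply/(invariant_IopP X_compact (density_notin mX dmu)) => P.
  by rewrite -[RHS](yI P); congr (Iop _ _ _ _); apply/funext => a; rewrite momE.
- by rewrite (Lp_normE _ dmu); apply/(Lnorm_le1 leb).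
- by exists h' => //; exact: Lp_unit_ball_Lfun.
Qed.

End limit_functional.

Definition truncate {R : realType} {n : nat} r (z : 'X_{1..n} -> R) :
  @truncated_seq R n r := fun b => z (bmnm b).
Arguments truncate {R n} r z.

Section truncation.
Context {R : realType} {n : nat}.

Lemma extend0_truncate r (z : 'X_{1..n} -> R) a : (mdeg a <= 2 * r)%N -> extend0 (truncate r z) a = z a.
Proof. by move=> ar; rewrite /extend0 insubT ?ltnS. Qed.

Lemma riesz_truncate r (z : 'X_{1..n} -> R) q : (msize q <= (2 * r).+1)%N ->
  riesz (extend0 (truncate r z)) q = riesz z q.
Proof.
move=> qr; apply: eq_riesz => a aq; apply: extend0_truncate.
by rewrite -ltnS; exact: leq_trans qr.
Qed.

Lemma msize_mul_le d e (p q : {mpoly R[n]}) : (msize p <= d.+1)%N -> (msize q <= e.+1)%N ->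
  (msize (p * q) <= (d + e).+1)%N.
Proof.
move=> pd qe; have [->|p0] := eqVneq p 0; first by rewrite mul0r msize0.
have [->|q0] := eqVneq q 0; first by rewrite mulr0 msize0.
rewrite msizeM//; have := leq_add pd qe; rewrite addSn addnS.
by case: (msize p + msize q)%N.
Qed.

Lemma msize_sqr_le d (p : {mpoly R[n]}) : (msize p <= d.+1)%N ->
  (msize (p ^+ 2) <= (2 * d).+1)%N.
Proof. by move=> pd; rewrite mul2n -addnn expr2 msize_mul_le. Qed.

End truncation.

Section moments_feasible.
Context {R : realType} {n m : nat} (dyn : dynamics) (p : exponent).
Variables (f : n.-tuple {mpoly R[n]}) (g : 'I_m -> {mpoly R[n]}).
Let X := semialgebraic g.
Hypothesis X_compact : compact X.
Local Notation leb := (lebesgueV n : {measure set 'rV[R]_n -> \bar R}).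
Variable mu : {finite_measure set 'rV[R]_n -> \bar R}.
Hypothesis mu_feas : ac_feasible dyn (exponent_val R p) f X mu.

Let mX := compact_measurable_rV X_compact.
Let Xoo : (leb X < +oo)%E := compact_lebesgueV_fin X_compact.

(** For p = 2, expand the squared norm of [P + s h] and use that the squared norm of [h] is at most
    1. For p = oo, integrate [P ^+ 2 * h <= P ^+ 2] over X. *)
Lemma density_C_ineq h P : is_density X mu h -> Lp_unit_ball leb p h ->
  C_ineq p (moment X leb) (moment X mu) P.
Proof.
move=> dh hball; have [mh h0 hX _] := dh.
have sh : sqint leb h by exact: (Lp_unit_ball_sqint mh h0 mX Xoo hX hball).
have sP q := sqint_meval_on X_compact q.
move: hball; rewrite /Lp_unit_ball /C_ineq; case: (p) => hball.
  move=> s; rewrite (riesz_leb_sqr X_compact) (riesz_density X_compact _ dh).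
  have h1 : dotL2 leb h h <= 1 by rewrite -lee_fin dotL2E.
  have := dotL2_ge0 leb (fun x => meval_on X P x + s * h x).
  rewrite dotL2_line// => /le_trans; apply; rewrite lerD2l.
  by rewrite ler_piMr ?sqr_ge0.
rewrite (riesz_leb X_compact) (riesz_density X_compact _ dh) /dotL2 /Rintegral.
have sM := sqint_mul (sP (P ^+ 2)) sh.
have sM1 := sqint_mul (sP P) (sP P).
have E x : meval_on X (P ^+ 2) x = meval_on X P x * meval_on X P x.
  rewrite /meval_on expr2 mevalM indicE; case: (_ \in _); rewrite ?mulr1 ?mulr0//.
apply: fine_le.
- exact: integrable_fin_num.
- under eq_integral do rewrite E.
  exact: integrable_fin_num.
apply: ae_ge0_le_integral => //.
- by move=> x _; rewrite lee_fin E mulr_ge0// -expr2 sqr_ge0.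
- exact: measurable_int sM.
- by move=> x _; rewrite lee_fin E -expr2 sqr_ge0.
- by apply/measurable_EFinP; have [] := sP (P ^+ 2).
apply: filterS hball => x hx _; rewrite lee_fin.
by rewrite ler_piMr// E -expr2 sqr_ge0.
Qed.

Lemma sdp_feasible_moments r : (r_min g <= r)%N ->
  sdp_feasible dyn p f g (truncate r (moment X mu)).
Proof.
move=> rg; have [inv mu1 [h dh _]] := mu_feas.
have [mh h0 hX _] := dh.
have hball : Lp_unit_ball leb p h.
  by apply/Lnorm_le1 => //; rewrite -(Lp_normE _ dh).
have muX := density_notin mX dh.
split.
- move=> a [ar Aa].
  have := proj1 (invariant_IopP X_compact muX f dyn) inv 'X_[a].
  by case: dyn Aa => /= Aa; rewrite !riesz_truncate// msizeX.
- apply/C_psdP => P Pr; have := density_C_ineq P dh hball; rewrite /C_ineq.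
  have P2 := msize_sqr_le Pr.
  have P1 : (msize P <= (2 * r).+1)%N by rewrite (leq_trans Pr)// ltnS mul2n -addnn leq_addr.
  by case: (p); rewrite !riesz_truncate.
- apply/psd_momentP => P Pr; rewrite riesz_truncate; last exact: msize_sqr_le.
  rewrite (riesz_moment X_compact); apply: Rintegral_ge0 => x _.
  by rewrite rmorphXn/= sqr_ge0.
- move=> j; apply/psd_localizingP => P Pr.
  have gr : (half_deg (g j) <= r)%N.
    apply: leq_trans rg; rewrite /r_min leq_max; apply/orP; right.
    exact: (leq_bigmax j).
  (* The product of [g j] and the square of [P] has degree at most [2 * r], so truncation does not
     affect it; [r_min g <= r] makes the natural subtraction exact. *)
  rewrite riesz_truncate; last first.
    apply: (@leq_trans ((2 * half_deg (g j) + 2 * (r - half_deg (g j))).+1)).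
      apply: msize_mul_le; last exact: msize_sqr_le.
      rewrite /half_deg; case: (msize (g j)) => //= k; rewrite ltnS mul2n.
      by rewrite uphalf_half doubleD -[leqLHS]odd_double_half leq_add2r; case: (odd k).
    by rewrite -mulnDr subnKC.
  rewrite (riesz_moment X_compact); apply: Rintegral_ge0 => x Xx.
  by rewrite mevalM mulr_ge0//; rewrite rmorphXn/= sqr_ge0.
Qed.

End moments_feasible.

(** If [u] is not eventually in [V], the filter [G] generated by [F] and the complement of the
    preimage of [V] is proper. An ultrafilter above it contains that complement and, by hypothesis,
    the preimage. *)
Lemma cvg_ultra (I : Type) (T : topologicalType) (F : set_system I) (FF : Filter F)
    (u : I -> T) (l : T) :
  (forall U : set_system I, UltraFilter U -> F `<=` U -> u @ U --> l) -> u @ F --> l.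
Proof.
move=> H V /= Vl; apply: contrapT => FV; rewrite /nbhs/= in FV.
pose G := [set A | F (A `|` u @^-1` V)].
have GF : ProperFilter G.
  split; first by rewrite /G/= set0U.
  split; rewrite /G/=.
  - by rewrite setTU; exact: filterT.
  - by move=> A B /= FA FB; rewrite setUIl; exact: filterI.
  - by move=> A B AB; apply: filterS; exact: setSU.
have [U [UU GU]] := ultraFilterLemma GF.
have FU : F `<=` U by move=> A FA; apply: GU; apply: filterS FA; exact: subsetUl.
have h1 : U (u @^-1` V) := H U UU FU V Vl.
have h2 : U (~` (u @^-1` V)) by apply: GU; rewrite /G/= setUCl; exact: filterT.
have UP : ProperFilter U by case: UU.
have : U set0 by rewrite -(setICr (u @^-1` V)); exact: filterI.
exact: filter_not_empty.
Qed.

Lemma ultra_bounded_cvg (R : realType) (I : Type) (U : set_system I) (UU : UltraFilter U)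
    (u : I -> R) (M : R) : U [set i | `|u i| <= M] ->
  exists l : R, u @ U --> l.
Proof.
move=> uM; have UP : ProperFilter U by case: UU.
have : compact `[- M, M]%classic by exact: segment_compact.
move=> /(_ (u @ U) _ _)[].
  have uM' : U (u @^-1` `[- M, M]).
    by apply: filterS uM => i /=; rewrite in_itv/= ler_norml.
  exact: uM'.
move=> l [_ cl]; exists l => V /= Vl.
have [//|UC] := in_ultra_setVsetC (u @^-1` V) UU.
have [x [xC xV]] := cl (~` V) V UC Vl.
by [].
Qed.

Lemma Iop_linear (R : realType) n dyn (f : n.-tuple {mpoly R[n]}) (z : 'X_{1..n} -> R) :
  linear_for *%R (Iop dyn f z).
Proof.
move=> c q q'; case: dyn => /=.
  by rewrite comp_mpolyD comp_mpolyZ !riesz_linear; ring.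
have -> : lie_deriv f (c *: q + q') = c *: lie_deriv f q + lie_deriv f q'.
  rewrite /lie_deriv scaler_sumr -big_split/=; apply: eq_bigr => i _.
  by rewrite mderivD mderivZ mulrDl scalerAl.
by rewrite linearD linearZ.
Qed.

HB.instance Definition _ (R : realType) n dyn (f : n.-tuple {mpoly R[n]})
    (z : 'X_{1..n} -> R) := GRing.isLinear.Build R {mpoly R[n]} R *%R (Iop dyn f z)
  (Iop_linear dyn f z).

Lemma riesz_cvg (R : realType) n (I : Type) (F : set_system I) (FF : Filter F)
    (u : I -> 'X_{1..n} -> R) (l : 'X_{1..n} -> R) (q : {mpoly R[n]}) :
  (forall a, u i a @[i --> F] --> l a) -> riesz (u i) q @[i --> F] --> riesz l q.
Proof.
move=> ul; rewrite /riesz; elim: (msupp q : seq _) => [|a s IHs].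
  by under eq_fun do rewrite big_nil; rewrite big_nil; exact: cvg_cst.
under eq_fun do rewrite big_cons; rewrite big_cons.
by apply: cvgD => //; apply: cvgM => //; exact: cvg_cst.
Qed.

(** * Ultrafilter limits of feasible truncated sequences *)

Section sdp_sequence.
Context {R : realType} {n m : nat} (dyn : dynamics) (p : exponent).
Variables (f : n.-tuple {mpoly R[n]}) (g : 'I_m -> {mpoly R[n]}).
Let X := semialgebraic g.
Hypothesis X_compact : compact X.
Local Notation leb := (lebesgueV n : {measure set 'rV[R]_n -> \bar R}).
Local Notation zleb := (moment X leb).
Variable y : forall r, @truncated_seq R n r.
Arguments y r : clear implicits.
Hypothesis yfeas : forall r, (r_min g <= r)%N -> sdp_feasible dyn p f g (y r).

Lemma sdp_moment_ge0 r P : (r_min g <= r)%N -> (msize P <= r.+1)%N ->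
  0 <= riesz (extend0 (y r)) (P ^+ 2).
Proof. by move=> /yfeas[_ _ /psd_momentP + _] Pr; exact. Qed.

Lemma sdp_C_ineq r P : (r_min g <= r)%N -> (msize P <= r.+1)%N ->
  C_ineq p zleb (extend0 (y r)) P.
Proof. by move=> /yfeas[_ /C_psdP + _ _] Pr; exact. Qed.

Lemma msize_addC r (P : {mpoly R[n]}) (s : R) : (msize P <= r.+1)%N -> (msize (P + s%:MP) <= r.+1)%N.
Proof.
move=> Pr; apply: leq_trans (msizeD_le _ _) _; rewrite geq_max Pr/=.
by rewrite msizeC; case: (s != 0).
Qed.

Lemma sdp_bounded a : exists M : R, forall r, (r_min g <= r)%N -> (mdeg a <= r)%N ->
  `|extend0 (y r) a| <= M.
Proof.
have zl0 P : 0 <= riesz zleb (P ^+ 2) by rewrite (riesz_leb_sqr X_compact) dotL2_ge0.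
(* For p = oo the constant of [C_ineq_bound] is the mass of [y r]; the constraint at [P = 1] bounds
   it by the Lebesgue mass of X. Hence [D] does not depend on [r], and [v ^+ 2 <= D] gives
   [|v| <= D + 1]. *)
pose D := (if p is exponent2 then 1 else riesz zleb 1) * riesz zleb ('X_[a] ^+ 2).
exists (D + 1) => r rg ar.
have ar' : (msize ('X_[a] : {mpoly R[n]}) <= r.+1)%N by rewrite msizeX ltnS.
have s1 : (msize (1 : {mpoly R[n]}) <= r.+1)%N by rewrite msize1.
have y1 : 0 <= riesz (extend0 (y r)) 1 by rewrite -(expr1n _ 2); exact: sdp_moment_ge0.
have h : riesz (extend0 (y r)) 'X_[a] ^+ 2 <= D.
  apply: le_trans (C_ineq_bound _ (sdp_C_ineq rg ar') y1 (zl0 _)) _.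
    by move=> s; apply: sdp_moment_ge0 => //; exact: msize_addC.
  rewrite /D ler_wpM2r//; have := sdp_C_ineq rg s1.
  by rewrite /C_ineq; case: p => // ; rewrite !expr1n.
rewrite rieszX in h; set v := extend0 _ _ in h *.
have D0 : 0 <= D by apply: le_trans h; rewrite sqr_ge0.
rewrite -real_normK ?num_real// in h.
by have := normr_ge0 v; nra.
Qed.

Variables (U : set_system nat) (UU : UltraFilter U) (ooU : \oo `<=` U).

Let UP : ProperFilter U. Proof. by case: UU. Qed.

Let near_ge (N : nat) (P : set nat) : (forall r, (N <= r)%N -> P r) -> U P.
Proof. by move=> NP; apply: ooU; exists N. Qed.

Lemma sdp_ultralimit : exists mu : {finite_measure set 'rV[R]_n -> \bar R},
  ac_feasible dyn (exponent_val R p) f X mu /\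
  forall a, extend0 (y r) a @[r --> U] --> moment X mu a.
Proof.
have ex a : exists l : R, extend0 (y r) a @[r --> U] --> l.
  have [M HM] := sdp_bounded a.
  apply: (ultra_bounded_cvg UU (M := M)); apply: (near_ge (N := maxn (r_min g) (mdeg a))) => r.
  by rewrite geq_max => /andP[rg ar]; exact: HM.
have [l yl] := choice ex.
have rl (q : {mpoly R[n]}) : riesz (extend0 (y r)) q @[r --> U] --> riesz l q.
  by apply: riesz_cvg => a; exact: yl.
have lim_ge0 (v : nat -> R) (c : R) N : v @ U --> c -> (forall r, (N <= r)%N -> 0 <= v r) -> 0 <= c.
  move=> vc v0; rewrite -(cvg_lim (@Rhausdorff R) vc); apply: limr_ge.
    by apply/cvg_ex; exists c.
  exact: near_ge v0.
have zl0 P : 0 <= riesz zleb (P ^+ 2) by rewrite (riesz_leb_sqr X_compact) dotL2_ge0.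
have [mu [mufeas lmu]] : exists mu : {finite_measure set 'rV[R]_n -> \bar R},
    ac_feasible dyn (exponent_val R p) f X mu /\ forall a, l a = moment X mu a.
  apply: (limit_functional_measure X_compact).
  - move=> q; rewrite [q]mpolyE linear_sum big1// => a _.
    rewrite linearZ/=; suff -> : Iop dyn f l 'X_[a] = 0 by rewrite mulr0.
    have cI : Iop dyn f (extend0 (y r)) 'X_[a] @[r --> U] --> Iop dyn f l 'X_[a].
      by case: (dyn) => /=; [apply: cvgB; exact: rl|exact: rl].
    (* From this rank on the monomial belongs to [A_set], so its invariance equation is among the
       constraints. *)
    pose N := maxn (r_min g) (maxn (mdeg a) (match dyn with
      | discrete_time => msize ('X_[a] \mPo f)
      | continuous_time => msize (lie_deriv f 'X_[a]) end)).
    have I0 r : (N <= r)%N -> Iop dyn f (extend0 (y r)) 'X_[a] = 0.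
      rewrite /N (geq_max r (r_min g)) (geq_max r (mdeg a)) => /and3P[rg ar fr].
      have [+ _ _ _] := yfeas rg; apply.
      have r2 : (r <= 2 * r)%N by rewrite mul2n -addnn leq_addr.
      split; first exact: leq_trans r2.
      by move: fr; case: (dyn) => fr; rewrite (leq_trans fr)// (leq_trans r2).
    apply: (cvg_unique (@Rhausdorff R) cI); apply: cvg_near_cst.
    by apply: (near_ge (N := N)) => r /I0 ->.
  - move=> P; apply: (lim_ge0 _ _ (maxn (r_min g) (msize P)) (rl (P ^+ 2))) => r.
    by rewrite geq_max => /andP[rg Pr]; apply: sdp_moment_ge0 => //; exact: leqW.
  - move=> P.
    have H r : (maxn (r_min g) (msize P) <= r)%N -> C_ineq p zleb (extend0 (y r)) P.
      by rewrite geq_max => /andP[rg Pr]; apply: sdp_C_ineq => //; exact: leqW.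
    rewrite /C_ineq; move: H; rewrite /C_ineq; case: (p) => H.
      move=> s; apply: (lim_ge0 (fun r =>
        riesz zleb (P ^+ 2) + 2 * s * riesz (extend0 (y r)) P + s ^+ 2) _ (maxn (r_min g) (msize P))).
        apply: cvgD; last exact: cvg_cst.
        apply: cvgD; first exact: cvg_cst.
        by apply: cvgM; [exact: cvg_cst|exact: rl].
      by move=> r /H.
    rewrite -subr_ge0.
    apply: (lim_ge0 (fun r => riesz zleb (P ^+ 2) - riesz (extend0 (y r)) (P ^+ 2)) _ (maxn (r_min g) (msize P))).
      by apply: cvgB; [exact: cvg_cst|exact: rl].
    by move=> r /H; rewrite subr_ge0.
by exists mu; split => // a; rewrite -lmu; exact: yl.
Qed.

End sdp_sequence.

Lemma Lfun_exponent_scale d (T : measurableType d) (R : realType)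
    (mu : {measure set T -> \bar R}) p (c : R) h : 0 <= c ->
  h \in Lfun mu (exponent_val R p) -> (fun x => c * h x) \in Lfun mu (exponent_val R p).
Proof.
move=> c0 hL; have hfin := Lfun_Lnorm_fin hL.
have mh : measurable_fun setT h by move: hL; rewrite inE => /andP[]; rewrite inE.
rewrite inE; apply/andP; split.
  by rewrite inE; apply: measurable_funM => //; exact: measurable_cst.
rewrite inE/= /finite_norm (LnormZ_Lfun c0 hL) -(fineK hfin) -EFinM ltry.
by [].
Qed.

(** * Feasible measures as multiples of the invariant probability *)

Section optimal_measure.
Context {R : realType} {n : nat} (X : set 'rV[R]_n) (X_compact : compact X).
Variables (dyn : dynamics) (p : exponent) (f : n.-tuple {mpoly R[n]}).
Local Notation leb := (lebesgueV n : {measure set 'rV[R]_n -> \bar R}).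
Local Notation pR := (exponent_val R p).
Implicit Types mu nu : {finite_measure set 'rV[R]_n -> \bar R}.

Let mX := compact_measurable_rV X_compact.
Let Xoo : (leb X < +oo)%E := compact_lebesgueV_fin X_compact.

Lemma density_integralZ (mu : {measure set 'rV[R]_n -> \bar R}) h c A : 0 <= c ->
  is_density X mu h -> measurable A ->
  (\int[leb]_(x in A) (c * h x)%:E = c%:E * mu A)%E.
Proof.
move=> c0 [mh h0 _ hmu] mA; rewrite hmu//; under eq_integral do rewrite EFinM.
apply: ge0_integralZl => //; last by move=> x _; rewrite lee_fin.
by apply/measurable_EFinP; exact: measurable_funTS.
Qed.

Lemma density_scale (mu nu : {measure set 'rV[R]_n -> \bar R}) h c : 0 <= c ->
  is_density X mu h -> (forall A, measurable A -> nu A = (c%:E * mu A)%E) ->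
  is_density X nu (fun x => c * h x).
Proof.
move=> c0 dh nuE; have [mh h0 hX _] := dh; split.
- by apply: measurable_funM => //; exact: measurable_cst.
- by move=> x; rewrite mulr_ge0.
- by move=> x /hX ->; rewrite mulr0.
- by move=> A mA; rewrite nuE// (density_integralZ c0 dh).
Qed.

(** Through [invariant_IopP] both dynamics are treated alike: [Iop] is homogeneous in the moments,
    and these are multiplied by [c]. *)
Lemma invariant_scale mu nu h c : 0 <= c -> is_density X mu h ->
  h \in Lfun leb pR -> (forall A, measurable A -> nu A = (c%:E * mu A)%E) ->
  invariant_measure dyn f X mu -> invariant_measure dyn f X nu.
Proof.
move=> c0 dh hL nuE; have dch := density_scale c0 dh nuE.
have [mh h0 hX _] := dh; have sh := Lfun_sqint mh h0 mX Xoo hX hL.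
move=> /(invariant_IopP X_compact (density_notin mX dh)) invmu.
apply/(invariant_IopP X_compact (density_notin mX dch)) => q.
have rE q' : riesz (moment X nu) q' = c * riesz (moment X mu) q'.
  rewrite (riesz_density X_compact _ dh) (riesz_density X_compact _ dch).
  rewrite dotL2C dotL2Z//; last exact: sqint_meval_on.
  by rewrite dotL2C.
have -> : Iop dyn f (moment X nu) q = c * Iop dyn f (moment X mu) q.
  by case: (dyn) => /=; rewrite !rE// mulrBr.
by rewrite invmu mulr0.
Qed.

Lemma density_mass mu h : is_density X mu h -> mu X = mu setT.
Proof.
move=> dh; rewrite -(setUv X) measureU//; last 2 first.
- exact: measurableC.
- exact: setICr.
by rewrite [X in (_ + X)%E](density_notin mX dh) adde0.
Qed.

Variables (mu_ac : probability 'rV[R]_n R) (h : 'rV[R]_n -> R).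
Hypothesis inv_ac : invariant_measure dyn f X mu_ac.
Hypothesis dh : is_density X mu_ac h.
Hypothesis hL : h \in Lfun leb pR.
Hypothesis uniq_ac : forall mu : probability 'rV[R]_n R,
  invariant_measure dyn f X mu -> in_Lp_plus pR X mu ->
  forall A, measurable A -> mu A = mu_ac A.

Let K : R := fine 'N[leb]_pR[EFin \o h]%E.

(** A density of norm 0 vanishes almost everywhere, and [mu_ac] would have mass 0 instead of 1. *)
Lemma ac_norm_gt0 : 0 < K.
Proof.
have Kfin := Lfun_Lnorm_fin hL; have [mh h0 _ hmu] := dh.
rewrite lt_neqAle fine_ge0 ?Lnorm_ge0// andbT eq_sym fine_eq0//; apply/eqP => K0.
have p0 : (0 < pR)%E by apply: lt_le_trans (exponent_val_ge1 p); rewrite lte01.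
have hae := Lnorm_eq0_eq0 (proj2 (measurable_EFinP _ _) mh) p0 K0.
have := probability_setT mu_ac; rewrite hmu// (ae_eq_integral (cst 0%E))//.
- by rewrite integral0 => /eqP; rewrite lt_eqF// lte01.
- exact/measurable_EFinP.
Qed.

Lemma scaled_ac_feasible nu c : 0 <= c -> c * K <= 1 ->
  (forall A, measurable A -> nu A = (c%:E * mu_ac A)%E) ->
  ac_feasible dyn pR f X nu.
Proof.
move=> c0 cK nuE; have dch := density_scale c0 dh nuE; split.
- exact: (invariant_scale c0 dh hL nuE).
- rewrite (Lp_normE _ dch) (LnormZ_Lfun c0 hL) -(fineK (Lfun_Lnorm_fin hL)).
  by rewrite -EFinM lee_fin.
- by exists (fun x => c * h x) => //; exact: Lfun_exponent_scale.
Qed.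

Lemma ac_feasible_scaled nu : ac_feasible dyn pR f X nu ->
  exists c, [/\ 0 <= c, c * K <= 1 & forall A, measurable A -> nu A = (c%:E * mu_ac A)%E].
Proof.
move=> [inv nu1 [h' dh' h'L]].
have nufin : nu setT \is a fin_num by exact: fin_num_measure.
pose a := fine (nu setT); have aE : nu setT = a%:E by rewrite fineK.
have a0 : 0 <= a by rewrite fine_ge0.
(* The zero measure cannot be normalised; it is the multiple with [c = 0]. *)
have [a0'|an0] := eqVneq a 0.
  exists 0; split; rewrite ?mul0r// => A mA; rewrite mul0e; apply/eqP.
  by rewrite -measure_le0 -[leRHS](_ : nu setT = 0%E) ?le_measure ?inE// aE a0'.
have ai0 : 0 <= a^-1 by rewrite invr_ge0.
(* [mnormalize] would fall back on [mu_ac] if the mass of [nu] were 0 or infinite; here the mass is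
   [a], finite and nonzero. *)
pose P : probability 'rV[R]_n R := mnormalize nu mu_ac.
have PE A : measurable A -> P A = (a^-1%:E * nu A)%E.
  move=> mA; rewrite /P /= /mnormalize [X in (X == 0%E) || _]aE eqe (negbTE an0)/=.
  rewrite [X in (X == +oo%E)]aE /=.
  by rewrite muleC.
have nuE A : measurable A -> nu A = (a%:E * mu_ac A)%E.
  move=> mA; rewrite -(uniq_ac (mu := P))//.
  - by rewrite PE// muleA -EFinM divff// mul1e.
  - exact: (invariant_scale ai0 dh' h'L PE).
  - exists (fun x => a^-1 * h' x); first exact: (density_scale ai0 dh' PE).
    by exact: Lfun_exponent_scale.
exists a; split => //.
move: nu1; rewrite (Lp_normE _ (density_scale a0 dh nuE)) (LnormZ_Lfun a0 hL).
by rewrite -(fineK (Lfun_Lnorm_fin hL)) -EFinM lee_fin.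
Qed.

(** The feasible measures are the multiples [c * mu_ac] with [0 <= c <= K^-1], so the largest mass
    is [K^-1]. Uniqueness asks only for a mass at least that of [mu_star], which is what is known of
    a limit of relaxations. *)
Lemma ac_problem_solution :
  exists mu_star, [/\ ac_optimal dyn pR f X mu_star,
    ac_value dyn pR f X = Lp_norm 1%:E X mu_star &
    forall nu, ac_feasible dyn pR f X nu -> (mu_star X <= nu X)%E ->
      forall A, measurable A -> nu A = mu_star A].
Proof.
have K0 := ac_norm_gt0; have Ki0 : 0 <= K^-1 by rewrite invr_ge0 ltW.
have [mh h0 hX hmu] := dh.
have acX : mu_ac X = 1%E by apply: etrans (density_mass dh) _; exact: probability_setT.
have [mu_star dstar] : exists mu : {finite_measure set 'rV[R]_n -> \bar R},
    is_density X mu (fun x => K^-1 * h x).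
  apply: density_measure_exists.
  - by apply: measurable_funM => //; exact: measurable_cst.
  - by move=> x; rewrite mulr_ge0.
  - by rewrite (density_integralZ Ki0 dh)// [X in (_ * X)%E](probability_setT mu_ac) mule1 ltry.
  - by move=> x /hX ->; rewrite mulr0.
have starE A : measurable A -> mu_star A = (K^-1%:E * mu_ac A)%E.
  by move=> mA; have [_ _ _ ->//] := dstar; exact: (density_integralZ Ki0 dh).
have starX : mu_star X = K^-1%:E by rewrite starE// acX mule1.
have sfeas : ac_feasible dyn pR f X mu_star.
  by apply: (scaled_ac_feasible Ki0) => //; rewrite mulVf// gt_eqF.
have ub nu : ac_feasible dyn pR f X nu -> (nu X <= mu_star X)%E.
  move=> /ac_feasible_scaled[c [c0 cK nuE]].
  by rewrite starX nuE// acX mule1 lee_fin -div1r ler_pdivlMr.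
have value : mu_star X = ac_value dyn pR f X.
  apply/eqP; rewrite eq_le; apply/andP; split.
    by apply: ereal_sup_ubound; exists mu_star.
  by apply: ge_ereal_sup => _ [nu nufeas <-]; exact: ub.
exists mu_star; split => //.
- rewrite -value (Lp_normE _ dstar) Lnorm1 (density_mass dstar).
  have [_ s0 _ ->//] := dstar; apply: eq_integral => x _ /=.
  by rewrite ger0_norm// s0.
- move=> nu nufeas starnu A mA; have nuX := ub _ nufeas.
  have {starnu nuX} : nu X = mu_star X by apply/eqP; rewrite eq_le nuX.
  have [c [_ _ nuE]] := ac_feasible_scaled nufeas.
  by rewrite starX nuE// acX mule1 => -[cE]; rewrite nuE// starE// cE.
Qed.

End optimal_measure.
Theorem lemma3p8 (R : realType) (n m : nat)
    (dyn : dynamics) (p : exponent)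
    (f : n.-tuple {mpoly R[n]}) (g : 'I_m -> {mpoly R[n]})
    (X := semialgebraic g) (pR := exponent_val R p)
    (X_compact : compact X)
    (ball_constraint : exists (j : 'I_m) (N : int),
      g j = (N%:~R)%:MP - \sum_(i < n) 'X_i ^+ 2)
    (unique_ac : exists mu_ac : probability 'rV[R]_n R,
      [/\ invariant_measure dyn f X mu_ac, in_Lp_plus pR X mu_ac &
          forall mu : probability 'rV[R]_n R,
            invariant_measure dyn f X mu -> in_Lp_plus pR X mu ->
            forall A, measurable A -> mu A = mu_ac A]) :
  exists mu_star : {finite_measure set 'rV[R]_n -> \bar R},
    [/\ ac_optimal dyn pR f X mu_star,
        (forall mu : {finite_measure set 'rV[R]_n -> \bar R},
          ac_optimal dyn pR f X mu ->
          forall A, measurable A -> mu A = mu_star A) &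
        forall y : (forall r, @truncated_seq R n r),
          (forall r, (r_min g <= r)%N -> sdp_optimal dyn p f g (y r)) ->
          exists y_star : 'X_{1..n} -> R,
            [/\ forall a : 'X_{1..n}, extend0 (y r) a @[r --> \oo] --> y_star a,
                forall a : 'X_{1..n}, y_star a = moment X mu_star a,
                sdp_value dyn p f g r @[r --> \oo] --> ac_value dyn pR f X &
                ac_value dyn pR f X = Lp_norm 1%:E X mu_star]].
Proof.
have [mu_ac [inv_ac [h dh hL] uniq_ac]] := unique_ac.
have [mu_star [opt value uniq]] := ac_problem_solution X_compact inv_ac dh hL uniq_ac.
have [star_feas starX] := opt.
exists mu_star; split => // [mu [mu_feas muX]|y yopt].
  by apply: uniq => //; rewrite muX starX.
have mass0 (mu : {finite_measure set 'rV[R]_n -> \bar R}) : (moment X mu 0%MM)%:E = mu X.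
  rewrite /moment; under eq_Rintegral do rewrite mpolyX0 meval1.
  rewrite /Rintegral integral_cst//; last exact: compact_measurable_rV.
  by rewrite mul1e fineK// fin_num_measure//; exact: compact_measurable_rV.
have yfeas r : (r_min g <= r)%N -> sdp_feasible dyn p f g (y r) by move=> /yopt[].
have ymass r : (r_min g <= r)%N -> moment X mu_star 0%MM <= extend0 (y r) 0%MM.
  move=> rg; have [_ yE] := yopt r rg; rewrite -lee_fin yE.
  apply: ereal_sup_ubound; exists (truncate r (moment X mu_star)).
    exact: sdp_feasible_moments.
  by rewrite extend0_truncate// mdeg0.
have ycvg a : extend0 (y r) a @[r --> \oo] --> moment X mu_star a.
  apply: cvg_ultra => U UU ooU; have UP : ProperFilter U by case: UU.
  have [mu [mu_feas mucvg]] := sdp_ultralimit X_compact yfeas UU ooU.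
  rewrite [moment X mu_star a](_ : _ = moment X mu a); first exact: mucvg.
  rewrite /moment /Rintegral; congr fine; apply: eq_measure_integral => A mA _.
  (* It remains to compare masses: the mass of the limit measure is a limit along [U] of numbers
     that, from [r_min g] on, are at least the mass of [mu_star]. *)
  apply/esym; apply: uniq => //; rewrite -!mass0 lee_fin.
  rewrite -(cvg_lim (@Rhausdorff R) (mucvg 0%MM)); apply: limr_ge.
    by apply/cvg_ex; exists (moment X mu 0%MM); exact: mucvg.
  by apply: ooU; exists (r_min g) => // r; exact: ymass.
exists (moment X mu_star); split => //.
rewrite -starX -mass0; apply: (@cvg_trans _ ((extend0 (y r) 0%MM)%:E @[r --> \oo])).
  (* The SDP value is attained by [y r] only from [r_min g] on, so the two sequences agree
     eventually. *)
  apply: near_eq_cvg; exists (r_min g) => // r rg /=.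
  by have [_ ->] := yopt r rg.
by apply: cvg_EFin; [exact: nearW|exact: ycvg].
Qed.
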